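(* Let $U_s$ be an arbitrary admissible shear flow. There exist positive constants $\bar\nu,K,S,\eta$ such that, for every $\nu\in(0,\bar\nu]$ and every integer $k\geqslant1$ with $k\geqslant K$ and $k\nu^{3/4}\geqslant S$, there exists $\lambda_{k,\nu}\in\mathbb{C}$ with $\operatorname{Re}\lambda_{k,\nu}\geqslant\eta\nu^{3/4}k^2$ such that the linearized IBL system around $U_s$ displays a $(\lambda_{k,\nu},k)$ instability.
   Context: **Admissible shear flows.** Let $\mathbb{R}_+=[0,\infty)$. A weight is a (locally absolutely continuous) function $\omega:\mathbb{R}_+\to[1,\infty)$ with $C_\omega:=\max\left(\|1/\omega\|_{L^1},\|\omega'/\omega\|_{L^\infty},\left\|\frac{\ln\omega(y)}{1+y}\right\|_{L^\infty}\right)<\infty$; set $\|\psi\|_{L^2(\omega)}^2:=\int_0^\infty|\psi|^2\omega\,dy$. An admissible shear flow is a function $U_s\in C^\infty(\mathbb{R}_+,[0,1))$ with $U_s(0)=0$, $U_s(+\infty)=1$, $U_s'>0$, $U_s''(0)\neq0$, such that $U_s''$ has finitely many zeros in $[0,\infty)$, and such that for some weight $\omega$: (i) $\Delta_s:=\int_0^\infty(1-U_s)\,dy<\infty$; (ii) $U_s^{(j)}\in L^\infty$ for $1\leqslant j\leqslant3$; (iii) $1-U_s\in L^2(\omega)$ and $y\mapsto(1+y)U_s^{(j)}(y)\in L^2(\omega)$ for $1\leqslant j\leqslant3$; (iv) $\lim_{y\to\infty}\frac{(1-U_s(y))^2}{U_s'(y)}=0$, $\lim_{y\to\infty}(1-U_s(y))y=0$,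 and $\frac{(1-U_s)^2}{(U_s')^2}U_s''\in L^1(\mathbb{R}_+)$; (v) there exist $0<\kappa<\frac12$ and $y_\kappa,c_\kappa>0$ with $(1-U_s(y))^{2-\kappa}U_s''(y)\leqslant-c_\kappa(U_s'(y))^3$ for $y\geqslant y_\kappa$. **Linearized IBL (Interactive Boundary Layer) system.** Let $\nu>0$. For $t>0$, $x\in\mathbb{T}=\mathbb{R}/2\pi\mathbb{Z}$, $y>0$, with unknowns $U,V$ (functions of $(t,x,y)$, mean-free in $x$) and $u_e$ (function of $(t,x)$, mean-free in $x$): $$\partial_tU+U_s\partial_xU+VU_s'-\partial_y^2U=\partial_tu_e+\partial_xu_e,\qquad\partial_xU+\partial_yV=0,$$ $$U|_{y=0}=V|_{y=0}=0,\qquad\lim_{y\to+\infty}U=u_e,\qquad u_e=\sqrt{\nu}\,\mathcal{DN}\int_0^{+\infty}(u_e-U)\,dy,$$ where $\mathcal{DN}$ is the Fourier multiplier in $x$ given by $\widehat{\mathcal{DN}f}(k)=|k|\hat f(k)$, $k\in\mathbb{Z}$. **Instability.** For an integer $k\geqslant1$ and $\lambda\in\mathbb{C}$ with $\operatorname{Re}\lambda>0$, a linear system displays a $(\lambda,k)$ instability when there exist $\mathcal{U},\mathcal{V}\in C^\infty(\mathbb{R}_+,\mathbb{C})$ such that $(U,V,u_e)(t,x,y)=e^{\lambda t}e^{ikx}(\mathcal{U}(y),\mathcal{V}(y),1)$ is a smooth solution to this system. *)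

(* Defs.v *)
From HB Require Import structures.
From mathcomp Require Import all_boot all_order all_algebra.
From mathcomp Require Import all_classical all_reals all_analysis.
From mathcomp Require Import complex.

Set Implicit Arguments.
Unset Strict Implicit.
Unset Printing Implicit Defensive.
Import Order.TTheory GRing.Theory Num.Theory.
Import numFieldNormedType.Exports.

Local Open Scope classical_set_scope.
Local Open Scope ring_scope.

(* Functions on R_+ = [0, oo) are represented by functions R -> _ whose values
   at negative arguments are irrelevant.  Functions on the circle R / 2 pi Z
   are represented by 2 pi-periodic functions on R.  C is R[i]; limits,
   derivatives and integrals of complex-valued functions are taken on the real
   and imaginary parts. *)

Section HalfLine.
Variable R : realType.
Implicit Types (f w : R -> R) (D : set R).

Notation mu := (@lebesgue_measure R).

Definition Rplus : set R := [set y | 0 <= y].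

Definition diff_quotient D f (x : R) : set_system R :=
  (fun z => (f z - f x) / (z - x)) @ within D x^'.

(* One-sided at an endpoint of D; the usual derivative in its interior. *)
Definition derivable_in D f (x : R) : Prop := cvg (diff_quotient D f x).
Definition derive_in D f (x : R) : R := lim (diff_quotient D f x).

(* f^{(j)} on the closed half-line. *)
Definition derivn_plus (j : nat) f : R -> R := iter j (derive_in Rplus) f.

Definition smooth_plus f : Prop :=
  forall (j : nat) (y : R), 0 <= y -> derivable_in Rplus (derivn_plus j f) y.

Definition Lnorm_plus (p : \bar R) f : \bar R :=
  'N[mu]_p[EFin \o (fun y => if 0 <= y then f y else 0)].

Definition in_Lp_plus (p : \bar R) f : Prop :=
  measurable_fun Rplus f /\ (Lnorm_plus p f < +oo)%E.

Definition in_L2_weight w f : Prop :=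
  measurable_fun Rplus f /\
  (\int[mu]_(y in Rplus) (`|f y| ^+ 2 * w y)%:E < +oo)%E.

Definition abs_continuous_on (a b : R) f : Prop :=
  forall e : R, 0 < e -> exists2 d : R, 0 < d &
    forall (n : nat) (l r : 'I_n -> R),
      (forall i, a <= l i /\ l i <= r i /\ r i <= b) ->
      trivIset [set: 'I_n] (fun i => [set x | l i < x < r i]) ->
      \sum_(i < n) (r i - l i) < d ->
      \sum_(i < n) `|f (r i) - f (l i)| < e.

Definition locally_abs_continuous_plus f : Prop :=
  forall b : R, 0 < b -> abs_continuous_on 0 b f.

(* The derivative of a locally absolutely continuous weight exists only almost
   everywhere; the L^oo norm ignores the remaining points. *)
Definition C_weight w : \bar R :=
  maxe (Lnorm_plus 1%E (fun y => 1 / w y))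
    (maxe (Lnorm_plus +oo%E (fun y => derive_in Rplus w y / w y))
          (Lnorm_plus +oo%E (fun y => ln (w y) / (1 + y)))).

Definition is_weight w : Prop :=
  [/\ forall y, 0 <= y -> 1 <= w y,
      locally_abs_continuous_plus w &
      (C_weight w < +oo)%E].

End HalfLine.

Record admissible_shear_flow (R : realType) (Us : R -> R) : Prop := {
  asf_smooth : smooth_plus Us;
  asf_range : forall y, 0 <= y -> 0 <= Us y < 1;
  asf_zero : Us 0 = 0;
  asf_infty : Us y @[y --> +oo] --> (1 : R);
  asf_incr : forall y, 0 <= y -> 0 < derivn_plus 1 Us y;
  asf_curv : derivn_plus 2 Us 0 != 0;
  asf_inflex : finite_set [set y | 0 <= y /\ derivn_plus 2 Us y = 0];
  asf_displacement :
    (\int[@lebesgue_measure R]_(y in @Rplus R) (1 - Us y)%:E < +oo)%E;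
  asf_bounded : forall j, (1 <= j <= 3)%N ->
    in_Lp_plus +oo%E (derivn_plus j Us);
  asf_weight : exists w : R -> R,
    [/\ is_weight w,
        in_L2_weight w (fun y => 1 - Us y) &
        forall j, (1 <= j <= 3)%N ->
          in_L2_weight w (fun y => (1 + y) * derivn_plus j Us y)];
  asf_lim_quot :
    (1 - Us y) ^+ 2 / derivn_plus 1 Us y @[y --> +oo] --> (0 : R);
  asf_lim_mul : (1 - Us y) * y @[y --> +oo] --> (0 : R);
  asf_L1 : in_Lp_plus 1%E (fun y =>
    (1 - Us y) ^+ 2 / derivn_plus 1 Us y ^+ 2 * derivn_plus 2 Us y);
  asf_concave : exists kappa ykappa ckappa : R,
    [/\ 0 < kappa < 1 / 2, 0 < ykappa, 0 < ckappa &
        forall y, ykappa <= y ->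
          (1 - Us y) `^ (2 - kappa) * derivn_plus 2 Us y
            <= - ckappa * derivn_plus 1 Us y ^+ 3] }.

Section Complex.
Variable R : realType.
Implicit Types (f g : R -> R[i]) (D : set R).

Notation mu := (@lebesgue_measure R).

Definition smooth_plusC f : Prop :=
  smooth_plus (fun y => complex.Re (f y)) /\
  smooth_plus (fun y => complex.Im (f y)).

Definition cexp (z : R[i]) : R[i] :=
  (expR (complex.Re z) * cos (complex.Im z)
    +i* (expR (complex.Re z) * sin (complex.Im z)))%C.

Definition integrableC D f : Prop :=
  mu.-integrable D (fun x => (complex.Re (f x))%:E) /\
  mu.-integrable D (fun x => (complex.Im (f x))%:E).

Definition integralC D f : R[i] :=
  (\int[mu]_(x in D) complex.Re (f x)
    +i* \int[mu]_(x in D) complex.Im (f x))%C.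

Definition cvgC_infty f (l : R[i]) : Prop :=
  complex.Re (f y) @[y --> +oo] --> complex.Re l /\
  complex.Im (f y) @[y --> +oo] --> complex.Im l.

Definition period : set R := [set x | 0 <= x <= 2 * pi].

Definition periodic f : Prop := forall x, f (x + 2 * pi) = f x.

Definition mean_free f : Prop := integralC period f = 0.

Definition fourier f (k : int) : R[i] :=
  ((2 * pi)^-1)%:C%C *
  integralC period (fun x => f x * cexp (- ('i%C * (k%:~R * x)%:C%C))).

(* g = DN f, where DN is the Fourier multiplier |k|. *)
Definition is_DN f g : Prop :=
  [/\ integrableC period f, integrableC period g &
      forall k : int, fourier g k = `|k|%:~R * fourier f k].

End Complex.

Section Fields.
Variable R : realType.

Variant direction := Dt | Dx | Dy.

Definition domain : set (R * R * R) := [set p | 0 < p.1.1 /\ 0 <= p.2].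

Definition partially_derivable (d : direction) (F : R -> R -> R -> R)
    (t x y : R) : Prop :=
  match d with
  | Dt => derivable (fun s => F s x y) t 1
  | Dx => derivable (fun s => F t s y) x 1
  | Dy => derivable_in (@Rplus R) (fun s => F t x s) y
  end.

Definition partial (d : direction) (F : R -> R -> R -> R) (t x y : R) : R :=
  match d with
  | Dt => derive1 (fun s => F s x y) t
  | Dx => derive1 (fun s => F t s y) x
  | Dy => derive_in (@Rplus R) (fun s => F t x s) y
  end.

(* All iterated partial derivatives exist and are jointly continuous up to
   the boundary y = 0. *)
Definition smooth3 (F : R -> R -> R -> R) : Prop :=
  forall s : seq direction, let G := foldr partial F s in
    (forall d t x y, 0 < t -> 0 <= y -> partially_derivable d G t x y) /\
    {within domain, continuous (fun p : R * R * R => G p.1.1 p.1.2 p.2)}.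

Implicit Types (F U V : R -> R -> R -> R[i]) (ue : R -> R -> R[i]).

Definition smooth3C F : Prop :=
  smooth3 (fun t x y => complex.Re (F t x y)) /\
  smooth3 (fun t x y => complex.Im (F t x y)).

Definition partialC (d : direction) F (t x y : R) : R[i] :=
  (partial d (fun t' x' y' => complex.Re (F t' x' y')) t x y
    +i* partial d (fun t' x' y' => complex.Im (F t' x' y')) t x y)%C.

Definition lift_edge ue : R -> R -> R -> R[i] := fun t x _ => ue t x.

Record linearized_IBL (nu : R) (Us : R -> R) U V ue : Prop := {
  ibl_periodic_U : forall t y, 0 < t -> 0 <= y -> periodic (fun x => U t x y);
  ibl_periodic_V : forall t y, 0 < t -> 0 <= y -> periodic (fun x => V t x y);
  ibl_periodic_ue : forall t, 0 < t -> periodic (ue t);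
  ibl_mean_U : forall t y, 0 < t -> 0 <= y -> mean_free (fun x => U t x y);
  ibl_mean_V : forall t y, 0 < t -> 0 <= y -> mean_free (fun x => V t x y);
  ibl_mean_ue : forall t, 0 < t -> mean_free (ue t);
  ibl_momentum : forall t x y, 0 < t -> 0 < y ->
    partialC Dt U t x y + (Us y)%:C%C * partialC Dx U t x y
      + V t x y * (derivn_plus 1 Us y)%:C%C - partialC Dy (partialC Dy U) t x y
    = partialC Dt (lift_edge ue) t x y + partialC Dx (lift_edge ue) t x y;
  ibl_divergence : forall t x y, 0 < t -> 0 < y ->
    partialC Dx U t x y + partialC Dy V t x y = 0;
  ibl_wall_U : forall t x, 0 < t -> U t x 0 = 0;
  ibl_wall_V : forall t x, 0 < t -> V t x 0 = 0;
  ibl_far_field : forall t x, 0 < t -> cvgC_infty (fun y => U t x y) (ue t x);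
  ibl_displacement : forall t x, 0 < t ->
    integrableC (@Rplus R) (fun y => ue t x - U t x y);
  ibl_interaction : forall t, 0 < t -> exists2 g : R -> R[i],
    is_DN (fun x => integralC (@Rplus R) (fun y => ue t x - U t x y)) g &
    forall x, ue t x = (Num.sqrt nu)%:C%C * g x }.

(* A system is given by the predicate its solutions (U, V, u_e) satisfy. *)
Definition displays_instability
    (sys : (R -> R -> R -> R[i]) -> (R -> R -> R -> R[i]) ->
           (R -> R -> R[i]) -> Prop)
    (lambda : R[i]) (k : nat) : Prop :=
  [/\ (1 <= k)%N, 0 < complex.Re lambda &
    exists cU cV : R -> R[i],
      let mode t x := cexp (lambda * t%:C%C) * cexp ('i%C * (k%:R * x)%:C%C) in
      let U t x y := mode t x * cU y in
      let V t x y := mode t x * cV y in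
      let ue t x := mode t x * 1 in
      [/\ smooth_plusC cU, smooth_plusC cV,
          [/\ smooth3C U, smooth3C V & smooth3C (lift_edge ue)] &
          sys U V ue]].

End Fields.

(* Main.v *)
Require Import Defs.
From HB Require Import structures.
From mathcomp Require Import all_boot all_order all_algebra.
From mathcomp Require Import all_classical all_reals all_analysis.
From mathcomp Require Import measurable_realfun.
From mathcomp Require Import complex ring lra.
Import Order.TTheory GRing.Theory Num.Theory.
Import numFieldNormedType.Exports.
Local Open Scope classical_set_scope.
Local Open Scope ring_scope.
Set Implicit Arguments.
Unset Strict Implicit.
Unset Printing Implicit Defensive.

(** A mode of frequency [k] and exponent [lambda] has velocity
    [1 - w(y)] and vertical velocity [- i k (y - delta + Z(y))], where [Z] is
    the integral of [w] from [y] to infinity. The boundary conditions and the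
    interaction law become [w(0) = 1], [Z(0) = delta], [Z -> 0], with
    [delta = 1 / (k sqrt nu)], and the momentum equation, integrated once from
    infinity, becomes
      [Z'' = (lambda + i k Us) Z
             + i k (2 int_y^oo Us' Z + H0(y) - delta (1 - Us))],
    where [H0(y) = 2 int_y^oo (1 - Us) + y (1 - Us)] takes at the wall twice the
    value of the displacement thickness [Delta].

    Where the instability comes from. Let [s = k nu^(3/4)]. The phase speed
    [|lambda| / k] is of order [Delta k sqrt nu = Delta s nu^(-1/4)], large
    compared with the values of [Us]: there is no critical layer, and the
    advection of the perturbation is a small correction. At leading order the
    equation at the wall reads [lambda delta = - 2 i k Delta]: a neutral wave,
    [lambda = sigma^2] with [sigma = rho (1 - i)] and [rho^2 delta = k Delta].
    The next term is the viscous sublayer, which adds [sqrt lambda] to the right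
    hand side, hence about [sigma / delta] to [lambda]. Its real part
    [rho / delta = sqrt Delta nu^(3/4) k^2] is positive: this is the announced
    growth. All other corrections to [lambda delta] are smaller than [rho] by a
    factor [1 / s] or a power of [nu], which is why [s] must be large and [nu]
    small.

    To turn this into a proof, write [lambda = sigma^2 + sigma m / delta] with
    [m = 1 + r(0)] and [Z = delta H + X / sigma], where [H = H0 / (2 Delta)].
    The operator [d^2 - sigma^2] factors as [(d - sigma) (d + sigma)], so [X]
    solves a decaying first-order equation with [X(0) = 0] driven by [r], and [r]
    is the bounded solution of a growing one driven by [X]. The map [r |-> r] so
    defined contracts a small ball in the uniform norm ([system_contraction]),
    and its fixed point gives the eigenvalue and the mode together
    ([system_fixed_point]): freezing the exponentials at [sigma] makes their
    dependence on the unknown [lambda] disappear. The same factorization,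
    with scalar majorants, shows that [w] is integrable ([defect_L1]), from which
    [w -> 0] and [Z -> 0] follow ([decaying_mode_exists]). Smoothness is a
    bootstrap on the differential equations ([mode_smooth]), and
    [mode_instability] checks the system. The flow enters
    through its monotonicity, its finite displacement thickness, and the
    boundedness of [y Us'], which follows from concavity far from the wall
    ([shear_bounded_by_concavity]).

    Every function lives on the closed half-line, with one-sided derivatives at
    the wall. Integrals are handled through primitives and the comparison
    principle [hasD_le]; the Lebesgue integral appears only for the existence of
    primitives and for the quantities named in the system. *)

(** * One-sided calculus on the half-line *)

Section HalfLineCalculus.
Variable R : realType.
Implicit Types (f g : R -> R) (x y l : R).

Definition hasD f y l : Prop := diff_quotient (@Rplus R) f y --> l.

Definition clamp y : R := Num.max y 0.

(** Freezing [f] to the left of the origin turns continuity relative to the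
    half-line into continuity on the whole line, so that the rules of continuity
    apply as they stand. *)
Definition contP f : Prop := continuous (f \o clamp).

Lemma clamp_ge0 y : 0 <= clamp y.
Proof. by rewrite /clamp le_max lexx orbT. Qed.

Lemma clampE y : 0 <= y -> clamp y = y.
Proof. by move=> y0; rewrite /clamp max_l. Qed.

Lemma continuous_clamp : continuous clamp.
Proof.
move=> y; apply: (@continuous_max _ _ (fun x => x) (fun=> 0)) => //.
exact: cvg_cst.
Qed.

Lemma Rplus_dnbhs_proper y : 0 <= y -> ProperFilter (within (@Rplus R) y^').
Proof.
move=> y0; apply: Build_ProperFilter_ex.
rewrite /within/= => A /nbhs_ballP[e /= e0 eA].
exists (y + e / 2); apply: eA => /=.
- by rewrite /ball/= opprD addrA subrr sub0r normrN gtr0_norm ?ltr_pdivrMr//; lra.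
- by apply/eqP => h; move: e0; lra.
- by rewrite /Rplus/=; lra.
Qed.

Lemma hasD_derive f y l : 0 <= y -> hasD f y l ->
  derivable_in (@Rplus R) f y /\ derive_in (@Rplus R) f y = l.
Proof.
move=> y0 h; have PF := Rplus_dnbhs_proper y0; split.
  by rewrite /derivable_in; apply/cvg_ex; exists l.
by rewrite /derive_in; apply: (@cvg_lim _ _ _ _) => //.
Qed.

Lemma derivable_hasD f y : derivable_in (@Rplus R) f y ->
  hasD f y (derive_in (@Rplus R) f y).
Proof. by []. Qed.

Lemma hasD_ext f g y l : (forall z, 0 <= z -> f z = g z) -> 0 <= y ->
  hasD f y l -> hasD g y l.
Proof.
move=> fg y0; rewrite /hasD /diff_quotient; apply: cvg_trans.
apply: near_eq_cvg; apply: filterS (withinT _ _) => z z0.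
by rewrite !fg.
Qed.

(** The bound by [e * `|z - y|] holds trivially at [z = y], which frees the other
    arguments from the punctured neighbourhood. *)
Lemma hasD_near f y l : hasD f y l <->
  forall e, 0 < e -> exists2 d, 0 < d & forall z, 0 <= z -> `|z - y| < d ->
   `|f z - f y - l * (z - y)| <= e * `|z - y|.
Proof.
split.
  move=> /cvgrPdist_le h e e0; have := h _ e0.
  rewrite /within/= => /nbhs_ballP[d /= d0 dA]; exists d => // z z0 zy.
  have [->|zney] := eqVneq z y; first by rewrite !subrr mulr0 subr0 normr0 mulr0.
  have zy0 : z - y != 0 by rewrite subr_eq0.
  have := dA z; rewrite /ball/= distrC => /(_ zy zney z0).
  have -> : f z - f y - l * (z - y) = (z - y) * - (l - (f z - f y) / (z - y)) by field.
  by rewrite normrM normrN [in X in _ -> X]mulrC => H; rewrite ler_wpM2r.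
move=> h; apply/cvgrPdist_le => e e0; have [d d0 H] := h _ e0.
rewrite /within/=; apply/nbhs_ballP; exists d => //= z.
rewrite /ball/= distrC => zy zney z0.
have zy0 : z - y != 0 by rewrite subr_eq0.
have := H z z0 zy.
have -> : f z - f y - l * (z - y) = (z - y) * - (l - (f z - f y) / (z - y)) by field.
by rewrite normrM normrN [X in X <= _ -> _]mulrC ler_pM2r// normr_gt0.
Qed.

Lemma is_derive_hasD f y l : is_derive y 1 f l -> hasD f y l.
Proof.
move=> /is_derive1_caratheodory[g [fE cg gl]]; apply/hasD_near => e e0.
move/cvgrPdist_le : cg => /(_ _ e0) /nbhs_ballP[d /= d0 dA]; exists d => // z z0 zy.
rewrite fE -gl -mulrBl normrM ler_wpM2r// distrC.
by apply: dA; rewrite /ball/= distrC.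
Qed.

Lemma hasD_is_derive f y l : 0 < y -> hasD f y l -> is_derive y 1 f l.
Proof.
move=> y0 /hasD_near h; apply/is_derive1_caratheodory.
exists (fun z => if z == y then l else (f z - f y) / (z - y)); split.
- move=> z; case: eqVneq => [->|zy]; first by rewrite !subrr mulr0.
  by rewrite divfK // subr_eq0.
- apply/cvgrPdist_le => e e0; have [d d0 H] := h _ e0.
  apply/nbhs_ballP; exists (Num.min d y) => /=; first by rewrite lt_min d0.
  move=> z; rewrite /ball/= lt_min distrC => /andP[zd zy]; rewrite eqxx.
  case: eqVneq => [_|zney]; first by rewrite subrr normr0 ltW.
  have z0 : 0 <= z by move: zy; rewrite ltr_norml => /andP[]; lra.
  have zy0 : z - y != 0 by rewrite subr_eq0.
  have := H z z0 zd.
  have -> : f z - f y - l * (z - y) = (z - y) * - (l - (f z - f y) / (z - y)) by field.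
  by rewrite normrM normrN [X in X <= _ -> _]mulrC ler_pM2r// normr_gt0.
- by rewrite eqxx.
Qed.

Lemma hasD_cvg f y l : hasD f y l ->
  f z @[z --> within (@Rplus R) (nbhs y)] --> f y.
Proof.
move=> /hasD_near h; apply/cvgrPdist_le => e e0.
have [d d0 H] := h _ ltr01.
have K0 : 0 < `|l| + 1 by rewrite ltr_wpDl.
rewrite /within/=; apply/nbhs_ballP; exists (Num.min d (e / (`|l| + 1))) => /=.
  by rewrite lt_min d0 divr_gt0.
move=> z; rewrite /ball/= lt_min distrC => /andP[zd zy] z0.
have Hz := H z z0 zd; rewrite distrC.
have -> : f z - f y = (f z - f y - l * (z - y)) + l * (z - y) by ring.
apply: (le_trans (ler_normD _ _)); rewrite normrM.
move: zy; rewrite ltr_pdivlMr// mulrDr mulr1 => zy.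
by apply: le_trans (ltW zy); rewrite mul1r in Hz; rewrite [`|l| * _]mulrC addrC lerD2l.
Qed.

Lemma cvg_contP f : (forall y, 0 <= y ->
  f z @[z --> within (@Rplus R) (nbhs y)] --> f y) -> contP f.
Proof.
move=> h y; apply: (@cvg_comp _ _ _ clamp f _ (within (@Rplus R) (nbhs (clamp y)))).
  move=> A; rewrite {1}/within/= => hA.
  have : nbhs y (fun z => Rplus (clamp z) -> A (clamp z)).
    exact: (@continuous_clamp y _ hA).
  by apply: filterS => z; apply; exact: clamp_ge0.
by apply: h; exact: clamp_ge0.
Qed.

Lemma hasD_contP f f' : (forall y, 0 <= y -> hasD f y (f' y)) -> contP f.
Proof. by move=> h; apply: cvg_contP => y y0; apply: hasD_cvg (h _ y0). Qed.

Lemma contP_within f : contP f -> {within (@Rplus R), continuous f}.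
Proof.
move=> cf; apply: (@subspace_eq_continuous _ _ _ (f \o clamp)).
  by move=> z /set_mem z0; rewrite /= clampE.
exact: continuous_subspaceT.
Qed.

Lemma contP_cst l : contP (fun=> l).
Proof. by move=> y; exact: cvg_cst. Qed.

Lemma contP_id : contP (fun x => x).
Proof. exact: continuous_clamp. Qed.

Lemma contPD f g : contP f -> contP g -> contP (fun x => f x + g x).
Proof. by move=> cf cg y; exact: (cvgD (cf y) (cg y)). Qed.

Lemma contPM f g : contP f -> contP g -> contP (fun x => f x * g x).
Proof. by move=> cf cg y; exact: (cvgM (cf y) (cg y)). Qed.

Lemma contPN f : contP f -> contP (fun x => - f x).
Proof. by move=> cf y; exact: (cvgN (cf y)). Qed.

Lemma contPB f g : contP f -> contP g -> contP (fun x => f x - g x).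
Proof. by move=> cf cg; apply: contPD => //; exact: contPN. Qed.

Lemma contP_comp f h : contP f -> continuous h -> contP (h \o f).
Proof. by move=> cf ch y; exact: (continuous_comp (cf y) (ch _)). Qed.

Lemma contP_norm f : contP f -> contP (fun x => `|f x|).
Proof. by move=> cf; apply: (contP_comp cf); exact: norm_continuous. Qed.

Lemma hasD_cst l y : hasD (fun=> l) y 0.
Proof. by apply: is_derive_hasD; exact: is_derive_cst. Qed.

Lemma hasD_id y : hasD (fun x => x) y 1.
Proof. by apply: is_derive_hasD; exact: is_derive_id. Qed.

Lemma hasDD f g y l l' : hasD f y l -> hasD g y l' ->
  hasD (fun x => f x + g x) y (l + l').
Proof.
move=> hf hg; apply: cvg_trans (cvgD hf hg).
by apply: near_eq_cvg; apply: nearW => z; rewrite !fctE; ring.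
Qed.

Lemma hasDM f g y l l' : hasD f y l -> hasD g y l' ->
  hasD (fun x => f x * g x) y (l * g y + f y * l').
Proof.
move=> hf hg; rewrite /hasD /diff_quotient.
have gy : g z @[z --> within (@Rplus R) y^'] --> g y.
  apply: cvg_trans (hasD_cvg hg) => A; rewrite /within/=.
  by move=> hA; apply: nbhs_dnbhs.
have fy : f y @[z --> within (@Rplus R) y^'] --> f y by exact: cvg_cst.
apply: cvg_trans (cvgD (cvgM hf gy) (cvgM fy hg)).
by apply: near_eq_cvg; apply: nearW => z; rewrite !fctE /=; ring.
Qed.

Lemma hasDN f y l : hasD f y l -> hasD (fun x => - f x) y (- l).
Proof.
move=> hf; have := hasDM (hasD_cst (-1) y) hf.
by under [X in hasD X]funext do rewrite mulN1r; rewrite mul0r add0r mulN1r.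
Qed.

Lemma hasDB f g y l l' : hasD f y l -> hasD g y l' ->
  hasD (fun x => f x - g x) y (l - l').
Proof. by move=> hf hg; apply: hasDD => //; exact: hasDN. Qed.

Lemma hasDZ f c y l : hasD f y l -> hasD (fun x => c * f x) y (c * l).
Proof.
by move=> hf; have := hasDM (hasD_cst c y) hf; rewrite mul0r add0r.
Qed.

Lemma hasD_lin c y : hasD (fun x => c * x) y c.
Proof. by rewrite -[X in hasD _ _ X]mulr1; exact: hasDZ (hasD_id y). Qed.

Lemma hasD_eq f y l l' : hasD f y l -> l = l' -> hasD f y l'.
Proof. by move=> ? <-. Qed.

Lemma contP_itv f a b : 0 <= a -> contP f -> {within `[a, b], continuous f}.
Proof.
move=> a0 /contP_within; apply: continuous_subspaceW => z /=.
by rewrite /Rplus /= in_itv/= => /andP[az _]; exact: le_trans az.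
Qed.

(** The mean value theorem applied to [G - F]. This comparison principle replaces
    every estimate of an integral below: [F] and [G] are primitives, and nothing
    is said about integrability. *)
Lemma hasD_le_itv F G f g a b :
  (forall y, 0 <= y -> hasD F y (f y)) -> (forall y, 0 <= y -> hasD G y (g y)) ->
  0 <= a -> a <= b -> (forall y, a <= y -> y <= b -> f y <= g y) ->
  F b - F a <= G b - G a.
Proof.
move=> hF hG a0 ab fg.
have h y : 0 <= y -> hasD (fun x => G x - F x) y (g y - f y).
  by move=> y0; apply: hasDB; [exact: hG|exact: hF].
have [c] : exists2 c, c \in `[a, b]%R &
    (G b - F b) - (G a - F a) = (g c - f c) * (b - a).
  apply: (@MVT_segment _ (fun x => G x - F x) (fun y => g y - f y)) => //.
    move=> x; rewrite in_itv/= => /andP[ax _]; apply: hasD_is_derive.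
      exact: le_lt_trans ax.
    by apply: h; rewrite (le_trans a0)// ltW.
  by apply: contP_itv => //; apply: hasD_contP h.
rewrite in_itv/= => /andP[ac cb] E.
have : 0 <= (g c - f c) * (b - a) by rewrite mulr_ge0 ?subr_ge0 ?fg.
by rewrite -E; lra.
Qed.

Lemma hasD_le F G f g a b :
  (forall y, 0 <= y -> hasD F y (f y)) -> (forall y, 0 <= y -> hasD G y (g y)) ->
  0 <= a -> a <= b -> (forall y, a <= y -> f y <= g y) ->
  F b - F a <= G b - G a.
Proof.
by move=> hF hG a0 ab fg; apply: (hasD_le_itv hF hG) => // y ay _; exact: fg.
Qed.

(** Only continuity on the closed half-line is assumed; integrating the function
    frozen to the left of the origin from [-1] makes the origin an interior
    point. *)
Lemma primitive_exists f : contP f ->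
  exists2 F, F 0 = 0 & forall y, 0 <= y -> hasD F y (f y).
Proof.
move=> cf; pose h := f \o clamp.
pose F y := (\int[@lebesgue_measure R]_(t in `[(-1), y]) h t)%R.
exists (fun y => F y - F 0); first by rewrite subrr.
move=> y y0; rewrite -[f y]subr0; apply: hasDB; last exact: hasD_cst.
apply: is_derive_hasD.
have [] := @continuous_FTC1_closed R h (-1) y (y + 1).
- lra.
- apply: continuous_compact_integrable; first exact: segment_compact.
  exact: continuous_subspaceT.
- lra.
- exact: cf.
move=> d1 d2; have -> : f y = h y by rewrite /h/= clampE.
by rewrite -d2 derive1E; exact: derivableP.
Qed.

End HalfLineCalculus.
Arguments hasDZ {R f} c {y l}.
Arguments hasD_lin {R} c y.

(** * Complex-valued functions and exponentials *)

Section ComplexCalculus.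
Variable R : realType.
Local Notation C := R[i].
Implicit Types (x y a : R) (z w s : C) (f g F G : R -> C).
Local Notation Re := complex.Re.
Local Notation Im := complex.Im.

Lemma ReD z w : Re (z + w) = Re z + Re w. Proof. by case: z; case: w. Qed.
Lemma ImD z w : Im (z + w) = Im z + Im w. Proof. by case: z; case: w. Qed.
Lemma ReN z : Re (- z) = - Re z. Proof. by case: z. Qed.
Lemma ImN z : Im (- z) = - Im z. Proof. by case: z. Qed.
Lemma ReM z w : Re (z * w) = Re z * Re w - Im z * Im w.
Proof. by case: z; case: w. Qed.
Lemma ImM z w : Im (z * w) = Re z * Im w + Im z * Re w.
Proof. by case: z; case: w. Qed.
Lemma Re_real a : Re a%:C%C = a. Proof. by []. Qed.
Lemma Im_real a : Im a%:C%C = 0. Proof. by []. Qed.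

Lemma Re_mk a b : Re (a +i* b)%C = a. Proof. by []. Qed.
Lemma Im_mk a b : Im (a +i* b)%C = b. Proof. by []. Qed.

Lemma realCD x y : (x + y)%:C%C = x%:C%C + y%:C%C :> C.
Proof. exact: rmorphD. Qed.
Lemma realCM x y : (x * y)%:C%C = x%:C%C * y%:C%C :> C.
Proof. exact: rmorphM. Qed.
Lemma realCB x y : (x - y)%:C%C = x%:C%C - y%:C%C :> C.
Proof. exact: rmorphB. Qed.
Lemma realCN x : (- x)%:C%C = - x%:C%C :> C.
Proof. exact: rmorphN. Qed.

Definition ReImE := (Re_mk, Im_mk, ReD, ImD, ReN, ImN, ReM, ImM, Re_real, Im_real).

Lemma complex_eq z w : Re z = Re w -> Im z = Im w -> z = w.
Proof. by case: z => ? ?; case: w => ? ? /= -> ->. Qed.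

(** Preferred to the modulus because it takes its values in [R], is
    submultiplicative, and bounds the two parts separately, so that real estimates
    on the parts add up to complex ones without square roots. *)
Definition nrm z : R := `|Re z| + `|Im z|.

Lemma nrm_ge0 z : 0 <= nrm z. Proof. by rewrite addr_ge0. Qed.
Lemma nrm_Re z : `|Re z| <= nrm z. Proof. by rewrite lerDl. Qed.
Lemma nrm_Im z : `|Im z| <= nrm z. Proof. by rewrite lerDr. Qed.
Lemma nrm0 : nrm 0 = 0. Proof. by rewrite /nrm normr0 addr0. Qed.
Lemma nrm_real a : nrm a%:C%C = `|a|. Proof. by rewrite /nrm/= normr0 addr0. Qed.
Lemma nrmN z : nrm (- z) = nrm z. Proof. by rewrite /nrm !ReImE !normrN. Qed.
Lemma nrmD z w : nrm (z + w) <= nrm z + nrm w.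
Proof. by rewrite /nrm !ReImE addrACA lerD// ler_normD. Qed.
Lemma nrmB z w : nrm (z - w) <= nrm z + nrm w.
Proof. by rewrite -(nrmN w) nrmD. Qed.
Lemma nrmM z w : nrm (z * w) <= nrm z * nrm w.
Proof.
rewrite /nrm !ReImE.
have := ler_normB (Re z * Re w) (Im z * Im w).
have := ler_normD (Re z * Im w) (Im z * Re w).
rewrite !normrM; nra.
Qed.
Lemma nrm_eq0 z : nrm z = 0 -> z = 0.
Proof.
move=> h; have := nrm_Re z; have := nrm_Im z; rewrite h !normr_le0.
by move=> /eqP hi /eqP hr; apply: complex_eq.
Qed.

Lemma nrm_le_prod z w a b : nrm z <= a -> nrm w <= b -> nrm (z * w) <= a * b.
Proof.
move=> za wb; apply: le_trans (nrmM _ _) _.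
by apply: ler_pM => //; exact: nrm_ge0.
Qed.

Lemma nrm_real_le a b : 0 <= a -> a <= b -> nrm a%:C%C <= b.
Proof. by move=> a0 ab; rewrite nrm_real ger0_norm. Qed.

Lemma nrm_le_sum z w a b : nrm z <= a -> nrm w <= b -> nrm (z + w) <= a + b.
Proof. by move=> za wb; apply: le_trans (nrmD _ _) _; exact: lerD. Qed.

Lemma nrm_le_diff z w a b : nrm z <= a -> nrm w <= b -> nrm (z - w) <= a + b.
Proof. by move=> za wb; apply: le_trans (nrmB _ _) _; exact: lerD. Qed.

Definition hasDC F y z : Prop :=
  hasD (fun x => Re (F x)) y (Re z) /\ hasD (fun x => Im (F x)) y (Im z).

Definition contC F : Prop :=
  contP (fun x => Re (F x)) /\ contP (fun x => Im (F x)).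

Lemma hasDC_eq F y z w : hasDC F y z -> z = w -> hasDC F y w.
Proof. by move=> ? <-. Qed.

Lemma hasDC_ext F G y z : (forall x, 0 <= x -> F x = G x) -> 0 <= y ->
  hasDC F y z -> hasDC G y z.
Proof.
by move=> FG y0 [h1 h2]; split; [apply: (hasD_ext _ y0 h1)|apply: (hasD_ext _ y0 h2)];
  move=> x x0; rewrite FG.
Qed.

Lemma hasDC_cst z y : hasDC (fun=> z) y 0.
Proof. by split; exact: hasD_cst. Qed.

Lemma hasDC_real (h : R -> R) y l : hasD h y l -> hasDC (fun x => (h x)%:C%C) y l%:C%C.
Proof. by split => //=; exact: hasD_cst. Qed.

Lemma hasDCD F G y z w : hasDC F y z -> hasDC G y w ->
  hasDC (fun x => F x + G x) y (z + w).
Proof.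
move=> [h1 h2] [h3 h4]; split; rewrite !ReImE.
  by under [X in hasD X]funext do rewrite ReD; exact: hasDD.
by under [X in hasD X]funext do rewrite ImD; exact: hasDD.
Qed.

Lemma hasDCN F y z : hasDC F y z -> hasDC (fun x => - F x) y (- z).
Proof.
move=> [h1 h2]; split; rewrite !ReImE.
  by under [X in hasD X]funext do rewrite ReN; exact: hasDN.
by under [X in hasD X]funext do rewrite ImN; exact: hasDN.
Qed.

Lemma hasDCB F G y z w : hasDC F y z -> hasDC G y w ->
  hasDC (fun x => F x - G x) y (z - w).
Proof. by move=> h1 h2; apply: hasDCD => //; exact: hasDCN. Qed.

Lemma hasDCM F G y z w : hasDC F y z -> hasDC G y w ->
  hasDC (fun x => F x * G x) y (z * G y + F y * w).
Proof.
move=> [h1 h2] [h3 h4]; split; rewrite !ReImE.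
  under [X in hasD X]funext do rewrite ReM.
  by apply: hasD_eq (hasDB (hasDM h1 h3) (hasDM h2 h4)) _; ring.
under [X in hasD X]funext do rewrite ImM.
by apply: hasD_eq (hasDD (hasDM h1 h4) (hasDM h2 h3)) _; ring.
Qed.

Lemma hasDCZ F c y z : hasDC F y z -> hasDC (fun x => c * F x) y (c * z).
Proof. by move=> h; have := hasDCM (hasDC_cst c y) h; rewrite mul0r add0r. Qed.

Lemma hasDC_contC F f : (forall y, 0 <= y -> hasDC F y (f y)) -> contC F.
Proof.
by move=> h; split; [apply: (@hasD_contP _ _ (fun y => Re (f y)))|
  apply: (@hasD_contP _ _ (fun y => Im (f y)))] => y y0; have [] := h y y0.
Qed.

Lemma contC_cst z : contC (fun=> z).
Proof. by split; exact: contP_cst. Qed.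

Lemma contC_real (h : R -> R) : contP h -> contC (fun x => (h x)%:C%C).
Proof. by move=> ch; split => //=; exact: contP_cst. Qed.

Lemma contCD F G : contC F -> contC G -> contC (fun x => F x + G x).
Proof.
move=> [h1 h2] [h3 h4]; split.
  by under [X in contP X]funext do rewrite ReD; exact: contPD.
by under [X in contP X]funext do rewrite ImD; exact: contPD.
Qed.

Lemma contCN F : contC F -> contC (fun x => - F x).
Proof.
move=> [h1 h2]; split.
  by under [X in contP X]funext do rewrite ReN; exact: contPN.
by under [X in contP X]funext do rewrite ImN; exact: contPN.
Qed.

Lemma contCB F G : contC F -> contC G -> contC (fun x => F x - G x).
Proof. by move=> h1 h2; apply: contCD => //; exact: contCN. Qed.

Lemma contCM F G : contC F -> contC G -> contC (fun x => F x * G x).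
Proof.
move=> [h1 h2] [h3 h4]; split.
  under [X in contP X]funext do rewrite ReM.
  by apply: contPB; exact: contPM.
under [X in contP X]funext do rewrite ImM.
by apply: contPD; exact: contPM.
Qed.

Lemma contC_nrm F : contC F -> contP (fun x => nrm (F x)).
Proof. by move=> [h1 h2]; apply: contPD; exact: contP_norm. Qed.

Lemma cvgCD (F G : R -> C) (l l' : C) : cvgC_infty F l -> cvgC_infty G l' ->
  cvgC_infty (fun y => F y + G y) (l + l').
Proof.
move=> [h1 h2] [h3 h4]; split; rewrite ReImE.
  by under [X in X @ _]funext do rewrite ReD; exact: cvgD.
by under [X in X @ _]funext do rewrite ImD; exact: cvgD.
Qed.

Lemma cvgCN (F : R -> C) (l : C) : cvgC_infty F l -> cvgC_infty (fun y => - F y) (- l).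
Proof.
move=> [h1 h2]; split; rewrite ReImE.
  by under [X in X @ _]funext do rewrite ReN; exact: cvgN.
by under [X in X @ _]funext do rewrite ImN; exact: cvgN.
Qed.

Lemma cvgCM (F G : R -> C) (l l' : C) : cvgC_infty F l -> cvgC_infty G l' ->
  cvgC_infty (fun y => F y * G y) (l * l').
Proof.
move=> [h1 h2] [h3 h4]; split; rewrite ReImE.
  under [X in X @ _]funext do rewrite ReM.
  by apply: cvgB; exact: cvgM.
under [X in X @ _]funext do rewrite ImM.
by apply: cvgD; exact: cvgM.
Qed.

Lemma cvgC_cst (l : C) : cvgC_infty (fun=> l : C) l.
Proof. by split; exact: cvg_cst. Qed.

Lemma cvgC_real (f : R -> R) (l : R) : f y @[y --> +oo] --> l ->
  cvgC_infty (fun y => (f y)%:C%C) l%:C%C.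
Proof. by move=> h; split => //; exact: cvg_cst. Qed.

Lemma cexpD z w : cexp (z + w) = cexp z * cexp w.
Proof.
apply: complex_eq; rewrite /cexp !ReImE expRD ?cosD ?sinD; ring.
Qed.

Lemma cexp0 : cexp (0 : C) = 1.
Proof. by apply: complex_eq; rewrite /cexp !ReImE expR0 ?cos0 ?sin0 mul1r. Qed.

Lemma cexpN z : cexp z * cexp (- z) = 1.
Proof. by rewrite -cexpD subrr cexp0. Qed.

Lemma nrm_cexp z : nrm (cexp z) <= 2 * expR (Re z).
Proof.
rewrite /nrm /cexp !ReImE !normrM (ger0_norm (expR_ge0 _)) -mulrDr mulrC.
rewrite ler_wpM2r ?expR_ge0//.
have hc : `|cos (Im z)| <= 1 by rewrite ler_norml cos_geN1 cos_le1.
have hs : `|sin (Im z)| <= 1 by rewrite ler_norml sin_geN1 sin_le1.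
lra.
Qed.

Definition expc s y : C := cexp (s * y%:C%C).

Lemma is_derive_expR_lin (c y : R) :
  is_derive y 1 (fun x => expR (c * x)) (c * expR (c * y)).
Proof.
have h : is_derive y 1 (fun x : R => c * x) c.
  by rewrite -[X in is_derive _ _ _ X]mulr1; exact: is_deriveZ.
by have := is_derive1_comp (is_derive_expR (c * y)) h; rewrite mulrC.
Qed.

Lemma is_derive_expc s y :
  is_derive y 1 (fun x => Re (expc s x)) (Re (s * expc s y)) /\
  is_derive y 1 (fun x => Im (expc s x)) (Im (s * expc s y)).
Proof.
case: s => a b.
have E x : expc (a +i* b)%C x =
    (expR (a * x) * cos (b * x) +i* (expR (a * x) * sin (b * x)))%C.
  by rewrite /expc /cexp !ReImE /= !mulr0 subr0 add0r.
have he := is_derive_expR_lin a y.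
have hb : is_derive y 1 (fun x : R => b * x) b.
  by rewrite -[X in is_derive _ _ _ X]mulr1; exact: is_deriveZ.
have hc : is_derive y 1 (fun x : R => cos (b * x)) (- sin (b * y) * b).
  exact: (is_derive1_comp (is_derive_cos (b * y)) hb).
have hs : is_derive y 1 (fun x : R => sin (b * x)) (cos (b * y) * b).
  exact: (is_derive1_comp (is_derive_sin (b * y)) hb).
under [X in is_derive _ _ X]funext do rewrite E.
under [X in _ /\ is_derive _ _ X _]funext do rewrite E.
rewrite E /=; split.
  apply: (@is_derive_eq _ _ _ _ _ _ _ _ (is_deriveM he hc)).
  by rewrite /GRing.scale /=; ring.
apply: (@is_derive_eq _ _ _ _ _ _ _ _ (is_deriveM he hs)).
by rewrite /GRing.scale /=; ring.
Qed.

Lemma hasDC_expc s y : hasDC (expc s) y (s * expc s y).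
Proof. by have [h1 h2] := is_derive_expc s y; split; apply: is_derive_hasD. Qed.

Lemma expc0 s : expc s 0 = 1.
Proof. by rewrite /expc mulr0 cexp0. Qed.

Lemma expcK s y : expc s y * expc (- s) y = 1.
Proof. by rewrite /expc mulNr cexpN. Qed.

Lemma expcNK s y : expc (- s) y * expc s y = 1.
Proof. by rewrite mulrC expcK. Qed.

Lemma nrm_expc s y : nrm (expc s y) <= 2 * expR (Re s * y).
Proof. by apply: le_trans (nrm_cexp _) _; rewrite !ReImE mulr0 subr0. Qed.

End ComplexCalculus.
Arguments hasDCZ {R F} c {y z}.

(** * Limits at infinity and first-order equations *)

Section FirstOrder.
Variable R : realType.
Local Notation C := R[i].
Implicit Types (x y a c : R).
Local Notation Re := complex.Re.
Local Notation Im := complex.Im.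

Lemma cvgy_near (T : R -> R) l : T y @[y --> +oo] --> l ->
  forall e, 0 < e -> exists2 M, 0 <= M & forall y, M <= y -> `|T y - l| <= e.
Proof.
move=> /cvgrPdist_le h e e0; have [M [_ HM]] := h _ e0.
exists (Num.max 0 (M + 1)); first by rewrite le_max lexx.
move=> y; rewrite ge_max => /andP[_ My]; rewrite distrC; apply: HM.
by apply: lt_le_trans My; rewrite ltrDl.
Qed.

Lemma near_cvgy (T : R -> R) l :
  (forall e, 0 < e -> exists M, forall y, M <= y -> `|T y - l| <= e) ->
  T y @[y --> +oo] --> l.
Proof.
move=> h; apply/cvgrPdist_le => e e0; have [M HM] := h e e0.
exists M; split; first exact: num_real.
by move=> y My; rewrite distrC; apply: HM; exact: ltW.
Qed.

Lemma le_of_all_eps a c : (forall e, 0 < e -> a <= c + e) -> a <= c.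
Proof. by move=> h; apply/ler_addgt0Pr. Qed.

Lemma cvgy_squeeze (T S : R -> R) : (forall y, 0 <= y -> `|T y| <= S y) ->
  S y @[y --> +oo] --> 0 -> T y @[y --> +oo] --> 0.
Proof.
move=> TS hS; apply: near_cvgy => e e0; have [M M0 HM] := cvgy_near hS e0.
exists M => y My; rewrite subr0; have := HM y My; rewrite subr0.
move=> h; apply: le_trans (TS y (le_trans M0 My)) _.
by apply: le_trans h; exact: ler_norm.
Qed.

Lemma expR_decay a : 0 < a -> expR (- a * y) @[y --> +oo] --> 0.
Proof.
move=> a0; apply: near_cvgy => e e0.
exists (1 / (a * e)) => y; rewrite ler_pdivrMr ?mulr_gt0// => h.
rewrite subr0 ger0_norm ?expR_ge0// mulNr expRN.
rewrite -[leRHS]invrK lef_pV2 ?posrE ?expR_gt0 ?invr_gt0//.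
have : a * y + 1 <= expR (a * y) by rewrite addrC expR_ge1Dx.
apply: le_trans; rewrite -[leLHS]mul1r ler_pdivrMr//; nra.
Qed.

Lemma bounded_monotone_cvg (F : R -> R) c :
  (forall x y, 0 <= x -> x <= y -> F x <= F y) ->
  (forall y, 0 <= y -> F y <= c) -> exists l : R, F y @[y --> +oo] --> l.
Proof.
move=> ndF Fc.
have h : F (clamp y) @[y --> +oo] --> sup (range (F \o @clamp R)).
  apply: nondecreasing_cvgr.
    move=> x y xy /=; apply: ndF; first exact: clamp_ge0.
    by rewrite /clamp ge_max !le_max xy lexx orbT.
  by exists c => _ [y _ <-] /=; apply: Fc; exact: clamp_ge0.
exists (sup (range (F \o @clamp R))); apply: near_cvgy => e e0.
have [M M0 HM] := cvgy_near h e0; exists M => y My.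
by have := HM y My; rewrite /= clampE// (le_trans M0).
Qed.

(** A function whose derivative is dominated by that of a bounded one has a
    limit at infinity; subtracting it gives the primitive vanishing there. *)
Lemma tail_exists (phi psi Psi : R -> R) c : contP phi ->
  (forall y, 0 <= y -> `|phi y| <= psi y) ->
  (forall y, 0 <= y -> hasD Psi y (psi y)) ->
  (forall y, 0 <= y -> Psi y <= c) ->
  exists2 T, (forall y, 0 <= y -> hasD T y (phi y)) & T y @[y --> +oo] --> 0.
Proof.
move=> cphi dom dPsi Psic; have [F F0 dF] := primitive_exists cphi.
have psi0 y : 0 <= y -> 0 <= psi y by move=> /dom; apply: le_trans.
have [|l1 h1] := @bounded_monotone_cvg Psi c _ Psic.
  move=> x y x0 xy; rewrite -subr_ge0.
  have := @hasD_le _ (fun=> 0) Psi (fun=> 0) psi x y.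
  rewrite subrr; apply => //; first by move=> *; exact: hasD_cst.
  by move=> z xz; apply: psi0; exact: le_trans xz.
have dFP y : 0 <= y -> hasD (fun x => F x + Psi x) y (phi y + psi y).
  by move=> y0; apply: hasDD; [exact: dF|exact: dPsi].
have Fle y : 0 <= y -> F y <= Psi y - Psi 0.
  move=> y0; have := hasD_le dF dPsi (lexx 0) y0; rewrite F0 subr0; apply => z z0.
  by apply: le_trans (ler_norm _) (dom z z0).
have [||l2 h2] := @bounded_monotone_cvg (fun x => F x + Psi x) (c - Psi 0 + c).
- move=> x y x0 xy; rewrite -subr_ge0.
  have := @hasD_le _ (fun=> 0) (fun x => F x + Psi x) (fun=> 0)
     (fun y => phi y + psi y) x y.
  rewrite subrr; apply => //; first by move=> *; exact: hasD_cst.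
  move=> z xz; have := dom z (le_trans x0 xz).
  by rewrite ler_norml => /andP[]; lra.
- by move=> y y0; have := Fle y y0; have := Psic y y0; lra.
exists (fun y => F y - (l2 - l1)).
  by move=> y y0; apply: hasD_eq (hasDB (dF y y0) (hasD_cst (l2 - l1) y)) (subr0 _).
have hc : (fun _ : R => l2 - l1) y @[y --> +oo] --> l2 - l1 by exact: cvg_cst.
have := cvgB (cvgB h2 h1) hc; rewrite subrr => h3.
apply: near_cvgy => e e0; have [M _ HM] := cvgy_near (h3 _ _) e0.
by exists M => y /HM; rewrite !fctE /= addrK.
Qed.

(** The increments of [T] are dominated by those of [Psi]; let the right end go to
    infinity. *)
Lemma tail_bound (phi psi T Psi : R -> R) c :
  (forall y, 0 <= y -> hasD T y (phi y)) -> T y @[y --> +oo] --> 0 ->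
  (forall y, 0 <= y -> `|phi y| <= psi y) ->
  (forall y, 0 <= y -> hasD Psi y (psi y)) ->
  (forall y, 0 <= y -> Psi y <= c) ->
  forall y, 0 <= y -> `|T y| <= c - Psi y.
Proof.
move=> dT T0 dom dPsi Psic y y0; apply: le_of_all_eps => e e0.
have [M M0 HM] := cvgy_near T0 e0.
pose x := Num.max M y.
have yx : y <= x by rewrite le_max lexx orbT.
have x0 := le_trans y0 yx.
have := HM x; rewrite subr0 le_max lexx => /(_ isT) Tx.
have h1 : T x - T y <= Psi x - Psi y.
  apply: (hasD_le dT dPsi) => // z yz.
  by apply: le_trans (ler_norm _) (dom _ (le_trans y0 yz)).
have h2 : (fun z => - T z) x - (fun z => - T z) y <= Psi x - Psi y.
  apply: (@hasD_le _ (fun z => - T z) Psi (fun z => - phi z) psi) => //.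
    by move=> z z0; apply: hasDN; exact: dT.
  move=> z yz.
  by have := dom _ (le_trans y0 yz); rewrite ler_norml => /andP[]; lra.
have := Psic x x0; move: Tx h2; rewrite !ler_norml /=; lra.
Qed.

(** If [l] were not zero, [f] would eventually grow at least like [`|l| / 2 * y]. *)
Lemma bounded_derivative_limit (f g : R -> R) (l B : R) :
  (forall y, 0 <= y -> hasD f y (g y)) -> g y @[y --> +oo] --> l ->
  (forall y, 0 <= y -> `|f y| <= B) -> l = 0.
Proof.
move=> df gl fB; apply/eqP; case: eqVneq => // l0; exfalso.
have l2 : 0 < `|l| / 2 by rewrite divr_gt0 ?normr_gt0.
have [M M0 HM] := cvgy_near gl l2.
have B0 : 0 <= B by apply: le_trans (fB 0 (lexx _)).
pose y := M + (4 * B + 1) / `|l|.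
have yM : y - M = (4 * B + 1) / `|l| by rewrite /y; ring.
have yM0 : 0 <= y - M by rewrite yM divr_ge0 //; lra.
have My : M <= y by rewrite -subr_ge0.
have y0 := le_trans M0 My.
have := fB _ M0; have := fB _ y0; rewrite !ler_norml => /andP[a1 a2] /andP[a3 a4].
have key : (`|l| / 2) * (y - M) = 2 * B + 1 / 2.
  by rewrite yM; field; rewrite normr_eq0.
move: l0; rewrite neq_lt => /orP[ln|lp].
  have : f y - f M <= (- (`|l| / 2)) * y - (- (`|l| / 2)) * M.
    apply: (hasD_le df (fun z _ => hasD_lin _ z)) => // z Mz.
    by have := HM z Mz; rewrite ler_norml (ltr0_norm ln); lra.
  by move: key; nra.
have : (`|l| / 2) * y - (`|l| / 2) * M <= f y - f M.
  apply: (hasD_le (fun z _ => hasD_lin _ z) df) => // z Mz.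
  by have := HM z Mz; rewrite ler_norml (gtr0_norm lp); lra.
by move: key; nra.
Qed.

Lemma hasD_expR c y : hasD (fun x => expR (c * x)) y (c * expR (c * y)).
Proof. by apply: is_derive_hasD; exact: is_derive_expR_lin. Qed.
Arguments hasD_expR : clear implicits.

Lemma expR_lin c y : expR (c * y) * expR (- c * y) = 1.
Proof. by rewrite mulNr expRN mulfV// gt_eqF ?expR_gt0. Qed.

Lemma contC_expc (s : C) : contC (expc s).
Proof. by apply: (@hasDC_contC _ _ (fun y => s * expc s y)) => y _; exact: hasDC_expc. Qed.

(** For [r' = s r + f] with [Re s > 0], every solution but one blows up. The
    bounded one is characterized by [exp (- s y) r(y) -> 0], i.e. it is the tail
    primitive of [exp (- s y) f] times [exp (s y)]; this gives existence,
    uniqueness and estimates. *)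
Section Growing.
Variables (s : C).
Let a := Re s.
Hypothesis a_gt0 : 0 < a.

(** A scalar supersolution [S] of the same equation, with [phi] in place of the
    modulus of [f], controls [r]. A constant [S] gives the uniform estimate; the
    general case transfers integrability from [phi] to [r]. The factor [8] is
    [2 * 2 * 2]: twice the bound of [nrm] on an exponential, and once the passage
    from the parts to [nrm]. *)
Lemma growing_bound (r f : R -> C) (phi S : R -> R) B :
  (forall y, 0 <= y -> hasDC r y (s * r y + f y)) ->
  (forall y, 0 <= y -> nrm (r y) <= B) ->
  (forall y, 0 <= y -> nrm (f y) <= phi y) ->
  (forall y, 0 <= y -> hasD S y (a * S y - phi y)) ->
  (forall y, 0 <= y -> 0 <= S y) ->
  forall y, 0 <= y -> nrm (r y) <= 8 * S y.
Proof.
move=> dr rB fphi dS S0 y y0.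
pose T x := expc (- s) x * r x.
have dT x : 0 <= x -> hasDC T x (expc (- s) x * f x).
  move=> x0; apply: hasDC_eq (hasDCM (hasDC_expc _ x) (dr x x0)) _; ring.
have nT x : 0 <= x -> nrm (T x) <= 2 * B * expR (- a * x).
  move=> x0; apply: le_trans (nrmM _ _) _.
  have := nrm_expc (- s) x; rewrite ReN -/a => h.
  have -> : 2 * B * expR (- a * x) = (2 * expR (- a * x)) * B by ring.
  by apply: ler_pM; rewrite ?nrm_ge0//; exact: rB.
have lim0 : 2 * B * expR (- a * x) @[x --> +oo] --> 0.
  have h2 : (fun _ : R => 2 * B) x @[x --> +oo] --> 2 * B by exact: cvg_cst.
  by have := cvgM h2 (expR_decay a_gt0); rewrite mulr0; apply.
have nTf x : 0 <= x -> nrm (expc (- s) x * f x) <= 2 * expR (- a * x) * phi x.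
  move=> x0; apply: le_trans (nrmM _ _) _.
  have := nrm_expc (- s) x; rewrite ReN -/a => h.
  by apply: ler_pM; rewrite ?nrm_ge0//; exact: fphi.
have dPsi x : 0 <= x ->
    hasD (fun x => - (2 * expR (- a * x) * S x)) x (2 * expR (- a * x) * phi x).
  move=> x0; apply: hasD_eq.
    by apply: hasDN; apply: hasDM (dS x x0); apply: hasDZ; exact: hasD_expR.
  by rewrite /=; ring.
have Psi0 x : 0 <= x -> - (2 * expR (- a * x) * S x) <= 0.
  by move=> x0; rewrite oppr_le0 mulr_ge0 ?S0// mulr_ge0 ?expR_ge0.
have hRe : `|Re (T y)| <= 2 * expR (- a * y) * S y.
  rewrite -[leRHS]opprK -[leRHS]sub0r.
  apply: (@tail_bound (fun x => Re (expc (- s) x * f x)) _ (fun x => Re (T x)) _ _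
     _ _ _ dPsi Psi0 y y0).
  - by move=> x x0; have [] := dT x x0.
  - apply: cvgy_squeeze lim0 => x x0; apply: le_trans (nT x x0); exact: nrm_Re.
  - by move=> x x0; apply: le_trans (nTf x x0); exact: nrm_Re.
have hIm : `|Im (T y)| <= 2 * expR (- a * y) * S y.
  rewrite -[leRHS]opprK -[leRHS]sub0r.
  apply: (@tail_bound (fun x => Im (expc (- s) x * f x)) _ (fun x => Im (T x)) _ _
     _ _ _ dPsi Psi0 y y0).
  - by move=> x x0; have [] := dT x x0.
  - apply: cvgy_squeeze lim0 => x x0; apply: le_trans (nT x x0); exact: nrm_Im.
  - by move=> x x0; apply: le_trans (nTf x x0); exact: nrm_Im.
have -> : r y = expc s y * T y by rewrite /T mulrA expcK mul1r.
apply: le_trans (nrmM _ _) _.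
have := nrm_expc s y; rewrite -/a => h.
have -> : 8 * S y = (2 * expR (a * y)) * (4 * expR (- a * y) * S y).
  by transitivity (8 * (expR (a * y) * expR (- a * y)) * S y);
    [rewrite expR_lin mulr1|ring].
by apply: ler_pM; rewrite ?nrm_ge0// /nrm; lra.
Qed.

Lemma growing_bound_cst (r f : R -> C) M B :
  (forall y, 0 <= y -> hasDC r y (s * r y + f y)) ->
  (forall y, 0 <= y -> nrm (r y) <= B) ->
  (forall y, 0 <= y -> nrm (f y) <= M) ->
  forall y, 0 <= y -> nrm (r y) <= 8 * (M / a).
Proof.
move=> dr rB fM; have M0 : 0 <= M by apply: le_trans (fM 0 (lexx _)); exact: nrm_ge0.
apply: (@growing_bound r f (fun=> M) (fun=> M / a) B) => //.
  move=> y y0; apply: hasD_eq (hasD_cst _ _) _.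
  by rewrite mulrC divfK ?subrr// gt_eqF.
by move=> y y0; rewrite divr_ge0// ltW.
Qed.

Lemma growing_exists (f : R -> C) M : contC f ->
  (forall y, 0 <= y -> nrm (f y) <= M) ->
  exists2 r, (forall y, 0 <= y -> hasDC r y (s * r y + f y)) &
    forall y, 0 <= y -> nrm (r y) <= 8 * (M / a).
Proof.
move=> cf fM; have M0 : 0 <= M by apply: le_trans (fM 0 (lexx _)); exact: nrm_ge0.
pose g x := expc (- s) x * f x.
have [c1 c2] : contC g by apply: contCM => //; exact: contC_expc.
have ng x : 0 <= x -> nrm (g x) <= 2 * expR (- a * x) * M.
  move=> x0; apply: le_trans (nrmM _ _) _.
  have := nrm_expc (- s) x; rewrite ReN -/a => h.
  by apply: ler_pM; rewrite ?nrm_ge0//; exact: fM.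
have dPsi x : 0 <= x ->
    hasD (fun x => - (2 * M / a) * expR (- a * x)) x (2 * expR (- a * x) * M).
  move=> x0; apply: hasD_eq; first by apply: hasDZ; exact: hasD_expR.
  by field; rewrite gt_eqF.
have Psi0 x : 0 <= x -> - (2 * M / a) * expR (- a * x) <= 0.
  move=> x0; rewrite mulNr oppr_le0 mulr_ge0 ?expR_ge0// divr_ge0 ?mulr_ge0//.
  exact: ltW.
have dom1 x : 0 <= x -> `|Re (g x)| <= 2 * expR (- a * x) * M.
  by move=> x0; apply: le_trans (ng x x0); exact: nrm_Re.
have dom2 x : 0 <= x -> `|Im (g x)| <= 2 * expR (- a * x) * M.
  by move=> x0; apply: le_trans (ng x x0); exact: nrm_Im.
have [T1 dT1 T1v] := tail_exists c1 dom1 dPsi Psi0.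
have [T2 dT2 T2v] := tail_exists c2 dom2 dPsi Psi0.
have b1 := tail_bound dT1 T1v dom1 dPsi Psi0.
have b2 := tail_bound dT2 T2v dom2 dPsi Psi0.
pose T x : C := (T1 x +i* T2 x)%C.
have dT x : 0 <= x -> hasDC T x (g x) by move=> x0; split; [exact: dT1|exact: dT2].
exists (fun x => expc s x * T x).
  move=> y y0; apply: hasDC_eq (hasDCM (hasDC_expc s y) (dT y y0)) _.
  by rewrite /g [expc s y * (_ * _)]mulrA expcK mul1r mulrA.
move=> y y0; apply: le_trans (nrmM _ _) _.
have -> : 8 * (M / a) = (2 * expR (a * y)) * (4 * expR (- a * y) * (M / a)).
  by transitivity (8 * (expR (a * y) * expR (- a * y)) * (M / a));
    [rewrite expR_lin mulr1|ring].
apply: ler_pM; rewrite ?nrm_ge0// ?nrm_expc// /nrm !ReImE.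
have e : 2 * M / a = 2 * (M / a) by rewrite mulrA.
by have := b1 y y0; have := b2 y y0; rewrite e; lra.
Qed.

End Growing.

Section GrowingReal.
Variable a : R.
Hypothesis a_gt0 : 0 < a.

Lemma growing_majorant (phi : R -> R) M : contP phi ->
  (forall y, 0 <= y -> 0 <= phi y <= M) ->
  exists S B, [/\ forall y, 0 <= y -> hasD S y (a * S y - phi y),
    forall y, 0 <= y -> 0 <= S y & forall y, 0 <= y -> S y <= B].
Proof.
move=> cphi phiM.
pose g x := - (expR (- a * x) * phi x).
have cg : contP g.
  apply: contPN; apply: contPM => //.
  by apply: (@hasD_contP _ _ (fun y => - a * expR (- a * y))) => y _; exact: hasD_expR.
have M0 : 0 <= M by have /andP[] := phiM 0 (lexx _); exact: le_trans.
have dPsi x : 0 <= x ->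
    hasD (fun x => - (M / a) * expR (- a * x)) x (expR (- a * x) * M).
  move=> x0; apply: hasD_eq; first by apply: hasDZ; exact: hasD_expR.
  by field; rewrite gt_eqF.
have Psi0 x : 0 <= x -> - (M / a) * expR (- a * x) <= 0.
  move=> x0; rewrite mulNr oppr_le0 mulr_ge0 ?expR_ge0// divr_ge0//.
  exact: ltW.
have dom x : 0 <= x -> `|g x| <= expR (- a * x) * M.
  move=> x0; have /andP[h1 h2] := phiM x x0.
  rewrite /g normrN normrM !ger0_norm ?expR_ge0//.
  by rewrite ler_wpM2l ?expR_ge0.
have [T dT Tv] := tail_exists cg dom dPsi Psi0.
have bT := tail_bound dT Tv dom dPsi Psi0.
exists (fun x => expR (a * x) * T x), (M / a); split.
- move=> y y0; apply: hasD_eq (hasDM (hasD_expR a y) (dT y y0)) _.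
  rewrite /g.
  transitivity (a * (expR (a * y) * T y) - (expR (a * y) * expR (- a * y)) * phi y).
    ring.
  by rewrite expR_lin mul1r.
- move=> y y0; apply: mulr_ge0; first exact: expR_ge0.
  apply: le_of_all_eps => e e0; have [N N0 HN] := cvgy_near Tv e0.
  pose x := Num.max N y.
  have yx : y <= x by rewrite le_max lexx orbT.
  have := HN x; rewrite subr0 le_max lexx => /(_ isT) Tx.
  have : T x - T y <= (fun=> 0) x - (fun=> 0) y.
    apply: (hasD_le dT (fun z _ => hasD_cst _ _)) => // z yz.
    have z0 := le_trans y0 yz; have /andP[h1 _] := phiM z z0.
    by rewrite /g oppr_le0 mulr_ge0 ?expR_ge0.
  by move: Tx; rewrite ler_norml /=; lra.
- move=> y y0.
  have : T y <= (M / a) * expR (- a * y).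
    by apply: le_trans (ler_norm _) _; apply: le_trans (bT y y0) _; lra.
  move=> /(ler_wpM2l (expR_ge0 (a * y))); rewrite mulrCA expR_lin mulr1; exact.
Qed.

Lemma decaying_majorant (phi : R -> R) : contP phi ->
  (forall y, 0 <= y -> 0 <= phi y) ->
  exists2 S, S 0 = 0 & (forall y, 0 <= y -> hasD S y (- a * S y + phi y)) /\
    (forall y, 0 <= y -> 0 <= S y).
Proof.
move=> cphi phi0.
pose g x := expR (a * x) * phi x.
have cg : contP g.
  apply: contPM => //.
  by apply: (@hasD_contP _ _ (fun y => a * expR (a * y))) => y _; exact: hasD_expR.
have [E E0 dE] := primitive_exists cg.
exists (fun x => expR (- a * x) * E x); first by rewrite E0 mulr0.
split => y y0.
  apply: hasD_eq (hasDM (hasD_expR (- a) y) (dE y y0)) _.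
  rewrite /g.
  transitivity (- a * (expR (- a * y) * E y) + (expR (a * y) * expR (- a * y)) * phi y).
    ring.
  by rewrite expR_lin mul1r.
apply: mulr_ge0; first exact: expR_ge0.
have := @hasD_le _ (fun=> 0) E (fun=> 0) g 0 y.
rewrite E0 !subr0; apply => //; first by move=> *; exact: hasD_cst.
by move=> z z0; rewrite /g mulr_ge0 ?expR_ge0// phi0.
Qed.

End GrowingReal.

Section Decaying.
Variables (s : C).
Let a := Re s.
Hypothesis a_gt0 : 0 < a.

(** The counterpart of [growing_bound] for [u' = - s u + f], where the initial
    value is free: integrate [exp (s y) u] from the wall. *)
Lemma decaying_bound (u f : R -> C) (phi S : R -> R) :
  (forall y, 0 <= y -> hasDC u y (- s * u y + f y)) ->
  (forall y, 0 <= y -> nrm (f y) <= phi y) ->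
  (forall y, 0 <= y -> hasD S y (- a * S y + phi y)) -> 0 <= S 0 ->
  forall y, 0 <= y -> nrm (u y) <= 2 * nrm (u 0) * expR (- a * y) + 8 * S y.
Proof.
move=> du fphi dS S0 y y0.
pose E x := expc s x * u x.
have dE x : 0 <= x -> hasDC E x (expc s x * f x).
  move=> x0; apply: hasDC_eq (hasDCM (hasDC_expc _ x) (du x x0)) _; ring.
have nf x : 0 <= x -> nrm (expc s x * f x) <= 2 * expR (a * x) * phi x.
  move=> x0; apply: le_trans (nrmM _ _) _.
  by apply: ler_pM; rewrite ?nrm_ge0// ?nrm_expc//; exact: fphi.
pose P x := 2 * expR (a * x) * S x.
have dP x : 0 <= x -> hasD P x (2 * expR (a * x) * phi x).
  move=> x0; apply: hasD_eq.
    by apply: hasDM (dS x x0); apply: hasDZ; exact: hasD_expR.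
  by rewrite /=; ring.
have P0 : 0 <= P 0 by rewrite /P !mulr_ge0 ?expR_ge0.
have aux (h h' : R -> R) : (forall x, 0 <= x -> hasD h x (h' x)) ->
    (forall x, 0 <= x -> `|h' x| <= 2 * expR (a * x) * phi x) ->
    `|h y| <= `|h 0| + P y.
  move=> dh hb.
  have h1 : h y - h 0 <= P y - P 0.
    by apply: (hasD_le dh dP) => // z z0; apply: le_trans (ler_norm _) (hb _ z0).
  have h2 : (fun z => - h z) y - (fun z => - h z) 0 <= P y - P 0.
    apply: (@hasD_le _ (fun z => - h z) P (fun z => - h' z) _ _ _ _ dP) => //.
      by move=> z z0; apply: hasDN; exact: dh.
    by move=> z z0; have := hb _ z0; rewrite ler_norml => /andP[]; lra.
  move: h1 h2 (ler_norm (h 0)) (lerNnormlW (lexx `|h 0|)).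
  by rewrite /= => h1 h2 h3 h4; rewrite ler_norml; apply/andP; split; lra.
have hR : `|Re (E y)| <= `|Re (E 0)| + P y.
  apply: (aux (fun x => Re (E x)) (fun x => Re (expc s x * f x))).
    by move=> x x0; have [] := dE x x0.
  by move=> x x0; apply: le_trans (nf x x0); exact: nrm_Re.
have hI : `|Im (E y)| <= `|Im (E 0)| + P y.
  apply: (aux (fun x => Im (E x)) (fun x => Im (expc s x * f x))).
    by move=> x x0; have [] := dE x x0.
  by move=> x x0; apply: le_trans (nf x x0); exact: nrm_Im.
have E0 : E 0 = u 0 by rewrite /E expc0 mul1r.
rewrite E0 in hR hI.
have -> : u y = expc (- s) y * E y by rewrite /E mulrA expcNK mul1r.
apply: le_trans (nrmM _ _) _.
have he : nrm (expc (- s) y) <= 2 * expR (- a * y).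
  by have := nrm_expc (- s) y; rewrite ReN.
have hE : nrm (E y) <= nrm (u 0) + 4 * expR (a * y) * S y.
  by rewrite /nrm; move: hR hI; rewrite /P; lra.
have -> : 2 * nrm (u 0) * expR (- a * y) + 8 * S y =
   (2 * expR (- a * y)) * (nrm (u 0) + 4 * expR (a * y) * S y).
  transitivity (2 * nrm (u 0) * expR (- a * y) +
    8 * (expR (a * y) * expR (- a * y)) * S y); last by ring.
  by rewrite expR_lin mulr1.
by apply: ler_pM; rewrite ?nrm_ge0.
Qed.

Lemma decaying_bound_cst (u f : R -> C) M :
  (forall y, 0 <= y -> hasDC u y (- s * u y + f y)) -> u 0 = 0 ->
  (forall y, 0 <= y -> nrm (f y) <= M) ->
  forall y, 0 <= y -> nrm (u y) <= 8 * (M / a).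
Proof.
move=> du u0 fM; have M0 : 0 <= M by apply: le_trans (fM 0 (lexx _)); exact: nrm_ge0.
have h := @decaying_bound u f (fun=> M) (fun=> M / a) du fM.
move=> y y0; have := h _ _ y y0; rewrite u0 nrm0 mulr0 mul0r add0r; apply.
  move=> z z0; apply: hasD_eq (hasD_cst _ _) _.
  by rewrite mulNr mulrC divfK ?addNr// gt_eqF.
by rewrite divr_ge0// ltW.
Qed.

Lemma primitiveC_exists (f : R -> C) : contC f ->
  exists2 F, F 0 = 0 & forall y, 0 <= y -> hasDC F y (f y).
Proof.
move=> [c1 c2]; have [F1 F10 d1] := primitive_exists c1.
have [F2 F20 d2] := primitive_exists c2.
exists (fun x => (F1 x +i* F2 x)%C); first by rewrite F10 F20.
by move=> y y0; split; [exact: d1|exact: d2].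
Qed.

Lemma decaying_exists (f : R -> C) : contC f ->
  exists2 u, u 0 = 0 & forall y, 0 <= y -> hasDC u y (- s * u y + f y).
Proof.
move=> cf; have cg : contC (fun x => expc s x * f x).
  by apply: contCM => //; exact: contC_expc.
have [E E0 dE] := primitiveC_exists cg.
exists (fun x => expc (- s) x * E x); first by rewrite E0 mulr0.
move=> y y0; apply: hasDC_eq (hasDCM (hasDC_expc (- s) y) (dE y y0)) _.
by rewrite [expc (- s) y * (_ * _)]mulrA expcNK mul1r mulrA.
Qed.

End Decaying.

Definition tailC (F f : R -> C) : Prop :=
  [/\ forall y, 0 <= y -> hasDC F y (f y), Re (F y) @[y --> +oo] --> 0 &
    Im (F y) @[y --> +oo] --> 0].

Lemma tailC_exists (f : R -> C) (psi Psi : R -> R) c : contC f ->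
  (forall y, 0 <= y -> nrm (f y) <= psi y) ->
  (forall y, 0 <= y -> hasD Psi y (psi y)) ->
  (forall y, 0 <= y -> Psi y <= c) -> exists F, tailC F f.
Proof.
move=> [c1 c2] dom dPsi Psic.
have [|T1 d1 v1] := tail_exists c1 _ dPsi Psic.
  by move=> y y0; apply: le_trans (dom y y0); exact: nrm_Re.
have [|T2 d2 v2] := tail_exists c2 _ dPsi Psic.
  by move=> y y0; apply: le_trans (dom y y0); exact: nrm_Im.
exists (fun x => (T1 x +i* T2 x)%C); split => // y y0.
by split; [exact: d1|exact: d2].
Qed.

Lemma tailC_bound (F f : R -> C) (psi Psi : R -> R) c : tailC F f ->
  (forall y, 0 <= y -> nrm (f y) <= psi y) ->
  (forall y, 0 <= y -> hasD Psi y (psi y)) ->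
  (forall y, 0 <= y -> Psi y <= c) ->
  forall y, 0 <= y -> nrm (F y) <= 2 * (c - Psi y).
Proof.
move=> [dF F1 F2] dom dPsi Psic y y0.
have h1 := @tail_bound (fun x => Re (f x)) psi (fun x => Re (F x)) Psi c
  (fun x hx => (dF x hx).1) F1 (fun x hx => le_trans (nrm_Re _) (dom x hx)) dPsi Psic y y0.
have h2 := @tail_bound (fun x => Im (f x)) psi (fun x => Im (F x)) Psi c
  (fun x hx => (dF x hx).2) F2 (fun x hx => le_trans (nrm_Im _) (dom x hx)) dPsi Psic y y0.
by rewrite /nrm; lra.
Qed.

Lemma tailCB (F f G g : R -> C) : tailC F f -> tailC G g ->
  tailC (fun x => F x - G x) (fun x => f x - g x).
Proof.
move=> [dF F1 F2] [dG G1 G2]; split.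
- by move=> y y0; apply: hasDCB; [exact: dF|exact: dG].
- under [X in X @ _]funext do rewrite ReD ReN.
  by have := cvgB F1 G1; rewrite subrr; apply.
- under [X in X @ _]funext do rewrite ImD ImN.
  by have := cvgB F2 G2; rewrite subrr; apply.
Qed.

Lemma hasD_zero_const (f : R -> R) : (forall y, 0 <= y -> hasD f y 0) ->
  forall y, 0 <= y -> f y = f 0.
Proof.
move=> df y y0; have c0 z : 0 <= z -> hasD (fun=> 0 : R) z 0 by move=> _; exact: hasD_cst.
have h1 := hasD_le df c0 (lexx 0) y0 (fun z _ => lexx _).
have h2 := hasD_le c0 df (lexx 0) y0 (fun z _ => lexx _).
by apply/eqP; rewrite eq_le; apply/andP; split; move: h1 h2; rewrite subrr; lra.
Qed.

(** An integrable function with a bounded derivative tends to zero. The derivative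
    of [f ^+ 2] is integrable too, so [f ^+ 2] has a limit; a primitive of [f ^+ 2]
    is bounded, so by [bounded_derivative_limit] that limit is zero. *)
Lemma integrable_vanishes (f h n N : R -> R) B W V : contP f -> contP h ->
  (forall y, 0 <= y -> hasD f y (h y)) -> (forall y, 0 <= y -> `|f y| <= n y) ->
  (forall y, 0 <= y -> `|f y| <= W) -> (forall y, 0 <= y -> `|h y| <= V) ->
  (forall y, 0 <= y -> hasD N y (n y)) -> (forall y, 0 <= y -> N y <= B) ->
  f y @[y --> +oo] --> 0.
Proof.
move=> cf ch df fn fW hV dN NB.
have W0 : 0 <= W by apply: le_trans (fW 0 (lexx _)).
have V0 : 0 <= V by apply: le_trans (hV 0 (lexx _)).
have dNc c y : 0 <= y -> hasD (fun x => c * N x) y (c * n y).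
  by move=> y0; apply: hasDZ; exact: dN.
have NBc c y : 0 <= c -> 0 <= y -> c * N y <= c * B.
  by move=> c0 y0; rewrite ler_wpM2l// NB.
have d2 y : 0 <= y -> hasD (fun x => f x * f x) y (2 * (h y * f y)).
  by move=> y0; apply: hasD_eq (hasDM (df y y0) (df y y0)) _; ring.
have c2 : contP (fun y => 2 * (h y * f y)).
  by apply: contPM; [exact: contP_cst|exact: contPM].
have b2 y : 0 <= y -> `|2 * (h y * f y)| <= 2 * V * n y.
  move=> y0; rewrite -mulrA !normrM (ger0_norm (ler0n _ 2)) ler_wpM2l//.
  by apply: ler_pM => //; [exact: hV|exact: fn].
have V2 : 0 <= 2 * V by rewrite mulr_ge0.
have [T dT T0] := tail_exists c2 b2 (dNc (2 * V)) (fun y => NBc (2 * V) y V2).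
pose c := f 0 * f 0 - T 0.
have fT y : 0 <= y -> f y * f y = c + T y.
  move=> y0; have := @hasD_zero_const (fun x => f x * f x - T x) _ y y0.
  have h0 z : 0 <= z -> hasD (fun x => f x * f x - T x) z 0.
    by move=> z0; apply: hasD_eq (hasDB (d2 z z0) (dT z z0)) (subrr _).
  by move=> /(_ h0) /= e; rewrite /c -e; ring.
have lim : f y * f y @[y --> +oo] --> c.
  apply: near_cvgy => e e0; have [m m0 hm] := cvgy_near T0 e0.
  exists m => y my; have := hm y my.
  by rewrite fT ?(le_trans m0)// subr0 [c + _]addrC addrK.
have [P P0 dP] := primitive_exists (contPM cf cf).
have PB y : 0 <= y -> `|P y| <= W * (B - N 0).
  move=> y0.
  have hb z : 0 <= z -> 0 <= f z * f z <= W * n z.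
    move=> z0; rewrite -expr2 sqr_ge0/= -real_normK ?num_real// expr2.
    by apply: ler_pM => //; [exact: fW|exact: fn].
  have h1 : P y - P 0 <= W * N y - W * N 0.
    by apply: (hasD_le dP (dNc W)) => // z z0; have /andP[] := hb z z0.
  have h2 : 0 <= P y - P 0.
    have := @hasD_le _ (fun=> 0 : R) P (fun=> 0 : R) _ 0 y
      (fun z _ => hasD_cst _ _) dP (lexx 0) y0.
    by rewrite subrr; apply => z z0; have /andP[] := hb z z0.
  move: h1 h2; rewrite P0 !subr0 => h1 h2; rewrite ger0_norm//.
  by apply: le_trans h1 _; rewrite -mulrBr ler_wpM2l// lerD2r NB.
have c_eq0 : c = 0 := bounded_derivative_limit dP lim PB.
apply: near_cvgy => e e0; have e20 : 0 < e ^+ 2 by rewrite exprn_gt0.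
have [m m0 hm] := cvgy_near lim e20; exists m => y my.
have := hm y my; rewrite c_eq0 !subr0 normrM -expr2.
by rewrite ler_pXn2r// nnegrE ?normr_ge0// ltW.
Qed.

Lemma nrm_lipschitz (F f : R -> C) L :
  (forall y, 0 <= y -> hasDC F y (f y)) -> (forall y, 0 <= y -> nrm (f y) <= L) ->
  forall x y, 0 <= x -> 0 <= y -> nrm (F x - F y) <= 2 * L * `|x - y|.
Proof.
move=> dF fL.
have aux (h h' : R -> R) : (forall x, 0 <= x -> hasD h x (h' x)) ->
    (forall x, 0 <= x -> `|h' x| <= L) ->
    forall x y, 0 <= y -> y <= x -> `|h x - h y| <= L * (x - y).
  move=> dh hL x y y0 yx.
  have h1 : h x - h y <= L * x - L * y.
    apply: (hasD_le dh (fun z _ => hasD_lin L z)) => // z z0.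
    exact: le_trans (ler_norm _) (hL _ (le_trans y0 z0)).
  have h2 : (- L) * x - (- L) * y <= h x - h y.
    apply: (hasD_le (fun z _ => hasD_lin (- L) z) dh) => // z z0.
    by have := hL _ (le_trans y0 z0); rewrite ler_norml => /andP[].
  by rewrite ler_norml; move: h1 h2; lra.
have main x y : 0 <= y -> y <= x -> nrm (F x - F y) <= 2 * L * (x - y).
  move=> y0 yx; rewrite /nrm !ReImE.
  have h1 := aux (fun x => Re (F x)) (fun x => Re (f x)) (fun z hz => (dF z hz).1)
    (fun z hz => le_trans (nrm_Re _) (fL z hz)) x y y0 yx.
  have h2 := aux (fun x => Im (F x)) (fun x => Im (f x)) (fun z hz => (dF z hz).2)
    (fun z hz => le_trans (nrm_Im _) (fL z hz)) x y y0 yx.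
  by move: h1 h2; lra.
move=> x y x0 y0; have [xy|xy] := leP x y.
  rewrite -nrmN opprB distrC ger0_norm ?subr_ge0//; exact: main.
by rewrite gtr0_norm ?subr_gt0//; apply: main => //; exact: ltW.
Qed.

Lemma lipschitz_contC (F : R -> C) L : 0 <= L ->
  (forall x y, 0 <= x -> 0 <= y -> nrm (F x - F y) <= L * `|x - y|) -> contC F.
Proof.
move=> L0 hF.
have aux (h : R -> R) : (forall x y, 0 <= x -> 0 <= y ->
    `|h x - h y| <= L * `|x - y|) -> contP h.
  move=> hh; apply: cvg_contP => y y0; apply/cvgrPdist_le => e e0.
  have L1 : 0 < L + 1 by rewrite ltr_wpDl.
  apply/nbhs_ballP; exists (e / (L + 1)); first by rewrite /= divr_gt0.
  move=> z; rewrite /ball/= ltr_pdivlMr// => zy z0.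
  apply: le_trans (hh y z y0 z0) _; apply: le_trans (ltW zy).
  by rewrite mulrC ler_wpM2l// lerDl.
split; apply: aux => x y x0 y0.
  by apply: le_trans (hF x y x0 y0); rewrite -[Re _ - Re _]/(Re _ + - Re _) -ReN -ReD nrm_Re.
by apply: le_trans (hF x y x0 y0); rewrite -[Im _ - Im _]/(Im _ + - Im _) -ImN -ImD nrm_Im.
Qed.

End FirstOrder.
Arguments hasD_expR {R} c y.

(** * A fixed point theorem in the uniform norm *)

Section FixedPoint.
Variable R : realType.
Local Notation C := R[i].
Local Notation Re := complex.Re.
Local Notation Im := complex.Im.

Implicit Types x y e d : R.

Lemma geometric_small (e : R) : 0 < e -> exists n : nat, (1 / 2) ^+ n <= e.
Proof.
move=> e0; exists (Num.truncn e^-1).+1.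
set n := (Num.truncn e^-1).+1.
have hn : e^-1 < n%:R by have /andP[] := truncn_itv (ltW (etrans (invr_gt0 e) e0)).
have h2 : (n%:R : R) <= 2 ^+ n by rewrite -natrX ler_nat ltnW// ltn_expl.
rewrite expr_div_n expr1n div1r -[e]invrK lef_pV2 ?posrE ?exprn_gt0 ?invr_gt0//.
by apply: le_trans h2; exact: ltW.
Qed.

(** The limit is the supremum of the lower bounds [u n - q n], where [q n] is the
    sum of the bounds on the increments still to come. *)
Lemma geometric_limit (u : nat -> R) :
  (forall n, `|u n.+1 - u n| <= (1 / 2) ^+ n) ->
  exists l, forall n, `|u n - l| <= 2 * (1 / 2) ^+ n.
Proof.
move=> hu; pose q n : R := 2 * (1 / 2) ^+ n.
have qS n : q n = q n.+1 + (1 / 2) ^+ n by rewrite /q exprS; field.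
have inc n p : u n - q n <= u (n + p)%N - q (n + p)%N.
  elim: p => [|p IH]; first by rewrite addn0.
  apply: le_trans IH _; rewrite addnS; move: (hu (n + p)%N) (qS (n + p)%N).
  by rewrite ler_norml; lra.
have dec n p : u (n + p)%N + q (n + p)%N <= u n + q n.
  elim: p => [|p IH]; first by rewrite addn0.
  apply: le_trans IH; rewrite addnS; move: (hu (n + p)%N) (qS (n + p)%N).
  by rewrite ler_norml; lra.
have q0 n : 0 <= q n by rewrite mulr_ge0// exprn_ge0// divr_ge0.
have cross n p : u n - q n <= u p + q p.
  have := inc n p; have := dec p n; rewrite [(p + n)%N]addnC.
  by have := q0 (n + p)%N; lra.
pose A := [set u n - q n | n in setT].
have hA : has_sup A.
  split; first by exists (u 0 - q 0), 0.
  by exists (u 0 + q 0) => _ [n _ <-]; exact: cross.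
exists (sup A) => n.
have h1 : u n - q n <= sup A by apply: ub_le_sup; [exact: hA.2|exists n].
have h2 : sup A <= u n + q n.
  by apply: ge_sup; [exact: hA.1|move=> _ [p _ <-]; exact: cross].
by rewrite ler_norml; move: h1 h2; rewrite /q; lra.
Qed.

(** Banach's fixed point theorem for a relation on a set of functions on the
    half-line, in the uniform norm. The uniform Lipschitz bound passes to the
    limit and plays the part of continuity. *)
Lemma uniform_fixed_point (step : (R -> C) -> (R -> C) -> Prop) (L : R)
  (P := fun r : R -> C => (forall y, 0 <= y -> nrm (r y) <= 1 / 4) /\
    (forall x y, 0 <= x -> 0 <= y -> nrm (r x - r y) <= L * `|x - y|)) :
  0 <= L ->
  (forall r, P r -> exists2 r', P r' & step r r') ->
  (forall r1 r2 r1' r2' d, P r1 -> P r2 -> P r1' -> P r2' ->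
     step r1 r1' -> step r2 r2' ->
     (forall y, 0 <= y -> nrm (r1 y - r2 y) <= d) ->
     forall y, 0 <= y -> nrm (r1' y - r2' y) <= d / 2) ->
  exists r r', [/\ P r, P r', step r r' & forall y, 0 <= y -> r' y = r y].
Proof.
move=> L0 ex contr.
have /choice[Phi hPhi] : forall r, exists s, P r -> P s /\ step r s.
  move=> r; have [/ex[s Ps rs]|nP] := pselect (P r); first by exists s.
  by exists r.
pose rn n := iter n Phi (fun=> 0).
have P0 : P (fun=> 0).
  split => [y _|x y _ _]; rewrite ?subrr nrm0 ?divr_ge0//.
  by rewrite mulr_ge0.
have Pn n : P (rn n) by elim: n => //= n IH; exact: (hPhi _ IH).1.
have stepn n : step (rn n) (rn n.+1) by exact: (hPhi _ (Pn n)).2.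
have dn n y : 0 <= y -> nrm (rn n.+1 y - rn n y) <= (1 / 2) ^+ n.
  elim: n y => [|n IH] y y0.
    rewrite expr0 [rn 0 y]/= subr0; apply: le_trans ((Pn 1).1 y y0) _; lra.
  rewrite exprSr mulrA mulr1.
  exact: (contr _ _ _ _ _ (Pn n.+1) (Pn n) (Pn n.+2) (Pn n.+1)
    (stepn n.+1) (stepn n) IH).
have /choice[r hr] : forall y : R, exists z : C, 0 <= y ->
    forall n, nrm (rn n y - z) <= 4 * (1 / 2) ^+ n.
  move=> y; have [y0|] := boolP (0 <= y); last by exists 0.
  have [|l1 h1] := @geometric_limit (fun n => Re (rn n y)).
    move=> n; apply: le_trans (dn n y y0).
    by have := nrm_Re (rn n.+1 y - rn n y); rewrite !ReImE.
  have [|l2 h2] := @geometric_limit (fun n => Im (rn n y)).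
    move=> n; apply: le_trans (dn n y y0).
    by have := nrm_Im (rn n.+1 y - rn n y); rewrite !ReImE.
  exists (l1 +i* l2)%C => _ n; rewrite /nrm !ReImE.
  by have := h1 n; have := h2 n; lra.
have small (e : R) : 0 < e -> exists n : nat, 4 * (1 / 2) ^+ n <= e.
  move=> e0; have [|n hn] := @geometric_small (e / 4); first by rewrite divr_gt0.
  by exists n; lra.
have Pr : P r.
  split => [y y0|x y x0 y0]; apply: le_of_all_eps => e e0.
    have [n hn] := small e e0.
    have -> : r y = rn n y - (rn n y - r y) by ring.
    by apply: nrm_le_diff; [exact: (Pn n).1|apply: le_trans (hr y y0 n) hn].
  have [|n hn] := small (e / 2); first by rewrite divr_gt0.
  have -> : r x - r y = (rn n x - rn n y) - ((rn n x - r x) - (rn n y - r y)) by ring.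
  apply: nrm_le_diff; first exact: (Pn n).2.
  have -> : e = e / 2 + e / 2 by field.
  by apply: nrm_le_diff; apply: le_trans hn; apply: hr.
have [Pr' sr] := hPhi r Pr.
exists r, (Phi r); split => // y y0.
suff : nrm (Phi r y - r y) <= 0.
  move=> h; apply/eqP; rewrite -subr_eq0; apply/eqP; apply: nrm_eq0.
  by apply/eqP; rewrite eq_le h nrm_ge0.
apply: le_of_all_eps => e e0; rewrite add0r.
have [|n hn] := small (e / 2); first by rewrite divr_gt0.
have -> : Phi r y - r y = (rn n.+1 y - r y) - (rn n.+1 y - Phi r y) by ring.
have -> : e = e / 2 + e / 2 by field.
apply: nrm_le_diff.
  apply: le_trans (hr y y0 n.+1) _; apply: le_trans hn.
  have : (0 : R) <= (1 / 2) ^+ n by rewrite exprn_ge0// divr_ge0.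
  by rewrite exprS; lra.
have := contr (rn n) r (rn n.+1) (Phi r) (4 * (1 / 2) ^+ n) (Pn n) Pr (Pn n.+1) Pr'
  (stepn n) sr (fun z z0 => hr z z0 n) y y0.
by move/le_trans; apply; move: hn; lra.
Qed.

End FixedPoint.

(** * Construction of the mode *)

Section Mode.
Variable R : realType.
Local Notation C := R[i].
Local Notation Re := complex.Re.
Local Notation Im := complex.Im.
Implicit Types (x y d : R) (r X Z : R -> C).

(** [a] is the flow, [b] its derivative; [H] and [g] are the functions [H0] and
    [1 - Us + y Us'] divided by [2 Delta], so that [H 0 = 1]. The scale [rho] and
    the displacement [delta] are independent here: the relation
    [rho ^+ 2 * delta = k * Delta] enters only when the forcing
    [- sigma ^+ 2 * delta * g] is recognized as [i k (1 - Us + y Us')]. *)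
Variables (a b g H : R -> R) (M k delta rho : R).
Hypothesis a01 : forall y, 0 <= y -> 0 <= a y <= 1.
Hypothesis b_ge0 : forall y, 0 <= y -> 0 <= b y.
Variable bm : R.
Hypothesis b_bound : forall y, 0 <= y -> b y <= bm.
Hypothesis da : forall y, 0 <= y -> hasD a y (b y).
Hypothesis cb : contP b.
Hypothesis H_bound : forall y, 0 <= y -> 0 <= H y <= 3 / 2.
Hypothesis H_at0 : H 0 = 1.
Hypothesis dH : forall y, 0 <= y -> hasD H y (- g y).
Hypothesis cg : contP g.
Hypothesis gM : forall y, 0 <= y -> 0 <= g y <= M.
Hypothesis M1 : 1 <= M.
Hypothesis k0 : 0 < k.
Hypothesis delta0 : 0 < delta.
Hypothesis rho0 : 0 < rho.
(* [50 * 50] stands for a large number. The most demanding use is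
   [rforce_bound_small], which needs it to exceed [32 * (50 + 11 + 2 + 5 / 4)]. *)
Hypothesis small1 : (50 * 50) <= rho * delta.
Hypothesis small2 : (50 * 50) * (k * delta) <= rho.
Hypothesis small3 : (50 * 50) * (M * delta) <= 1.
Hypothesis small4 : (50 * 50) * M <= rho.

Definition sigma : C := (rho -i* rho)%C.
Definition sigmaV : C := ((2 * rho)^-1 +i* (2 * rho)^-1)%C.
(** The factor [m] in [lambda = sigma ^+ 2 + sigma * m / delta]: [1] is the viscous
    sublayer, [r 0] collects the other corrections. *)
Definition amp r : C := 1 + r 0.
(** The integrated defect [Z]: a slowly varying part carried by [H], and a
    correction [X / sigma] smaller by a factor [1 / (rho * delta)]. *)
Definition profile X : R -> C := fun y => (delta * H y)%:C%C + sigmaV * X y.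

Definition Xforce r : R -> C :=
  fun y => sigma * (r y + (delta * g y)%:C%C - amp r * (H y)%:C%C).

Definition Qforce X : R -> C :=
  fun y => - (2 * b y)%:C%C * profile X y.

Definition rforce r X (Q : R -> C) : R -> C := fun y =>
  amp r * delta^-1%:C%C * X y
  + 'i%C * k%:C%C * ((a y)%:C%C * profile X y + Q y - (delta * (1 - a y))%:C%C)
  + (sigma * delta%:C%C - amp r) * (g y)%:C%C.

(** [r'] is the image of [r] under the map whose fixed points are the modes; [Q] is
    the nonlocal term [2 int_y^oo b Z]. At a fixed point [X = sigma (Z - delta H)]
    and [r = Z' + sigma Z - (sigma delta - m) H]: the slowly varying parts are
    subtracted from both factors of the splitting. The first and last terms of
    [rforce] are what this leaves of [(lambda - sigma ^+ 2) Z] and of the derivative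
    of [(sigma delta - m) H]. *)
Definition system r X (Q r' : R -> C) : Prop :=
  [/\ X 0 = 0,
    forall y, 0 <= y -> hasDC X y (- sigma * X y + Xforce r y),
    tailC Q (Qforce X) &
    forall y, 0 <= y -> hasDC r' y (sigma * r' y + rforce r X Q y)].

Lemma sigmaK : sigma * sigmaV = 1.
Proof.
by apply: complex_eq; rewrite /sigma /sigmaV !ReImE /=; field; rewrite gt_eqF.
Qed.

Lemma nrm_sigma : nrm sigma <= 2 * rho.
Proof. by rewrite /nrm/= normrN (gtr0_norm rho0); lra. Qed.

Lemma nrm_sigmaV : nrm sigmaV <= rho^-1.
Proof.
have h : 0 <= (2 * rho)^-1 by rewrite invr_ge0 mulr_ge0 // ltW.
rewrite /nrm/= ger0_norm// invfM.
have : (2^-1 : R) = 1 / 2 by rewrite div1r.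
by move=> ->; lra.
Qed.

Lemma Re_sigma : Re sigma = rho. Proof. by []. Qed.

Lemma nrm_i : nrm ('i%C : C) <= 1.
Proof. by rewrite /nrm !ReImE normr0 normr1 add0r. Qed.

Lemma rhoV_le : 50 * 50 * rho^-1 <= delta.
Proof. by rewrite ler_pdivrMr// [delta * rho]mulrC. Qed.

Lemma deltaV_le : 50 * 50 * delta^-1 <= rho.
Proof. by rewrite ler_pdivrMr. Qed.

Lemma cont_a : contP a. Proof. by apply: (@hasD_contP _ _ b). Qed.
Lemma cont_H : contP H. Proof. by apply: (@hasD_contP _ _ (fun y => - g y)) => y y0; exact: dH. Qed.

Section Bounds.
Variable r : R -> C.
Hypothesis r14 : forall y, 0 <= y -> nrm (r y) <= 1 / 4.

Lemma nrm_amp : nrm (amp r) <= 5 / 4.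
Proof.
have -> : (5 / 4 : R) = 1 + 1 / 4 by field.
by apply: nrm_le_sum; [rewrite nrm_real normr1|exact: r14].
Qed.

Lemma nrm_Xforce y : 0 <= y -> nrm (Xforce r y) <= 5 * rho.
Proof.
move=> y0; have -> : 5 * rho = (2 * rho) * (5 / 2) by field.
apply: nrm_le_prod; first exact: nrm_sigma.
have -> : (5 / 2 : R) = (1 / 4 + 3 / 8) + 5 / 4 * (3 / 2) by field.
apply: nrm_le_diff; first apply: nrm_le_sum.
- exact: r14.
- have /andP[g0 g1] := gM y0; apply: nrm_real_le; first by rewrite mulr_ge0// ltW.
  have : delta * g y <= delta * M by rewrite ler_wpM2l// ltW.
  move: small3; lra.
- apply: nrm_le_prod; first exact: nrm_amp.
  by have /andP[] := H_bound y0; exact: nrm_real_le.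
Qed.

Lemma cont_Xforce : contC r -> contC (Xforce r).
Proof.
move=> cr; apply: contCM; first exact: contC_cst.
apply: contCB; first apply: contCD => //.
  by apply: contC_real; apply: contPM => //; exact: contP_cst.
apply: contCM; first exact: contC_cst.
by apply: contC_real; exact: cont_H.
Qed.

Variable X : R -> C.
Hypothesis X40 : forall y, 0 <= y -> nrm (X y) <= 40.

Lemma nrm_profile y : 0 <= y -> nrm (profile X y) <= 2 * delta.
Proof.
move=> y0; have : nrm (profile X y) <= delta * (3 / 2) + rho^-1 * 40.
  apply: nrm_le_sum.
    have /andP[h1 h2] := H_bound y0.
    by apply: nrm_real_le; rewrite ?mulr_ge0 ?ler_wpM2l// ltW.
  by apply: nrm_le_prod; [exact: nrm_sigmaV|exact: X40].
by have := rhoV_le; move: delta0; lra.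
Qed.

Lemma nrm_Qforce y : 0 <= y -> nrm (Qforce X y) <= 4 * delta * b y.
Proof.
move=> y0; have -> : 4 * delta * b y = (2 * b y) * (2 * delta) by ring.
apply: nrm_le_prod; last exact: nrm_profile.
by rewrite nrmN nrm_real ger0_norm ?mulr_ge0 ?b_ge0.
Qed.

Lemma da_scaled c y : 0 <= y -> hasD (fun y => c * a y) y (c * b y).
Proof. by move=> y0; apply: hasDZ; exact: da. Qed.

Lemma scaled_a_le c y : 0 <= c -> 0 <= y -> c * a y <= c.
Proof.
by move=> c0 y0; have /andP[_ h] := a01 y0; rewrite -[leRHS]mulr1 ler_wpM2l.
Qed.

Lemma cont_profile : contC X -> contC (profile X).
Proof.
move=> cX; apply: contCD; last by apply: contCM => //; exact: contC_cst.
by apply: contC_real; apply: contPM; [exact: contP_cst|exact: cont_H].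
Qed.

Lemma Q_exists : contC X -> exists Q, tailC Q (Qforce X).
Proof.
move=> cX; have d0 : 0 <= 4 * delta by rewrite mulr_ge0 ?ltW.
apply: (@tailC_exists _ _ _ _ (4 * delta) _ nrm_Qforce (@da_scaled (4 * delta))).
  apply: contCM; last exact: cont_profile.
  apply: contCN; apply: contC_real; apply: contPM => //; exact: contP_cst.
by move=> y y0; exact: scaled_a_le.
Qed.

Variable Q : R -> C.
Hypothesis tQ : tailC Q (Qforce X).

Lemma nrm_Q y : 0 <= y -> nrm (Q y) <= 8 * delta.
Proof.
move=> y0; have d0 : 0 <= 4 * delta by rewrite mulr_ge0 ?ltW.
have := tailC_bound tQ nrm_Qforce (@da_scaled (4 * delta))
  (fun z hz => scaled_a_le d0 hz) y0.
have /andP[h _] := a01 y0.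
have : 0 <= delta * a y by rewrite mulr_ge0// ltW.
lra.
Qed.

Definition rforce_bound : R :=
  50 * delta^-1 + 11 * (k * delta) + (2 * (rho * delta) + 5 / 4) * M.

Lemma nrm_rforce y : 0 <= y -> nrm (rforce r X Q y) <= rforce_bound.
Proof.
move=> y0; have /andP[a0 a1] := a01 y0.
have hdV : nrm (delta^-1%:C%C : C) <= delta^-1.
  by apply: nrm_real_le => //; rewrite invr_ge0 ltW.
apply: nrm_le_sum; first apply: nrm_le_sum.
- have -> : 50 * delta^-1 = 5 / 4 * delta^-1 * 40 by field; rewrite gt_eqF.
  apply: nrm_le_prod; last exact: X40.
  by apply: nrm_le_prod hdV; exact: nrm_amp.
- have -> : 11 * (k * delta) = 1 * k * (1 * (2 * delta) + 8 * delta + delta) by ring.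
  apply: nrm_le_prod.
    by apply: nrm_le_prod; [exact: nrm_i|apply: nrm_real_le => //; exact: ltW].
  apply: nrm_le_diff.
    apply: nrm_le_sum; last exact: nrm_Q.
    by apply: nrm_le_prod; [exact: nrm_real_le|exact: nrm_profile].
  by apply: nrm_real_le; move: delta0; nra.
- have /andP[g0 g1] := gM y0; apply: nrm_le_prod; last exact: nrm_real_le.
  apply: nrm_le_diff; last exact: nrm_amp.
  rewrite mulrA; apply: nrm_le_prod; first exact: nrm_sigma.
  by apply: nrm_real_le => //; exact: ltW.
Qed.

Lemma cont_rforce : contC X -> contC (rforce r X Q).
Proof.
move=> cX; have cQ : contC Q by case: tQ => dQ _ _; exact: hasDC_contC dQ.
apply: contCD; first apply: contCD.
- by apply: contCM => //; exact: contC_cst.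
- apply: contCM; first exact: contC_cst.
  apply: contCB.
    apply: contCD => //; apply: contCM; last exact: cont_profile.
    by apply: contC_real; exact: cont_a.
  apply: contC_real; apply: contPM; first exact: contP_cst.
  by apply: contPB; [exact: contP_cst|exact: cont_a].
- by apply: contCM; [exact: contC_cst|exact: contC_real].
Qed.

End Bounds.

Lemma X_bound r X : (forall y, 0 <= y -> nrm (r y) <= 1 / 4) -> X 0 = 0 ->
  (forall y, 0 <= y -> hasDC X y (- sigma * X y + Xforce r y)) ->
  forall y, 0 <= y -> nrm (X y) <= 40.
Proof.
move=> r14 X0 dX y y0.
have := decaying_bound_cst (s := sigma) rho0 dX X0 (nrm_Xforce r14) y0.
move/le_trans; apply; rewrite Re_sigma mulfK ?gt_eqF//; lra.
Qed.

Lemma rforce_bound_small : 8 * (rforce_bound / rho) <= 1 / 4.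
Proof.
rewrite mulrA ler_pdivrMr// /rforce_bound.
by have := deltaV_le; move: small1 small2 small3 small4 rho0; nra.
Qed.

Definition lip : R := 2 * rho * (1 / 4) + rforce_bound.

Lemma rforce_bound_ge0 : 0 <= rforce_bound.
Proof.
rewrite /rforce_bound; have : 0 <= delta^-1 by rewrite invr_ge0 ltW.
have : 0 <= k * delta by rewrite mulr_ge0 ?ltW.
have : 0 <= rho * delta by rewrite mulr_ge0 ?ltW.
by move: M1; nra.
Qed.

Lemma lip_ge0 : 0 <= lip.
Proof. by rewrite /lip; have := rforce_bound_ge0; move: rho0; lra. Qed.

Lemma system_exists r : contC r -> (forall y, 0 <= y -> nrm (r y) <= 1 / 4) ->
  exists X Q r', [/\ system r X Q r',
    forall y, 0 <= y -> nrm (r' y) <= 1 / 4 &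
    forall x y, 0 <= x -> 0 <= y -> nrm (r' x - r' y) <= 2 * lip * `|x - y|].
Proof.
move=> cr r14.
have [X X0 dX] := decaying_exists sigma (cont_Xforce cr).
have X40 := X_bound r14 X0 dX.
have cX : contC X by exact: hasDC_contC dX.
have [Q tQ] := Q_exists X40 cX.
have [r' dr' br'] := growing_exists (s := sigma) rho0 (cont_rforce r tQ cX)
  (nrm_rforce r14 X40 tQ).
have r'14 y : 0 <= y -> nrm (r' y) <= 1 / 4.
  by move=> y0; apply: le_trans (br' y y0) rforce_bound_small.
exists X, Q, r'; split => //.
apply: nrm_lipschitz dr' _ => y y0.
apply: nrm_le_sum; last exact: nrm_rforce.
by apply: nrm_le_prod; [exact: nrm_sigma|exact: r'14].
Qed.

(** [X], [Q] and [rforce] are affine in [r] apart from the product [amp r * X]. A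
    change [d] of [r] moves [X] by [40 * d], hence [Z] and [Q] by [d] over [rho],
    and the growing equation divides the resulting forcing by [rho]: all terms come
    out with one of the small ratios. *)
Lemma system_contraction r1 X1 (Q1 r1' : R -> C) r2 X2 (Q2 r2' : R -> C) d :
  (forall y, 0 <= y -> nrm (r1 y) <= 1 / 4) ->
  (forall y, 0 <= y -> nrm (r2 y) <= 1 / 4) ->
  (forall y, 0 <= y -> nrm (r1' y) <= 1 / 4) ->
  (forall y, 0 <= y -> nrm (r2' y) <= 1 / 4) ->
  system r1 X1 Q1 r1' -> system r2 X2 Q2 r2' ->
  (forall y, 0 <= y -> nrm (r1 y - r2 y) <= d) ->
  forall y, 0 <= y -> nrm (r1' y - r2' y) <= d / 2.
Proof.
move=> b1 b2 b1' b2' [X10 dX1 tQ1 dr1] [X20 dX2 tQ2 dr2] rd.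
have d0 : 0 <= d by apply: le_trans (rd 0 (lexx _)); exact: nrm_ge0.
have X140 := X_bound b1 X10 dX1; have X240 := X_bound b2 X20 dX2.
have dm : nrm (amp r1 - amp r2) <= d.
  rewrite /amp (_ : _ - _ = r1 0 - r2 0); first exact: rd.
  by ring.
pose X y := X1 y - X2 y; pose Q y := Q1 y - Q2 y.
pose fX y := Xforce r1 y - Xforce r2 y.
have nfX y : 0 <= y -> nrm (fX y) <= 5 * rho * d.
  move=> y0; have -> : fX y = sigma *
      ((r1 y - r2 y) - (amp r1 - amp r2) * (H y)%:C%C) by rewrite /fX /Xforce; ring.
  have -> : 5 * rho * d = 2 * rho * (d + d * (3 / 2)) by field.
  apply: nrm_le_prod; first exact: nrm_sigma.
  apply: nrm_le_diff; first exact: rd.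
  apply: nrm_le_prod => //.
  by have /andP[] := H_bound y0; exact: nrm_real_le.
have nX y : 0 <= y -> nrm (X y) <= 40 * d.
  have dX z : 0 <= z -> hasDC X z (- sigma * X z + fX z).
    move=> z0; apply: hasDC_eq (hasDCB (dX1 z z0) (dX2 z z0)) _.
    by rewrite /X /fX; ring.
  move=> y0.
  have X0 : X 0 = 0 by rewrite /X X10 X20 subrr.
  have := decaying_bound_cst (s := sigma) rho0 dX X0 nfX y0.
  move/le_trans; apply; rewrite Re_sigma.
  have -> : 5 * rho * d / rho = 5 * d by field; rewrite gt_eqF.
  lra.
have pE y : profile X1 y - profile X2 y = sigmaV * X y.
  by rewrite /profile /X; ring.
have nZ y : 0 <= y -> nrm (profile X1 y - profile X2 y) <= rho^-1 * (40 * d).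
  move=> y0; rewrite pE; apply: nrm_le_prod; [exact: nrm_sigmaV|exact: nX].
have rV0 : 0 <= rho^-1 * (40 * d).
  by rewrite mulr_ge0 ?invr_ge0 ?mulr_ge0// ltW.
have nQ y : 0 <= y -> nrm (Q y) <= 4 * (rho^-1 * (40 * d)).
  set e := rho^-1 * (40 * d) in rV0 nZ *.
  have nf z : 0 <= z -> nrm (Qforce X1 z - Qforce X2 z) <= 2 * e * b z.
    move=> z0; have -> : Qforce X1 z - Qforce X2 z =
      - (2 * b z)%:C%C * (profile X1 z - profile X2 z) by rewrite /Qforce; ring.
    have -> : 2 * e * b z = (2 * b z) * e by ring.
    apply: nrm_le_prod; last exact: nZ.
    by rewrite nrmN nrm_real ger0_norm ?mulr_ge0 ?b_ge0.
  move=> y0; have e2 : 0 <= 2 * e by rewrite mulr_ge0.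
  have := tailC_bound (tailCB tQ1 tQ2) nf (@da_scaled (2 * e))
    (fun z hz => scaled_a_le e2 hz) y0.
  have /andP[h _] := a01 y0.
  have : 0 <= e * a y by rewrite mulr_ge0.
  rewrite /Q; lra.
pose fr y := rforce r1 X1 Q1 y - rforce r2 X2 Q2 y.
pose B := 90 * delta^-1 + 200 * (k * rho^-1) + M.
have nfr y : 0 <= y -> nrm (fr y) <= B * d.
  move=> y0; have /andP[a0 a1] := a01 y0.
  have -> : fr y = (amp r1 * delta^-1%:C%C * X y
      + (amp r1 - amp r2) * delta^-1%:C%C * X2 y)
      + 'i%C * k%:C%C * ((a y)%:C%C * (profile X1 y - profile X2 y) + Q y)
      - (amp r1 - amp r2) * (g y)%:C%C.
    by rewrite /fr /rforce /X /Q; ring.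
  have -> : B * d = (5 / 4 * delta^-1 * (40 * d) + d * delta^-1 * 40)
      + 1 * k * (1 * (rho^-1 * (40 * d)) + 4 * (rho^-1 * (40 * d))) + d * M.
    by rewrite /B; field; rewrite !gt_eqF.
  have hdV : nrm (delta^-1%:C%C : C) <= delta^-1.
    by apply: nrm_real_le => //; rewrite invr_ge0 ltW.
  apply: nrm_le_diff; first apply: nrm_le_sum; first apply: nrm_le_sum.
  - by apply: nrm_le_prod; [apply: nrm_le_prod hdV; exact: nrm_amp|exact: nX].
  - by apply: nrm_le_prod; [exact: nrm_le_prod|exact: X240].
  - apply: nrm_le_prod.
      by apply: nrm_le_prod; [exact: nrm_i|apply: nrm_real_le => //; exact: ltW].
    apply: nrm_le_sum; last exact: nQ.
    by apply: nrm_le_prod; [exact: nrm_real_le|exact: nZ].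
  - have /andP[g0 g1] := gM y0; apply: nrm_le_prod => //; exact: nrm_real_le.
have dr z : 0 <= z ->
    hasDC (fun y => r1' y - r2' y) z (sigma * (r1' z - r2' z) + fr z).
  move=> z0; apply: hasDC_eq (hasDCB (dr1 z z0) (dr2 z z0)) _.
  by rewrite /fr; ring.
have rb z : 0 <= z -> nrm (r1' z - r2' z) <= 1 / 4 + 1 / 4.
  by move=> z0; apply: nrm_le_diff; [exact: b1'|exact: b2'].
move=> y y0; have := growing_bound_cst (s := sigma) rho0 dr rb nfr y0.
move/le_trans; apply; rewrite Re_sigma.
have kr : 50 * 50 * (50 * 50 * (k * rho^-1)) <= rho.
  have h1 : k * (50 * 50 * rho^-1) <= k * delta.
    by apply: ler_wpM2l; [exact: ltW|exact: rhoV_le].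
  by move: small2; lra.
have Br : 16 * B <= rho by rewrite /B; have := deltaV_le; move: small4 rho0; lra.
rewrite mulrA ler_pdivrMr//; nra.
Qed.

Lemma system_fixed_point : exists X Q r,
  (forall y, 0 <= y -> nrm (r y) <= 1 / 4) /\ system r X Q r.
Proof.
have L0 : 0 <= 2 * lip by rewrite mulr_ge0// lip_ge0.
have [||r [r' [[r14 rL] _ [X [Q [X0 dX tQ dr]]] rr']]] := @uniform_fixed_point R
    (fun r r' => exists X Q, system r X Q r') (2 * lip) L0.
- move=> r [r14 rL].
  have cr : contC r by exact: lipschitz_contC rL.
  have [X [Q [r' [sys b' l']]]] := system_exists cr r14.
  by exists r' => //; exists X, Q.
- move=> r1 r2 r1' r2' d [b1 _] [b2 _] [b1' _] [b2' _] [X1 [Q1 s1]] [X2 [Q2 s2]].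
  exact: system_contraction s1 s2.
exists X, Q, r; split => //; split => // y y0.
apply: (hasDC_ext rr' y0); rewrite -rr'//; exact: dr.
Qed.

(** * Decay of the mode *)

Definition eigenvalue r : C := sigma ^+ 2 + sigma * (amp r * delta^-1%:C%C).

(** This is [- Z'], read off the equation of [X]. *)
Definition velocity_defect r X : R -> C := fun y => X y + amp r * (H y)%:C%C - r y.

(** This is [- Z''], in the form given by the integrated equation. *)
Definition shear r X (Q : R -> C) : R -> C := fun y =>
  - (eigenvalue r * profile X y
     + 'i%C * k%:C%C * ((a y)%:C%C * profile X y + Q y - (delta * (1 - a y))%:C%C)
     - sigma ^+ 2 * (delta * H y)%:C%C).

Hypothesis a_lim : a y @[y --> +oo] --> (1 : R).
Hypothesis H_lim : H y @[y --> +oo] --> (0 : R).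

Section Solution.
Variables (r X Q : R -> C).
Hypothesis r14 : forall y, 0 <= y -> nrm (r y) <= 1 / 4.
Hypothesis sys : system r X Q r.
Local Notation Z := (profile X).
Local Notation w := (velocity_defect r X).
Local Notation v := (shear r X Q).
Local Notation lambda := (eigenvalue r).

Let X40 : forall y, 0 <= y -> nrm (X y) <= 40.
Proof. by case: sys => X0 dX _ _; exact: X_bound dX. Qed.

Lemma sigma_neq0 : sigma != 0.
Proof.
by apply/eqP => h; have := sigmaK; rewrite h mul0r => /eqP; rewrite eq_sym oner_eq0.
Qed.

Lemma sigmaVE : sigmaV = sigma^-1.
Proof.
by apply: (mulfI sigma_neq0); rewrite sigmaK mulfV // sigma_neq0.
Qed.

Lemma deltaC_neq0 : delta%:C%C != 0 :> C.
Proof. by rewrite eq_complex /= eqxx andbT gt_eqF. Qed.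

Lemma deltaVE : delta^-1%:C%C = (delta%:C%C)^-1 :> C.
Proof. exact: fmorphV. Qed.

Lemma derivative_profile y : 0 <= y -> hasDC Z y (- w y).
Proof.
move=> y0; case: sys => _ dX _ _.
apply: hasDC_eq.
  apply: hasDCD; first by apply: hasDC_real; apply: hasDZ; exact: dH.
  by apply: hasDCZ; exact: dX.
rewrite /velocity_defect /Xforce sigmaVE !(realCM, realCN).
by field; rewrite sigma_neq0.
Qed.

Lemma derivative_defect y : 0 <= y -> hasDC w y (v y).
Proof.
move=> y0; case: sys => _ dX _ dr.
apply: hasDC_eq.
  apply: hasDCB (dr y y0); apply: hasDCD (dX y y0) _.
  by apply: hasDCZ; apply: hasDC_real; exact: dH.
rewrite /shear /Xforce /rforce /eigenvalue /profile sigmaVE deltaVE.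
rewrite !(realCM, realCN).
by field; rewrite sigma_neq0 deltaC_neq0.
Qed.

Definition shear_rate y : C := lambda * w y
  + 'i%C * k%:C%C * ((a y)%:C%C * w y + (b y)%:C%C * (Z y - delta%:C%C))
  - sigma ^+ 2 * (delta * g y)%:C%C.

Lemma derivative_shear y : 0 <= y -> hasDC v y (shear_rate y).
Proof.
move=> y0; case: sys => _ _ [dQ _ _] _.
apply: hasDC_eq.
  apply: hasDCN; apply: hasDCB.
    apply: hasDCD; first by apply: hasDCZ; exact: derivative_profile.
    apply: hasDCZ; apply: hasDCB.
      apply: hasDCD (dQ y y0); apply: hasDCM (derivative_profile y0).
      by apply: hasDC_real; exact: da.
    apply: hasDC_real; apply: hasDZ.
    by apply: hasDB (da y0); exact: hasD_cst.
  by apply: hasDCZ; apply: hasDC_real; apply: hasDZ; exact: dH.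
rewrite /shear_rate /Qforce !(realCM, realCN, realCB).
have -> : (2%:C%C : C) = 1 + 1 by apply: complex_eq; rewrite !ReImE ?addr0.
have -> : (0%:C%C : C) = 0 by [].
ring.
Qed.

Lemma profile_at0 : Z 0 = delta%:C%C.
Proof. by case: sys => X0 _ _ _; rewrite /profile X0 H_at0 mulr1 mulr0 addr0. Qed.

Lemma defect_at0 : w 0 = 1.
Proof. by case: sys => X0 _ _ _; rewrite /velocity_defect X0 H_at0 /amp; ring. Qed.

Lemma nrm_defect y : 0 <= y -> nrm (w y) <= 43.
Proof.
move=> y0; apply: (@le_trans _ _ (40 + 5 / 4 * (3 / 2) + 1 / 4)); last by lra.
apply: nrm_le_diff; last exact: r14.
apply: nrm_le_sum; first exact: X40.
apply: nrm_le_prod; first exact: nrm_amp.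
by have /andP[] := H_bound y0; exact: nrm_real_le.
Qed.

Lemma nrm_eigenvalue : nrm (lambda - sigma ^+ 2) <= 2 * rho * (5 / 4 * delta^-1).
Proof.
rewrite /eigenvalue addrAC subrr add0r.
apply: nrm_le_prod; first exact: nrm_sigma.
apply: nrm_le_prod; first exact: nrm_amp.
by apply: nrm_real_le => //; rewrite invr_ge0 ltW.
Qed.

Lemma nrm_sigma2 : nrm (sigma ^+ 2) <= 2 * rho * (2 * rho).
Proof. by rewrite expr2; apply: nrm_le_prod; exact: nrm_sigma. Qed.

(** [sigma ^+ 2] is purely imaginary, and [m] is within [1 / 4] of [1]. *)
Lemma Re_eigenvalue : rho / (2 * delta) <= Re lambda.
Proof.
have := nrm_Re (r 0); have := nrm_Im (r 0); have := r14 (lexx 0).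
rewrite /nrm => h1 h2 h3.
have -> : Re lambda = rho / delta * (1 + Re (r 0) + Im (r 0)).
  by rewrite /eigenvalue /amp /sigma expr2 !ReImE /=; ring.
have -> : rho / (2 * delta) = rho / delta * (1 / 2) by field; rewrite gt_eqF.
apply: ler_wpM2l; first by rewrite divr_ge0// ltW.
move: h1; have := ler_norm (- Re (r 0)); have := ler_norm (- Im (r 0)).
rewrite !normrN; lra.
Qed.

Lemma shear_bounded : exists V, forall y, 0 <= y -> nrm (v y) <= V.
Proof.
case: sys => _ _ tQ _.
exists (nrm lambda * (2 * delta) + 1 * k * (1 * (2 * delta) + 8 * delta + delta)
        + nrm (sigma ^+ 2) * (delta * (3 / 2))) => y y0.
have /andP[a0 a1] := a01 y0; have /andP[H0 H1] := H_bound y0.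
rewrite /shear nrmN; apply: nrm_le_diff; first apply: nrm_le_sum.
- by apply: nrm_le_prod; [exact: lexx|exact: nrm_profile].
- apply: nrm_le_prod.
    by apply: nrm_le_prod; [exact: nrm_i|apply: nrm_real_le => //; exact: ltW].
  apply: nrm_le_diff.
    apply: nrm_le_sum; last exact: (nrm_Q X40 tQ).
    by apply: nrm_le_prod; [exact: nrm_real_le|exact: nrm_profile].
  by apply: nrm_real_le; move: delta0; nra.
- apply: nrm_le_prod; first exact: lexx.
  by apply: nrm_real_le; [rewrite mulr_ge0// ltW|rewrite ler_wpM2l// ltW].
Qed.

(** The forcing left when the third-order equation for [Z] is written as
    [(d - sigma) (d + sigma) w = residual]. *)
Definition residual y : C := (lambda - sigma ^+ 2) * w y
  + 'i%C * k%:C%C * ((a y)%:C%C * w y + (b y)%:C%C * (Z y - delta%:C%C))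
  - sigma ^+ 2 * (delta * g y)%:C%C.

Lemma cont_defect : contC w.
Proof. exact: hasDC_contC derivative_defect. Qed.

Lemma cont_residual : contC residual.
Proof.
have cZ : contC Z by exact: (hasDC_contC derivative_profile).
have cw := cont_defect; have ca := cont_a.
apply: contCB; first apply: contCD.
- by apply: contCM => //; exact: contC_cst.
- apply: contCM; first exact: contC_cst.
  apply: contCD; first by apply: contCM => //; exact: contC_real.
  apply: contCM; first exact: contC_real.
  by apply: contCB => //; exact: contC_cst.
- apply: contCM; first exact: contC_cst.
  by apply: contC_real; apply: contPM => //; exact: contP_cst.
Qed.

Definition residual_cst : R := 3 * (k * delta) + 4 * (rho ^+ 2 * delta).

Lemma residual_cst_ge0 : 0 <= residual_cst.
Proof. by rewrite addr_ge0// !mulr_ge0// ?exprn_ge0// ltW. Qed.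

Lemma nrm_residual y : 0 <= y ->
  500 * nrm (residual y) <= rho ^+ 2 * nrm (w y) + 500 * (residual_cst * (b y + g y)).
Proof.
move=> y0; have /andP[a0 a1] := a01 y0; have /andP[g0 g1] := gM y0.
have b0 := b_ge0 y0; have n0 := nrm_ge0 (w y).
have : nrm (residual y) <= 2 * rho * (5 / 4 * delta^-1) * nrm (w y)
   + 1 * k * (1 * nrm (w y) + b y * (2 * delta + delta))
   + 2 * rho * (2 * rho) * (delta * g y).
  apply: nrm_le_diff; first apply: nrm_le_sum.
  - by apply: nrm_le_prod => //; exact: nrm_eigenvalue.
  - apply: nrm_le_prod.
      by apply: nrm_le_prod; [exact: nrm_i|apply: nrm_real_le => //; exact: ltW].
    apply: nrm_le_sum; first by apply: nrm_le_prod => //; exact: nrm_real_le.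
    apply: nrm_le_prod; first exact: nrm_real_le.
    apply: nrm_le_diff; first exact: nrm_profile.
    by apply: nrm_real_le => //; exact: ltW.
  - apply: nrm_le_prod; first exact: nrm_sigma2.
    by apply: nrm_real_le => //; rewrite mulr_ge0// ltW.
have h1 : 50 * 50 * (rho * delta^-1) <= rho ^+ 2.
  rewrite mulrCA expr2; apply: ler_wpM2l; first exact: ltW.
  exact: deltaV_le.
have h2 : 50 * 50 * k <= rho ^+ 2.
  have : 50 * 50 * k <= rho * delta * (50 * 50 * k).
    by rewrite -[leLHS]mul1r ler_wpM2r ?mulr_ge0 ?(ltW k0)//; move: small1; lra.
  move/le_trans; apply.
  have -> : rho * delta * (50 * 50 * k) = rho * (50 * 50 * (k * delta)) by ring.
  by rewrite expr2 ler_wpM2l// ltW.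
have h3 : (50 * 50 * (rho * delta^-1)) * nrm (w y) <= rho ^+ 2 * nrm (w y).
  by rewrite ler_wpM2r.
have h4 : (50 * 50 * k) * nrm (w y) <= rho ^+ 2 * nrm (w y) by rewrite ler_wpM2r.
have h5 : 0 <= k * delta * g y by rewrite !mulr_ge0// ltW.
have h6 : 0 <= rho ^+ 2 * delta * b y by rewrite !mulr_ge0// ?exprn_ge0// ltW.
have h7 : 0 <= rho ^+ 2 * nrm (w y) by rewrite mulr_ge0// exprn_ge0// ltW.
move: h3 h4 h5 h6 h7; rewrite /residual_cst !expr2; lra.
Qed.

(** The factors of [(d - sigma) (d + sigma) w = residual] are inverted one after
    the other, with scalar supersolutions [Sq] and [Sw]. Integrating these two
    scalar equations bounds, up to boundary terms, a primitive of [nrm w] by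
    [64 / rho ^+ 2] times one of [nrm residual]; by [nrm_residual] the latter contains [nrm w] only with the
    factor [rho ^+ 2 / 500], so that this part is absorbed, and the rest is
    dominated by [b + g], the derivative of the bounded function [a - H]. *)
Lemma defect_L1 : exists N B, [/\ N 0 = 0,
  forall y, 0 <= y -> hasD N y (nrm (w y)) & forall y, 0 <= y -> N y <= B].
Proof.
have cn : contP (fun y => nrm (w y)) by exact: contC_nrm cont_defect.
have [N N0 dN] := primitive_exists cn.
have [V vV] := shear_bounded.
pose q y := v y + sigma * w y.
have dq y : 0 <= y -> hasDC q y (sigma * q y + residual y).
  move=> y0; apply: hasDC_eq.
    apply: hasDCD (derivative_shear y0) _.
    by apply: hasDCZ; exact: derivative_defect.
  by rewrite /q /shear_rate /residual; ring.
have qB y : 0 <= y -> nrm (q y) <= V + 2 * rho * 43.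
  move=> y0; apply: nrm_le_sum; first exact: vV.
  by apply: nrm_le_prod; [exact: nrm_sigma|exact: nrm_defect].
have dw y : 0 <= y -> hasDC w y (- sigma * w y + q y).
  by move=> y0; apply: hasDC_eq (derivative_defect y0) _; rewrite /q; ring.
have cq : contC q by exact: hasDC_contC dq.
have [Bb bB] : exists Bb, forall y, 0 <= y -> 0 <= nrm (residual y) <= Bb.
  have [Vr hVr] : exists Vr, forall y, 0 <= y -> nrm (residual y) <= Vr; last first.
    by exists Vr => y y0; rewrite nrm_ge0 hVr.
  exists (rho ^+ 2 * 43 + 500 * (residual_cst * (bm + M))) => y y0.
  have := nrm_residual y0; have /andP[g0 g1] := gM y0.
  have h1 : rho ^+ 2 * nrm (w y) <= rho ^+ 2 * 43.
    by apply: ler_wpM2l; [exact: exprn_ge0 (ltW rho0)|exact: nrm_defect].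
  have h2 : residual_cst * (b y + g y) <= residual_cst * (bm + M).
    by apply: ler_wpM2l; [exact: residual_cst_ge0|apply: lerD => //; exact: b_bound].
  have := nrm_ge0 (residual y); lra.
have [Sq [Bq [dSq Sq0 SqB]]] := growing_majorant rho0 (contC_nrm cont_residual) bB.
have qS y : 0 <= y -> nrm (q y) <= 8 * Sq y.
  exact: (growing_bound (s := sigma) rho0 dq qB (fun z _ => lexx _) dSq Sq0).
have [Sw Sw0 [dSw Swp]] := decaying_majorant rho (contC_nrm cq) (fun z _ => nrm_ge0 _).
have wS y : 0 <= y -> nrm (w y) <= 2 * expR (- rho * y) + 8 * Sw y.
  move=> y0; have := decaying_bound (s := sigma) dw (fun z _ => lexx _) dSw _ y0.
  by rewrite Sw0 lexx defect_at0 nrm_real normr1 mulr1; apply.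
pose K := residual_cst.
have K0 : 0 <= K := residual_cst_ge0.
have rV := mulfV (lt0r_neq0 rho0); have rV0 : 0 < rho^-1 by rewrite invr_gt0.
pose G y := - (2 / rho) * expR (- rho * y) + (- (8 / rho)) * Sw y
  + (64 / rho ^+ 2) * (Sq y + K * (a y - H y)).
pose G' y := - (2 / rho) * (- rho * expR (- rho * y))
  + (- (8 / rho)) * (- rho * Sw y + nrm (q y))
  + (64 / rho ^+ 2) * (rho * Sq y - nrm (residual y) + K * (b y - - g y)).
have dG y : 0 <= y -> hasD G y (G' y).
  move=> y0; apply: hasDD.
    apply: hasDD; first by apply: hasDZ; exact: hasD_expR.
    by apply: hasDZ; exact: dSw.
  apply: hasDZ; apply: hasDD; first exact: dSq.
  by apply: hasDZ; apply: hasDB; [exact: da|exact: dH].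
have key y : 0 <= y -> 1 / 2 * nrm (w y) <= G' y.
  move=> y0; have hw := wS y y0; have hq := qS y y0; have hr := nrm_residual y0.
  have -> : G' y = 2 * expR (- rho * y) + 8 * Sw y + 8 / rho * (8 * Sq y - nrm (q y))
      - 64 / rho ^+ 2 * (nrm (residual y) - K * (b y + g y)).
    by rewrite /G'; field; rewrite gt_eqF.
  have h1 : 0 <= 8 / rho * (8 * Sq y - nrm (q y)).
    by apply: mulr_ge0; [rewrite divr_ge0// ltW|rewrite subr_ge0].
  (* [64 / 500] is less than [1 / 2]: the absorption. *)
  have h2 : 500 * (64 / rho ^+ 2 * (nrm (residual y) - K * (b y + g y))) <=
      64 * nrm (w y).
    have -> : 64 * nrm (w y) = 64 / rho ^+ 2 * (rho ^+ 2 * nrm (w y)).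
      by field; rewrite gt_eqF.
    rewrite mulrCA; apply: ler_wpM2l; first by rewrite divr_ge0// exprn_ge0// ltW.
    by rewrite mulrBr lerBlDr.
  by have := nrm_ge0 (w y); lra.
exists N, (2 * (2 / rho + 64 / rho ^+ 2 * (Bq + K * (5 / 2)))); split => // y y0.
have hN z : 0 <= z -> hasD (fun z => 1 / 2 * N z) z (1 / 2 * nrm (w z)).
  by move=> z0; apply: hasDZ; exact: dN.
have := hasD_le hN dG (lexx 0) y0 key; rewrite N0 mulr0 subr0 => h.
have hG : G y - G 0 <= 2 / rho + 64 / rho ^+ 2 * (Bq + K * (5 / 2)).
  rewrite /G Sw0 !mulr0 addr0 expR0 mulr1 H_at0.
  have /andP[a0 _] := a01 (lexx 0); have /andP[_ a1] := a01 y0.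
  have /andP[H0 _] := H_bound y0.
  have e1 : 0 <= 2 / rho * expR (- rho * y).
    by rewrite mulr_ge0 ?expR_ge0// divr_ge0// ltW.
  have e2 : 0 <= 8 / rho * Sw y by rewrite mulr_ge0 ?Swp// divr_ge0// ltW.
  have e3 : 64 / rho ^+ 2 * ((Sq y + K * (a y - H y)) - (Sq 0 + K * (a 0 - 1)))
     <= 64 / rho ^+ 2 * (Bq + K * (5 / 2)).
    apply: ler_wpM2l; first by rewrite divr_ge0// exprn_ge0// ltW.
    have := SqB y y0; have := Sq0 0 (lexx _).
    have : K * (a y - H y - (a 0 - 1)) <= K * (5 / 2) by apply: ler_wpM2l => //; lra.
    by lra.
  lra.
lra.
Qed.

Lemma contP_Re F : contC F -> contP (fun y => Re (F y)). Proof. by case. Qed.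
Lemma contP_Im F : contC F -> contP (fun y => Im (F y)). Proof. by case. Qed.

Lemma defect_vanishes : cvgC_infty w 0.
Proof.
have [N [B [N0 dN NB]]] := defect_L1; have [V vV] := shear_bounded.
have cv : contC v by exact: (hasDC_contC derivative_shear).
split.
  apply: (@integrable_vanishes _ (fun y => Re (w y)) (fun y => Re (v y))
    (fun y => nrm (w y)) N B 43 V) => //.
  - exact: contP_Re cont_defect.
  - exact: contP_Re.
  - by move=> y y0; have [] := derivative_defect y0.
  - by move=> y y0; exact: nrm_Re.
  - by move=> y y0; apply: le_trans (nrm_defect y0); exact: nrm_Re.
  - by move=> y y0; apply: le_trans (vV y y0); exact: nrm_Re.
apply: (@integrable_vanishes _ (fun y => Im (w y)) (fun y => Im (v y))
  (fun y => nrm (w y)) N B 43 V) => //.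
- exact: contP_Im cont_defect.
- exact: contP_Im.
- by move=> y y0; have [] := derivative_defect y0.
- by move=> y y0; exact: nrm_Im.
- by move=> y y0; apply: le_trans (nrm_defect y0); exact: nrm_Im.
- by move=> y y0; apply: le_trans (vV y y0); exact: nrm_Im.
Qed.

(** Since [w] is integrable, [Z] tends to some [c]. By the integrated equation [w']
    then tends to [- (lambda + i k) c]; as [w] is bounded, this limit is zero, and
    [Re lambda > 0] leaves [c = 0]. *)
Lemma profile_vanishes : cvgC_infty Z 0.
Proof.
have [N [B [N0 dN NB]]] := defect_L1.
have [_ _ [dQ Q1 Q2] _] := sys.
have [T [dT T1 T2]] : exists T, tailC T (fun y => - w y).
  apply: (@tailC_exists _ _ (fun y => nrm (w y)) N B) => //.
    by apply: contCN; exact: cont_defect.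
  by move=> y y0; rewrite nrmN.
pose c := Z 0 - T 0.
have ZT y : 0 <= y -> Z y = c + T y.
  move=> y0.
  have h0 z : 0 <= z -> hasDC (fun x => Z x - T x) z 0.
    move=> z0; apply: hasDC_eq (hasDCB (derivative_profile z0) (dT z z0)) _.
    exact: subrr.
  have e1 := @hasD_zero_const _ (fun x => Re (Z x - T x)) (fun z hz => (h0 z hz).1) y y0.
  have e2 := @hasD_zero_const _ (fun x => Im (Z x - T x)) (fun z hz => (h0 z hz).2) y y0.
  have e : Z y - T y = c by apply: complex_eq; rewrite ?e1 ?e2.
  by rewrite -e subrK.
have Zc : cvgC_infty Z c.
  have h : cvgC_infty (fun y => c + T y) (c + 0).
    by apply: cvgCD; [exact: cvgC_cst|split].
  rewrite addr0 in h; case: h => [h1 h2].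
  split; apply: near_cvgy => e e0.
    by have [m m0 hm] := cvgy_near h1 e0; exists m => y my; rewrite ZT ?hm// (le_trans m0).
  by have [m m0 hm] := cvgy_near h2 e0; exists m => y my; rewrite ZT ?hm// (le_trans m0).
have vc : cvgC_infty v (- (lambda * c + 'i%C * k%:C%C * (1%:C%C * c + 0 -
     (delta * (1 - 1))%:C%C) - sigma ^+ 2 * (delta * 0)%:C%C)).
  apply: cvgCN; apply: cvgCD; first apply: cvgCD.
  - by apply: cvgCM => //; exact: cvgC_cst.
  - apply: cvgCM; first exact: cvgC_cst.
    apply: cvgCD.
      apply: cvgCD; last by split.
      by apply: cvgCM => //; exact: cvgC_real.
    apply: cvgCN; apply: cvgC_real; apply: cvgM; first exact: cvg_cst.
    by apply: cvgB => //; exact: cvg_cst.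
  - apply: cvgCN; apply: cvgCM; first exact: cvgC_cst.
    by apply: cvgC_real; apply: cvgM => //; exact: cvg_cst.
set l := (X in cvgC_infty _ X) in vc.
have l1 : Re l = 0.
  apply: (@bounded_derivative_limit _ (fun y => Re (w y)) (fun y => Re (v y)) (Re l) 43).
  - by move=> y y0; have [] := derivative_defect y0.
  - by case: vc.
  - by move=> y y0; apply: le_trans (nrm_defect y0); exact: nrm_Re.
have l2 : Im l = 0.
  apply: (@bounded_derivative_limit _ (fun y => Im (w y)) (fun y => Im (v y)) (Im l) 43).
  - by move=> y y0; have [] := derivative_defect y0.
  - by case: vc.
  - by move=> y y0; apply: le_trans (nrm_defect y0); exact: nrm_Im.
have lE : l = - (lambda + 'i%C * k%:C%C) * c.
  rewrite /l subrr !mulr0.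
  have -> : (0%:C%C : C) = 0 by [].
  have -> : (1%:C%C : C) = 1 by [].
  ring.
have l0 : l = 0 by apply: complex_eq.
have : c = 0.
  move: lE; rewrite l0 => /esym/eqP; rewrite mulf_eq0 oppr_eq0 => /orP[|/eqP//].
  move=> /eqP h.
  have : 0 < Re (lambda + 'i%C * k%:C%C).
    have ik : Re ('i%C * k%:C%C : C) = 0 by rewrite !ReImE mul0r mulr0 subr0.
    rewrite ReD ik addr0.
    by apply: lt_le_trans Re_eigenvalue; rewrite divr_gt0// mulr_gt0.
  by rewrite h ltxx.
by move=> <-.
Qed.
End Solution.

Lemma decaying_mode_exists : exists (lambda : C) (Z w v : R -> C) (N : R -> R) (B : R),
  [/\ rho / (2 * delta) <= Re lambda, Z 0 = delta%:C%C, w 0 = 1,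
      cvgC_infty Z 0 & cvgC_infty w 0] /\
  [/\ forall y, 0 <= y -> hasDC Z y (- w y),
      forall y, 0 <= y -> hasDC w y (v y),
      forall y, 0 <= y -> hasDC v y (lambda * w y
        + 'i%C * k%:C%C * ((a y)%:C%C * w y + (b y)%:C%C * (Z y - delta%:C%C))
        - sigma ^+ 2 * (delta * g y)%:C%C),
      forall y, 0 <= y -> hasD N y (nrm (w y)) &
      forall y, 0 <= y -> N y <= B].
Proof.
have [X [Q [r [r14 sys]]]] := system_fixed_point.
have [N [B [N0 dN NB]]] := defect_L1 r14 sys.
exists (eigenvalue r), (profile X), (velocity_defect r X), (shear r X Q), N, B.
split; split => //.
- exact: Re_eigenvalue.
- exact: profile_at0 sys.
- exact: defect_at0 sys.
- exact: profile_vanishes r14 sys.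
- exact: defect_vanishes r14 sys.
- by move=> y y0; exact: (derivative_profile sys y0).
- by move=> y y0; exact: (derivative_defect sys y0).
- by move=> y y0; exact: (derivative_shear sys y0).
Qed.

End Mode.

(** * Smoothness and separated solutions *)

Section Smoothness.
Variable R : realType.
Local Notation C := R[i].
Local Notation Re := complex.Re.
Local Notation Im := complex.Im.
Implicit Types (f g : R -> R) (F G : R -> C).

(** Differentiability [n] times with the derivatives named by witnesses: it
    survives changes of the function outside the half-line and lends itself to
    induction, unlike iterated [derive_in]. *)
Fixpoint diffn n f : Prop :=
  if n is n.+1 then exists2 g, (forall y, 0 <= y -> hasD f y (g y)) & diffn n g
  else True.

Lemma diffn_ext n f g : (forall y, 0 <= y -> f y = g y) -> diffn n f -> diffn n g.
Proof.
case: n => //= n fg [h dh Ch]; exists h => // y y0.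
exact: hasD_ext fg y0 (dh y y0).
Qed.

Lemma smooth_diffn f : smooth_plus f -> forall n, diffn n f.
Proof.
move=> sf n; elim: n f sf => //= n IH f sf.
exists (derive_in (@Rplus R) f).
  by move=> y y0; apply: derivable_hasD; exact: (sf 0 y y0).
by apply: IH => j y y0; have := sf j.+1 y y0; rewrite /derivn_plus iterSr.
Qed.

Lemma diffn_smooth f : (forall n, diffn n f) -> smooth_plus f.
Proof.
move=> h j; have {h} := h j.+1; elim: j f => [|j IH] f [g dg Cg] y y0.
  by have [] := hasD_derive y0 (dg y y0).
rewrite /derivn_plus iterSr; apply: (IH _ _ y y0).
apply: (@diffn_ext j.+1 g) Cg => z z0.
by have [_ ->] := hasD_derive z0 (dg z z0).
Qed.

Lemma diffnW n f : diffn n.+1 f -> diffn n f.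
Proof.
elim: n f => // n IH f [g dg Cg]; exists g => //; exact: IH.
Qed.

Lemma diffn_cst n (c : R) : diffn n (fun=> c).
Proof.
by elim: n c => //= n IH c; exists (fun=> 0) => // y _; exact: hasD_cst.
Qed.

Lemma diffn_id n : diffn n (fun x : R => x).
Proof.
by case: n => //= n; exists (fun=> 1); [move=> y _; exact: hasD_id|exact: diffn_cst].
Qed.

Lemma diffnD n f g : diffn n f -> diffn n g -> diffn n (fun x => f x + g x).
Proof.
elim: n f g => //= n IH f g [f' df Cf] [g' dg Cg].
exists (fun x => f' x + g' x); last exact: IH.
by move=> y y0; apply: hasDD; [exact: df|exact: dg].
Qed.

Lemma diffnM n f g : diffn n f -> diffn n g -> diffn n (fun x => f x * g x).
Proof.
elim: n f g => // n IH f g Cf Cg.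
have Cf0 := diffnW Cf; have Cg0 := diffnW Cg.
case: Cf => f' df Cf; case: Cg => g' dg Cg.
exists (fun x => f' x * g x + f x * g' x).
  by move=> y y0; apply: hasDM; [exact: df|exact: dg].
by apply: diffnD; exact: IH.
Qed.

Lemma diffnN n f : diffn n f -> diffn n (fun x => - f x).
Proof.
move=> Cf; have := diffnM (diffn_cst n (-1)) Cf.
by apply: diffn_ext => y _; rewrite mulN1r.
Qed.

Definition diffnC n F := diffn n (fun y => Re (F y)) /\ diffn n (fun y => Im (F y)).

Lemma smooth_diffnC F : smooth_plusC F -> forall n, diffnC n F.
Proof. by move=> [h1 h2] n; split; exact: smooth_diffn. Qed.

Lemma diffnC_smooth F : (forall n, diffnC n F) -> smooth_plusC F.
Proof. by move=> h; split; apply: diffn_smooth => n; have [] := h n. Qed.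

Lemma diffnC_cst n (c : C) : diffnC n (fun=> c).
Proof. by split; exact: diffn_cst. Qed.

Lemma diffnC_real n f : diffn n f -> diffnC n (fun y => (f y)%:C%C).
Proof. by split => //; exact: diffn_cst. Qed.

Lemma diffnCD n F G : diffnC n F -> diffnC n G -> diffnC n (fun x => F x + G x).
Proof.
move=> [h1 h2] [h3 h4]; split.
  by under [X in diffn _ X]funext do rewrite ReD; exact: diffnD.
by under [X in diffn _ X]funext do rewrite ImD; exact: diffnD.
Qed.

Lemma diffnCN n F : diffnC n F -> diffnC n (fun x => - F x).
Proof.
move=> [h1 h2]; split.
  by under [X in diffn _ X]funext do rewrite ReN; exact: diffnN.
by under [X in diffn _ X]funext do rewrite ImN; exact: diffnN.
Qed.

Lemma diffnCM n F G : diffnC n F -> diffnC n G -> diffnC n (fun x => F x * G x).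
Proof.
move=> [h1 h2] [h3 h4]; split.
  under [X in diffn _ X]funext do rewrite ReM.
  by apply: diffnD; [exact: diffnM|apply: diffnN; exact: diffnM].
under [X in diffn _ X]funext do rewrite ImM.
by apply: diffnD; exact: diffnM.
Qed.

Lemma diffnCB n F G : diffnC n F -> diffnC n G -> diffnC n (fun x => F x - G x).
Proof. by move=> h1 h2; apply: diffnCD => //; exact: diffnCN. Qed.

(** The bootstrap step for differential equations. *)
Lemma diffnC_derivative n F G : (forall y, 0 <= y -> hasDC F y (G y)) ->
  diffnC n G -> diffnC n.+1 F.
Proof.
move=> dF [h1 h2]; split.
  by exists (fun y => Re (G y)) => // y y0; have [] := dF y y0.
by exists (fun y => Im (G y)) => // y y0; have [] := dF y y0.
Qed.

Lemma smooth_plusCZ (c : C) F : smooth_plusC F -> smooth_plusC (fun y => c * F y).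
Proof.
move=> sF; apply: diffnC_smooth => n.
by apply: diffnCM; [exact: diffnC_cst|exact: smooth_diffnC].
Qed.

Definition deriveC F y : C :=
  (derive_in (@Rplus R) (fun z => Re (F z)) y
   +i* derive_in (@Rplus R) (fun z => Im (F z)) y)%C.

Lemma deriveCP F y : smooth_plusC F -> 0 <= y -> hasDC F y (deriveC F y).
Proof.
move=> [h1 h2] y0; split; apply: derivable_hasD.
  exact: (h1 0 y y0).
exact: (h2 0 y y0).
Qed.

Lemma smooth_deriveC F : smooth_plusC F -> smooth_plusC (deriveC F).
Proof.
move=> [h1 h2]; split => j y y0.
  by have := h1 j.+1 y y0; rewrite /derivn_plus iterSr.
by have := h2 j.+1 y y0; rewrite /derivn_plus iterSr.
Qed.

Section Separated.
Variables (lambda K : C).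
Implicit Types t x y : R.

Definition wave t x : C := expc lambda t * expc K x.

Lemma wave_dt (c : C) t x :
  is_derive t 1 (fun s => Re (wave s x * c)) (Re (wave t x * (lambda * c))) /\
  is_derive t 1 (fun s => Im (wave s x * c)) (Im (wave t x * (lambda * c))).
Proof.
have [h1 h2] := is_derive_expc lambda t.
set d := expc K x * c.
have E s : wave s x * c = expc lambda s * d by rewrite /wave /d; ring.
have -> : wave t x * (lambda * c) = lambda * expc lambda t * d by rewrite /wave /d; ring.
have lin (f : R -> R) (e l : R) : is_derive t 1 f l -> is_derive t 1 (fun s => f s * e) (l * e).
  move=> hf; apply: (@is_derive_eq _ _ _ _ _ _ _ _ (is_deriveM hf (is_derive_cst e t 1))).
  by rewrite /GRing.scale /= mulr0 add0r mulrC.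
split.
  under [X in is_derive _ _ X]funext do rewrite E ReM.
  by rewrite ReM; apply: is_deriveB; exact: lin.
under [X in is_derive _ _ X]funext do rewrite E ImM.
by rewrite ImM; apply: is_deriveD; exact: lin.
Qed.

Lemma wave_dx (c : C) t x :
  is_derive x 1 (fun s => Re (wave t s * c)) (Re (wave t x * (K * c))) /\
  is_derive x 1 (fun s => Im (wave t s * c)) (Im (wave t x * (K * c))).
Proof.
have [h1 h2] := is_derive_expc K x.
set d := expc lambda t * c.
have E s : wave t s * c = expc K s * d by rewrite /wave /d; ring.
have -> : wave t x * (K * c) = K * expc K x * d by rewrite /wave /d; ring.
have lin (f : R -> R) (e l : R) : is_derive x 1 f l -> is_derive x 1 (fun s => f s * e) (l * e).
  move=> hf; apply: (@is_derive_eq _ _ _ _ _ _ _ _ (is_deriveM hf (is_derive_cst e x 1))).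
  by rewrite /GRing.scale /= mulr0 add0r mulrC.
split.
  under [X in is_derive _ _ X]funext do rewrite E ReM.
  by rewrite ReM; apply: is_deriveB; exact: lin.
under [X in is_derive _ _ X]funext do rewrite E ImM.
by rewrite ImM; apply: is_deriveD; exact: lin.
Qed.

Lemma wave_dy F (z : C) t x y : hasDC F y z ->
  hasDC (fun s => wave t x * F s) y (wave t x * z).
Proof. exact: hasDCZ. Qed.

(** The functions [Re (wave * F)], with [F] smooth, are stable under all three
    derivations: those in [t] and [x] multiply [F] by a constant. The equality is
    asserted for [y >= 0] only, as [partial Dy] has no meaning elsewhere. *)
Lemma iterated_partials (s : seq direction) F : smooth_plusC F ->
  exists2 G, smooth_plusC G & forall t x y, 0 <= y ->
    foldr (@partial R) (fun t x y => Re (wave t x * F y)) s t x y = Re (wave t x * G y).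
Proof.
move=> sF; elim: s => [|d s [G sG IH]]; first by exists F.
case: d.
- exists (fun y => lambda * G y); first exact: smooth_plusCZ.
  move=> t x y y0 /=; under [X in derive1 X]funext do rewrite IH//.
  by have [h _] := wave_dt (G y) t x; rewrite derive1E; exact: derive_val.
- exists (fun y => K * G y); first exact: smooth_plusCZ.
  move=> t x y y0 /=; under [X in derive1 X]funext do rewrite IH//.
  by have [h _] := wave_dx (G y) t x; rewrite derive1E; exact: derive_val.
- exists (deriveC G); first exact: smooth_deriveC.
  move=> t x y y0 /=.
  have [h _] := wave_dy t x (deriveCP sG y0).
  have h' : hasD (fun z => foldr (@partial R) (fun t x y => Re (wave t x * F y)) s t x z) y
      (Re (wave t x * deriveC G y)).
    by apply: hasD_ext h => // z z0; rewrite IH.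
  by have [_ e] := hasD_derive y0 h'; exact: e.
Qed.

Lemma continuous_wave_part (u v : R -> R) (f : R -> R) : continuous u -> continuous v ->
  continuous f -> continuous (fun p : R * R * R => u p.1.1 * v p.1.2 * f p.2).
Proof.
move=> cu cv cf p.
have c1 : {for p, continuous (fun p : R * R * R => p.1.1)}.
  by apply: (@continuous_comp _ _ _ fst fst); exact: cvg_fst.
have c2 : {for p, continuous (fun p : R * R * R => p.1.2)}.
  by apply: (@continuous_comp _ _ _ fst snd); [exact: cvg_fst|exact: cvg_snd].
have c3 : {for p, continuous (fun p : R * R * R => p.2)} by exact: cvg_snd.
have d1 : {for p, continuous (fun p : R * R * R => u p.1.1)}.
  exact: (continuous_comp c1 (cu _)).
have d2 : {for p, continuous (fun p : R * R * R => v p.1.2)}.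
  exact: (continuous_comp c2 (cv _)).
have d3 : {for p, continuous (fun p : R * R * R => f p.2)}.
  exact: (continuous_comp c3 (cf _)).
exact: (cvgM (cvgM d1 d2) d3).
Qed.

Lemma continuous_expc (s : C) : continuous (fun t => Re (expc s t)) /\
  continuous (fun t => Im (expc s t)).
Proof.
split => t; have [h1 h2] := is_derive_expc s t.
  by apply: differentiable_continuous; apply/derivable1_diffP; exact: ex_derive.
by apply: differentiable_continuous; apply/derivable1_diffP; exact: ex_derive.
Qed.

Lemma smooth3_wave F : smooth_plusC F -> smooth3 (fun t x y => Re (wave t x * F y)).
Proof.
move=> sF s G0; rewrite /G0 {G0}; have [G sG GE] := iterated_partials s sF; split.
  move=> [] t x y _ y0 /=.
  - under [X in derivable X]funext do rewrite GE//.
    by have [h _] := wave_dt (G y) t x; exact: ex_derive.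
  - under [X in derivable X]funext do rewrite GE//.
    by have [h _] := wave_dx (G y) t x; exact: ex_derive.
  - have [h _] := wave_dy t x (deriveCP sG y0).
    have h' : hasD (fun z => foldr (@partial R) (fun t x y => Re (wave t x * F y)) s t x z)
       y (Re (wave t x * deriveC G y)).
      by apply: hasD_ext h => // z z0; rewrite GE.
    by have [] := hasD_derive y0 h'.
have [cG1 cG2] : contC G.
  by apply: (@hasDC_contC _ _ (deriveC G)) => y y0; exact: deriveCP.
have [l1 l2] := continuous_expc lambda; have [k1 k2] := continuous_expc K.
apply: (@subspace_eq_continuous _ _ _ (fun p : R * R * R =>
  Re (expc lambda p.1.1) * Re (expc K p.1.2) * Re (G (clamp p.2))
  + - (Im (expc lambda p.1.1) * Im (expc K p.1.2) * Re (G (clamp p.2)))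
  + - (Re (expc lambda p.1.1) * Im (expc K p.1.2) * Im (G (clamp p.2)))
  + - (Im (expc lambda p.1.1) * Re (expc K p.1.2) * Im (G (clamp p.2))))).
  move=> p /set_mem [_ p0]; apply: etrans (esym (GE _ _ _ p0)).
  by rewrite clampE// /wave !ReImE; ring.
apply: continuous_subspaceT => p.
have P (u v f : R -> R) (cu : continuous u) (cv : continuous v) (cf : continuous f) :=
  @continuous_wave_part u v f cu cv cf p.
apply: cvgD; first apply: cvgD; first apply: cvgD.
- exact: (P _ _ _ l1 k1 cG1).
- by apply: cvgN; exact: (P _ _ _ l2 k2 cG1).
- by apply: cvgN; exact: (P _ _ _ l1 k2 cG2).
- by apply: cvgN; exact: (P _ _ _ l2 k1 cG2).
Qed.

Lemma smooth3C_wave F : smooth_plusC F -> smooth3C (fun t x y => wave t x * F y).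
Proof.
move=> sF; split; first exact: smooth3_wave.
rewrite (_ : (fun t x y => Im (wave t x * F y)) =
  (fun t x y => Re (wave t x * (- 'i%C * F y)))).
  by apply: smooth3_wave; exact: smooth_plusCZ.
apply/funext => t; apply/funext => x; apply/funext => y; rewrite !ReImE; ring.
Qed.

Lemma partialC_dt F t x y : partialC Dt (fun t x y => wave t x * F y) t x y =
  wave t x * (lambda * F y).
Proof.
have [h1 h2] := wave_dt (F y) t x; apply: complex_eq; rewrite /partialC /partial ReImE.
  by rewrite derive1E; exact: derive_val.
by rewrite derive1E; exact: derive_val.
Qed.

Lemma partialC_dx F t x y : partialC Dx (fun t x y => wave t x * F y) t x y =
  wave t x * (K * F y).
Proof.
have [h1 h2] := wave_dx (F y) t x; apply: complex_eq; rewrite /partialC /partial ReImE.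
  by rewrite derive1E; exact: derive_val.
by rewrite derive1E; exact: derive_val.
Qed.

Lemma partialC_dy F (z : C) (U : R -> R -> R -> C) t x y : 0 <= y ->
  (forall s, 0 <= s -> U t x s = wave t x * F s) -> hasDC F y z ->
  partialC Dy U t x y = wave t x * z.
Proof.
move=> y0 UE dF; have dU : hasDC (fun s => U t x s) y (wave t x * z).
  apply: hasDC_ext (wave_dy t x dF) => // s s0; by rewrite UE.
have [h1 h2] := dU; apply: complex_eq; rewrite /partialC /partial ReImE.
  by have [] := hasD_derive y0 h1.
by have [] := hasD_derive y0 h2.
Qed.

End Separated.
End Smoothness.

(** * Improper integrals and Fourier modes *)

Section Integrals.
Variable R : realType.
Local Notation C := R[i].
Local Notation Re := complex.Re.
Local Notation Im := complex.Im.
Local Notation mu := (@lebesgue_measure R).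
Implicit Types x y t : R.

Lemma RplusE : @Rplus R = `[0, +oo[%classic.
Proof. by rewrite set_itvcy. Qed.

Lemma contP_measurable (f : R -> R) : contP f -> measurable_fun (@Rplus R) f.
Proof.
move=> cf; apply: (eq_measurable_fun (f \o @clamp R)).
  by move=> z /set_mem z0 /=; rewrite clampE.
apply: measurable_funTS; exact: continuous_measurable_fun.
Qed.

Lemma contP_at_right (f : R -> R) : contP f -> f x @[x --> 0^'+] --> f 0.
Proof.
move=> cf.
have h : f (clamp x) @[x --> 0^'+] --> f (clamp 0).
  by apply: cvg_at_right_filter; exact: cf.
rewrite clampE// in h; apply: cvg_trans h.
apply: near_eq_cvg; near=> z; rewrite clampE//.
Unshelve. all: by end_near. Qed.

Lemma ge0_improper_integral (f F : R -> R) (l : R) : contP f ->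
  (forall y, 0 <= y -> 0 <= f y) -> (forall y, 0 <= y -> hasD F y (f y)) ->
  F y @[y --> +oo] --> l ->
  (\int[mu]_(y in @Rplus R) (f y)%:E = l%:E - (F 0)%:E)%E.
Proof.
move=> cf f0 dF Fl; rewrite RplusE.
apply: (@ge0_continuous_FTC2y _ f F 0 l) => //.
- by rewrite -RplusE; exact: contP_within.
- by move=> x x0; have := hasD_is_derive x0 (dF x (ltW x0)) => h; exact: ex_derive.
- by apply: contP_at_right; exact: hasD_contP dF.
- move=> x; rewrite in_itv/= andbT => x0.
  by have := hasD_is_derive x0 (dF x (ltW x0)) => h; rewrite derive1E; exact: derive_val.
Qed.

(** Bridge from primitives to the Lebesgue integral. Monotone convergence gives the
    formula for nonnegative functions; [f] is the difference of [f + `|f|] and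
    [`|f|]. *)
Lemma improper_integral (f F n N : R -> R) (l B : R) : contP f ->
  (forall y, 0 <= y -> hasD F y (f y)) -> F y @[y --> +oo] --> l ->
  (forall y, 0 <= y -> `|f y| <= n y) -> (forall y, 0 <= y -> hasD N y (n y)) ->
  (forall y, 0 <= y -> N y <= B) ->
  mu.-integrable (@Rplus R) (EFin \o f) /\ (\int[mu]_(y in @Rplus R) f y)%R = l - F 0.
Proof.
move=> cf dF Fl fn dN NB.
have cn := contP_norm cf.
have [P P0 dP] := primitive_exists cn.
have [p Pp] : exists p : R, P y @[y --> +oo] --> p.
  apply: (@bounded_monotone_cvg _ P (B - N 0)) => [x y x0 xy|y y0].
    have := @hasD_le _ (fun=> 0 : R) P (fun=> 0 : R) _ x y
      (fun z _ => hasD_cst _ _) dP x0 xy.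
    by rewrite subrr subr_ge0; apply.
  have := hasD_le dP dN (lexx 0) y0 fn; rewrite P0 subr0 => h.
  by apply: le_trans h _; rewrite lerD2r NB.
have intn : mu.-integrable (@Rplus R) (EFin \o (fun y => `|f y|)).
  apply/integrableP; split; first by apply/measurable_EFinP; exact: contP_measurable.
  have -> : (\int[mu]_(x in @Rplus R) `|(EFin \o (fun y => `|f y|%R)) x| =
      \int[mu]_(x in @Rplus R) (`|f x|%R)%:E)%E.
    by apply: eq_integral => x _ /=; rewrite normr_id.
  by rewrite (ge0_improper_integral cn (fun y _ => normr_ge0 _) dP Pp) ltry.
have intf : mu.-integrable (@Rplus R) (EFin \o f).
  apply/integrableP; split; first by apply/measurable_EFinP; exact: contP_measurable.
  have -> : (\int[mu]_(x in @Rplus R) `|(EFin \o f) x| =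
      \int[mu]_(x in @Rplus R) (`|f x|%R)%:E)%E by apply: eq_integral.
  by rewrite (ge0_improper_integral cn (fun y _ => normr_ge0 _) dP Pp) ltry.
split => //.
have csum := contPD cf cn.
have sum0 y : 0 <= y -> 0 <= f y + `|f y|.
  by move=> _; have := lerNnormlW (lexx `|f y|); lra.
have dsum y : 0 <= y -> hasD (fun y => F y + P y) y (f y + `|f y|).
  by move=> y0; apply: hasDD; [exact: dF|exact: dP].
have Fsum : F y + P y @[y --> +oo] --> l + p by exact: cvgD.
have i1 : (\int[mu]_(y in @Rplus R) (f y + `|f y|))%R = (l + p) - (F 0 + P 0).
  by rewrite /Rintegral (ge0_improper_integral csum sum0 dsum Fsum).
have i2 : (\int[mu]_(y in @Rplus R) `|f y|)%R = p - P 0.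
  by rewrite /Rintegral (ge0_improper_integral cn (fun y _ => normr_ge0 _) dP Pp).
have : (\int[mu]_(y in @Rplus R) (f y + `|f y|) =
    \int[mu]_(y in @Rplus R) f y + \int[mu]_(y in @Rplus R) `|f y|)%R.
  by apply: RintegralD => //; rewrite RplusE; exact: measurable_itv.
have alg (I q z : R) : l + q - (z + 0) = I + (q - 0) -> I = l - z by lra.
by rewrite i1 i2 P0; exact: alg.
Qed.

Definition freq (c : R) : C := 'i%C * c%:C%C.

Lemma expc_add (s s' : C) x : expc s x * expc s' x = expc (s + s') x.
Proof. by rewrite /expc mulrDl cexpD. Qed.

Lemma expc_shift (s : C) x y : expc s (x + y) = expc s x * expc s y.
Proof. by rewrite /expc -cexpD -mulrDr; congr (cexp (_ * _)); exact: rmorphD. Qed.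

Lemma expc_period_nat (n : nat) : expc (freq n%:R) (2 * pi) = 1.
Proof.
elim: n => [|n IH]; first by rewrite /expc /freq mulr0 mul0r cexp0.
have -> : freq n.+1%:R = freq n%:R + freq 1.
  by rewrite /freq -mulrDr -natr1; congr (_ * _); exact: rmorphD.
rewrite -expc_add IH mul1r /expc /freq.
have -> : 'i%C * 1%:C%C * (2 * pi)%:C%C = (0 +i* (pi *+ 2))%C :> C.
  by apply: complex_eq; rewrite !ReImE; ring.
by apply: complex_eq; rewrite /cexp !ReImE expR0 mul1r ?cos2pi ?sin2pi.
Qed.

Lemma expc_period (j : int) : expc (freq j%:~R) (2 * pi) = 1.
Proof.
case: (intP j) => [|n|n]; first exact: (expc_period_nat 0).
  exact: (expc_period_nat n.+1).
have -> : freq (- (n.+1%:Z))%:~R = - freq n.+1%:R.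
  by apply: complex_eq; rewrite /freq !ReImE mulrNz; ring.
have := expcK (freq n.+1%:R) (2 * pi).
by rewrite expc_period_nat mul1r.
Qed.

Lemma integral_period (f F : R -> R) : (forall x, is_derive x 1 F (f x)) ->
  continuous f -> (\int[mu]_(x in @period R) f x)%R = F (2 * pi) - F 0.
Proof.
move=> dF cf.
have -> : @period R = `[0, 2 * pi]%classic by rewrite set_itvcc.
have cF : continuous F.
  move=> x; apply: differentiable_continuous; apply/derivable1_diffP.
  by have := dF x => h; exact: ex_derive.
rewrite /Rintegral (@continuous_FTC2 _ f F) //.
- by rewrite mulr_gt0 ?pi_gt0.
- exact: continuous_subspaceT.
- split.
  + by move=> x _; have := dF x => h; exact: ex_derive.
  + by apply: cvg_at_right_filter; exact: cF.
  + by apply: cvg_at_left_filter; exact: cF.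
- by move=> x _; have := dF x => h; rewrite derive1E; exact: derive_val.
Qed.

Lemma is_derive_scaled_expc (A s : C) x :
  is_derive x 1 (fun y => Re (A * expc s y)) (Re (A * (s * expc s x))) /\
  is_derive x 1 (fun y => Im (A * expc s y)) (Im (A * (s * expc s x))).
Proof.
have [h1 h2] := wave_dx 0 s A 0 x.
have E y : wave 0 s 0 y * A = A * expc s y.
  by rewrite /wave /expc mul0r cexp0 mul1r mulrC.
have E' : wave 0 s 0 x * (s * A) = A * (s * expc s x).
  by rewrite /wave /expc mul0r cexp0 mul1r; ring.
by rewrite E' in h1 h2; split; under [X in is_derive _ _ X]funext do rewrite -E.
Qed.

Lemma continuous_scaled_expc (A s : C) :
  continuous (fun y => Re (A * expc s y)) /\ continuous (fun y => Im (A * expc s y)).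
Proof.
split => x; have [h1 h2] := is_derive_scaled_expc A s x.
  by apply: differentiable_continuous; apply/derivable1_diffP; exact: ex_derive.
by apply: differentiable_continuous; apply/derivable1_diffP; exact: ex_derive.
Qed.

Lemma integralC_freq0 (A : C) (j : int) : j != 0 ->
  integralC (@period R) (fun x => A * expc (freq j%:~R) x) = 0.
Proof.
move=> j0; set s := freq _.
have s0 : s != 0.
  rewrite /s /freq mulf_eq0 negb_or; apply/andP; split.
    by rewrite eq_complex /= negb_and oner_eq0 orbT.
  by rewrite eq_complex /= eqxx andbT intr_eq0.
have [c1 c2] := continuous_scaled_expc A s.
pose B := A / s.
have BA x : B * (s * expc s x) = A * expc s x by rewrite /B; field.
have per : B * expc s (2 * pi) = B * expc s 0 by rewrite expc_period expc0.
have d1 x : is_derive x 1 (fun y => Re (B * expc s y)) (Re (A * expc s x)).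
  by have [+ _] := is_derive_scaled_expc B s x; rewrite BA.
have d2 x : is_derive x 1 (fun y => Im (B * expc s y)) (Im (A * expc s x)).
  by have [_ +] := is_derive_scaled_expc B s x; rewrite BA.
apply: complex_eq; rewrite /integralC ReImE.
  by rewrite (integral_period d1 c1) per subrr.
by rewrite (integral_period d2 c2) per subrr.
Qed.

Lemma integrableC_freq (A s : C) : integrableC (@period R) (fun x => A * expc s x).
Proof.
have [c1 c2] := continuous_scaled_expc A s.
have -> : @period R = `[0, 2 * pi]%classic by rewrite set_itvcc.
by split; apply: continuous_compact_integrable; (try exact: segment_compact);
  apply: continuous_subspaceT.
Qed.

Lemma fourier_freq (A : C) (k n : int) : n != k ->
  fourier (fun x => A * expc (freq k%:~R) x) n = 0.
Proof.
move=> nk; rewrite /fourier.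
have -> : (fun x => A * expc (freq k%:~R) x * cexp (- ('i%C * (n%:~R * x)%:C%C))) =
    (fun x => A * expc (freq (k - n)%:~R) x).
  apply/funext => x; rewrite -mulrA /expc -cexpD; congr (_ * cexp _).
  by apply: complex_eq; rewrite /freq !ReImE intrB; ring.
by rewrite integralC_freq0 ?mulr0// subr_eq0 eq_sym.
Qed.

Lemma fourier_scale (A : C) (c : R) (k : int) n :
  fourier (fun x => (c%:C%C * A) * expc (freq k%:~R) x) n =
  c%:C%C * fourier (fun x => A * expc (freq k%:~R) x) n.
Proof.
rewrite /fourier mulrCA; congr (_ * _).
have E x : A * expc (freq k%:~R) x * cexp (- ('i%C * (n%:~R * x)%:C%C)) =
    A * expc (freq (k - n)%:~R) x.
  rewrite -mulrA /expc -cexpD; congr (_ * cexp _).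
  by apply: complex_eq; rewrite /freq !ReImE intrB; ring.
have Ec x : (c%:C%C * A) * expc (freq k%:~R) x * cexp (- ('i%C * (n%:~R * x)%:C%C)) =
    c%:C%C * (A * expc (freq (k - n)%:~R) x).
  by rewrite -mulrA -mulrA [A * (_ * _)]mulrA E.
rewrite (funext E) (funext Ec).
have [i1 i2] := integrableC_freq A (freq (k - n)%:~R).
have mp : measurable (@period R).
  by have -> : @period R = `[0, 2 * pi]%classic by rewrite set_itvcc.
apply: complex_eq; rewrite /integralC !ReImE mul0r ?subr0 ?addr0.
  rewrite -RintegralZl//; apply: eq_Rintegral => x _.
  by rewrite !ReImE; ring.
rewrite -RintegralZl//; apply: eq_Rintegral => x _.
by rewrite !ReImE; ring.
Qed.

(** At the frequency [k] the multiplier is [k]; at the others both Fourier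
    coefficients vanish. *)
Lemma DN_freq (A : C) (k : nat) :
  is_DN (fun x => A * expc (freq k%:R) x)
        (fun x => ((k%:R)%:C%C * A) * expc (freq k%:R) x).
Proof.
split; [exact: integrableC_freq|exact: integrableC_freq|] => n.
have e : freq (k%:R : R) = freq (k%:Z)%:~R by rewrite pmulrn.
rewrite e fourier_scale.
have [->|nk] := eqVneq n k%:Z; last by rewrite fourier_freq// !mulr0.
congr (_ * _); rewrite ger0_norm// -pmulrn.
exact: rmorph_nat.
Qed.

End Integrals.

(** * From the mode to the instability *)

Section FromModeToInstability.
Variable R : realType.
Local Notation C := R[i].
Local Notation Re := complex.Re.
Local Notation Im := complex.Im.
Local Notation mu := (@lebesgue_measure R).
Implicit Types x y t : R.

Variables (Us : R -> R) (nu : R) (k : nat) (lambda : C) (delta : R).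
Local Notation Us' := (derivn_plus 1 Us).
Local Notation K := (freq (k%:R : R)).
Hypothesis Us_smooth : smooth_plus Us.
Hypothesis k1 : (1 <= k)%N.
Hypothesis Re_lambda : 0 < Re lambda.
Hypothesis delta_nu : Num.sqrt nu * (k%:R * delta) = 1.
Variables (Z w v : R -> C) (N : R -> R) (B : R).
Hypothesis dZ : forall y, 0 <= y -> hasDC Z y (- w y).
Hypothesis dw : forall y, 0 <= y -> hasDC w y (v y).
Hypothesis dv : forall y, 0 <= y -> hasDC v y (lambda * w y
  + K * ((Us y)%:C%C * w y + (Us' y)%:C%C * (Z y - delta%:C%C))
  + K * (1 - Us y + y * Us' y)%:C%C).
Hypothesis Z0 : Z 0 = delta%:C%C.
Hypothesis w0 : w 0 = 1.
Hypothesis Z_lim : cvgC_infty Z 0.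
Hypothesis w_lim : cvgC_infty w 0.
Hypothesis dN : forall y, 0 <= y -> hasD N y (nrm (w y)).
Hypothesis N_bound : forall y, 0 <= y -> N y <= B.

Let cU y : C := 1 - w y.
Let cV y : C := - K * (y%:C%C - delta%:C%C + Z y).

(** [Z], [w] and [v] form a linear differential system with smooth coefficients:
    each is once more differentiable than the least regular of the three. *)
Lemma mode_smooth n : [/\ diffnC n Z, diffnC n w & diffnC n v].
Proof.
have sU m : diffn m Us by exact: smooth_diffn.
have sU' m : diffn m Us'.
  by apply: smooth_diffn => j y y0; have := @Us_smooth j.+1 y y0; rewrite /derivn_plus iterSr.
elim: n => [|n [hZ hw hv]]; first by split; split.
split.
- by apply: diffnC_derivative dZ _; exact: diffnCN.
- exact: diffnC_derivative dw _.
- apply: diffnC_derivative dv _; apply: diffnCD; first apply: diffnCD.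
  + by apply: diffnCM => //; exact: diffnC_cst.
  + apply: diffnCM; first exact: diffnC_cst.
    apply: diffnCD; first by apply: diffnCM => //; exact: diffnC_real.
    apply: diffnCM; first exact: diffnC_real.
    by apply: diffnCB => //; exact: diffnC_cst.
  + apply: diffnCM; first exact: diffnC_cst.
    apply: diffnC_real; apply: diffnD; last by apply: diffnM => //; exact: diffn_id.
    by apply: diffnD; [exact: diffn_cst|exact: diffnN].
Qed.

Lemma cU_smooth : smooth_plusC cU.
Proof.
apply: diffnC_smooth => n; have [_ hw _] := mode_smooth n.
by apply: diffnCB => //; exact: diffnC_cst.
Qed.

Lemma cV_smooth : smooth_plusC cV.
Proof.
apply: diffnC_smooth => n; have [hZ _ _] := mode_smooth n.
apply: diffnCM; first exact: diffnC_cst.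
apply: diffnCD => //; apply: diffnCB; last exact: diffnC_cst.
by apply: diffnC_real; exact: diffn_id.
Qed.

Lemma dcU y : 0 <= y -> hasDC cU y (- v y).
Proof.
move=> y0; apply: hasDC_eq (hasDCB (hasDC_cst 1 y) (dw y0)) _; exact: sub0r.
Qed.

Lemma dcV y : 0 <= y -> hasDC cV y (- K * cU y).
Proof.
move=> y0; apply: hasDC_eq.
  apply: hasDCZ; apply: hasDCD (dZ y0); apply: hasDCB (hasDC_cst _ _).
  exact: hasDC_real (hasD_id y).
by rewrite /cU subr0.
Qed.

Local Notation mode := (wave lambda K).

Lemma modeE t x : cexp (lambda * t%:C%C) * cexp ('i%C * (k%:R * x)%:C%C) = mode t x.
Proof. by rewrite /wave /expc /freq realCM mulrA. Qed.

Lemma mode_periodic t (c : C) : Defs.periodic (fun x => mode t x * c).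
Proof. by move=> x; rewrite /wave expc_shift expc_period_nat mulr1. Qed.

Lemma mode_mean_free t (c : C) : mean_free (fun x => mode t x * c).
Proof.
rewrite /mean_free -[RHS](@integralC_freq0 R (expc lambda t * c) k%:Z).
  by congr integralC; apply/funext => x; rewrite /wave -pmulrn; ring.
by rewrite eqz_nat -lt0n.
Qed.

(** The integrand is [mode * w], with primitive [- mode * Z]: its integral is
    [mode * Z 0]. *)
Lemma mode_displacement t x :
  integrableC (@Rplus R) (fun y => mode t x * 1 - mode t x * cU y) /\
  integralC (@Rplus R) (fun y => mode t x * 1 - mode t x * cU y) = mode t x * delta%:C%C.
Proof.
set m := mode t x.
have -> : (fun y => m * 1 - m * cU y) = (fun y => m * w y).
  by apply/funext => y; rewrite /cU; ring.
have cw : contC (fun y => m * w y).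
  by apply: contCM; [exact: contC_cst|exact: hasDC_contC dw].
have dmZ y : 0 <= y -> hasDC (fun y => - (m * Z y)) y (m * w y).
  move=> y0; apply: hasDC_eq; first by apply: hasDCN; apply: hasDCZ; exact: dZ.
  by ring.
have [l1 l2] : cvgC_infty (fun y => - (m * Z y)) (- (m * 0)).
  by apply: cvgCN; apply: cvgCM => //; exact: cvgC_cst.
have dmN y : 0 <= y -> hasD (fun y => nrm m * N y) y (nrm m * nrm (w y)).
  by move=> y0; apply: hasDZ; exact: dN.
have mNB y : 0 <= y -> nrm m * N y <= nrm m * B.
  by move=> y0; apply: ler_wpM2l; [exact: nrm_ge0|exact: N_bound].
have [i1 e1] := @improper_integral _ (fun y => Re (m * w y)) (fun y => Re (- (m * Z y)))
  (fun y => nrm m * nrm (w y)) (fun y => nrm m * N y) (Re (- (m * 0))) (nrm m * B)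
  cw.1 (fun y hy => (dmZ y hy).1) l1
  (fun y _ => le_trans (nrm_Re _) (nrmM m (w y))) dmN mNB.
have [i2 e2] := @improper_integral _ (fun y => Im (m * w y)) (fun y => Im (- (m * Z y)))
  (fun y => nrm m * nrm (w y)) (fun y => nrm m * N y) (Im (- (m * 0))) (nrm m * B)
  cw.2 (fun y hy => (dmZ y hy).2) l2
  (fun y _ => le_trans (nrm_Im _) (nrmM m (w y))) dmN mNB.
split; first by split.
apply: complex_eq; rewrite /integralC ReImE.
  by rewrite e1 Z0 mulr0 oppr0 ReN opprK add0r.
by rewrite e2 Z0 mulr0 oppr0 ImN opprK add0r.
Qed.

Lemma mode_instability : displays_instability (linearized_IBL nu Us) lambda k.
Proof.
split => //; exists cU, cV => m U V ue.
have mE : m = mode by apply/funext => t; apply/funext => x; exact: modeE.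
have UE : U = (fun t x y => mode t x * cU y) by rewrite /U mE.
have VE : V = (fun t x y => mode t x * cV y) by rewrite /V mE.
have ueE : ue = (fun t x => mode t x * 1) by rewrite /ue mE.
have leE : lift_edge ue = (fun t x y => mode t x * (fun=> 1) y) by rewrite ueE.
have s1 : smooth_plusC (fun=> 1 : C) by apply: diffnC_smooth => n; exact: diffnC_cst.
split; [exact: cU_smooth|exact: cV_smooth| |].
  rewrite leE UE VE; split; apply: smooth3C_wave => //.
  - exact: cU_smooth.
  - exact: cV_smooth.
split.
- by move=> t y _ _; rewrite UE; exact: mode_periodic.
- by move=> t y _ _; rewrite VE; exact: mode_periodic.
- by move=> t _; rewrite ueE; exact: mode_periodic.
- by move=> t y _ _; rewrite UE; exact: mode_mean_free.
- by move=> t y _ _; rewrite VE; exact: mode_mean_free.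
- by move=> t _; rewrite ueE; exact: mode_mean_free.
- move=> t x y _ /ltW y0.
  have dyU z : 0 <= z -> partialC Dy U t x z = mode t x * (- v z).
    by move=> z0; apply: partialC_dy (dcU z0) => // s _; rewrite UE.
  have dv' := hasDCN (dv y0).
  rewrite (partialC_dy y0 dyU dv') leE UE !partialC_dt !partialC_dx VE /cU /cV.
  rewrite realCD realCB realCM.
  have -> : real_complex R 1 = 1 by [].
  set b := real_complex R (Us' y); set a := real_complex R (Us y).
  set yy := real_complex R y.
  by ring.
- move=> t x y _ /ltW y0.
  have dyV : partialC Dy V t x y = mode t x * (- K * cU y).
    by apply: partialC_dy (dcV y0) => // s _; rewrite VE.
  by rewrite dyV UE partialC_dx; ring.
- by move=> t x _; rewrite UE /cU w0 subrr mulr0.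
- by move=> t x _; rewrite VE /cV Z0 sub0r addNr !mulr0.
- move=> t x _; rewrite UE ueE.
  have := cvgCM (cvgC_cst (mode t x)) (cvgCD (cvgC_cst 1) (cvgCN w_lim)).
  by rewrite oppr0 addr0.
- by move=> t x _; rewrite UE ueE; exact: (mode_displacement t x).1.
- move=> t _.
  exists (fun x => (k%:R%:C%C * (expc lambda t * delta%:C%C)) * expc K x).
    have -> : (fun x => integralC (@Rplus R) (fun y => ue t x - U t x y)) =
        (fun x => expc lambda t * delta%:C%C * expc K x).
      by apply/funext => x; rewrite UE ueE (mode_displacement t x).2 /wave mulrAC.
    exact: DN_freq.
  move=> x; rewrite ueE.
  transitivity ((Num.sqrt nu * (k%:R * delta))%:C%C * mode t x).
    by rewrite delta_nu mulr1 mul1r.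
  rewrite /wave !realCM.
  set s := real_complex R (Num.sqrt nu); set kk := real_complex R k%:R.
  set d := real_complex R delta.
  by ring.
Qed.

End FromModeToInstability.

(** * The admissible flow *)

Section AdmissibleProfile.
Variable R : realType.
Local Notation mu := (@lebesgue_measure R).
Implicit Types x y : R.

Variables (Us : R -> R).
Hypothesis hUs : admissible_shear_flow Us.
Local Notation b := (derivn_plus 1 Us).
Local Notation b' := (derivn_plus 2 Us).

Lemma derivative_Us y : 0 <= y -> hasD Us y (b y).
Proof. by move=> y0; apply: derivable_hasD; exact: (@asf_smooth _ _ hUs 0%N y y0). Qed.

Lemma derivative_Us' y : 0 <= y -> hasD b y (b' y).
Proof. by move=> y0; apply: derivable_hasD; exact: (@asf_smooth _ _ hUs 1%N y y0). Qed.

Lemma Us_in01 y : 0 <= y -> 0 <= Us y <= 1.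
Proof. by move=> /(asf_range hUs)/andP[-> /ltW]. Qed.

Lemma Us'_ge0 y : 0 <= y -> 0 <= b y.
Proof. by move=> /(asf_incr hUs)/ltW. Qed.

Lemma cont_Us : contP Us. Proof. exact: hasD_contP derivative_Us. Qed.
Lemma cont_Us' : contP b. Proof. exact: hasD_contP derivative_Us'. Qed.

Lemma Us_nondecreasing x y : 0 <= x -> x <= y -> Us x <= Us y.
Proof.
move=> x0 xy; rewrite -subr_ge0.
have := @hasD_le _ (fun=> 0 : R) Us (fun=> 0 : R) _ x y
  (fun z _ => hasD_cst _ _) derivative_Us x0 xy.
by rewrite subrr; apply => z xz; apply: Us'_ge0; exact: le_trans xz.
Qed.

Lemma contP_bounded (f : R -> R) c : 0 <= c -> contP f ->
  exists B, forall y, 0 <= y -> y <= c -> f y <= B.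
Proof.
move=> c0 cf; have [z _ hz] := EVT_max c0 (contP_itv (lexx 0) cf).
by exists (f z) => y y0 yc; apply: hz; rewrite in_itv/= y0.
Qed.

(** Beyond the last inflection point the shear decreases, so that half of
    [y * b y] is at most the increase of the flow over [y / 2, y]. *)
Lemma shear_bounded_by_concavity : exists B, forall y, 0 <= y -> b y <= B /\ y * b y <= B.
Proof.
have [kappa [yk [ck [_ yk0 ck0 hk]]]] := asf_concave hUs.
have b'_neg y : yk <= y -> b' y <= 0.
  move=> ky; have y0 : 0 <= y by apply: le_trans ky; exact: ltW.
  have h := hk y ky; have /andP[_ U1] := asf_range hUs y0.
  have p0 : 0 < (1 - Us y) `^ (2 - kappa) by rewrite powR_gt0// subr_gt0.
  have b3 : 0 <= b y ^+ 3 by rewrite exprn_ge0// Us'_ge0.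
  rewrite leNgt; apply/negP => b0; have := mulr_gt0 p0 b0.
  by rewrite ltNge => /negP; apply; apply: le_trans h _; rewrite mulNr oppr_le0 mulr_ge0// ltW.
have b_dec x y : yk <= x -> x <= y -> b y <= b x.
  move=> kx xy; have x0 : 0 <= x by apply: le_trans kx; exact: ltW.
  have := @hasD_le _ b (fun=> 0 : R) _ (fun=> 0 : R) x y
    derivative_Us' (fun z _ => hasD_cst _ _) x0 xy.
  by rewrite subrr subr_le0; apply => z xz; apply: b'_neg; exact: le_trans xz.
have far y : yk * 2 <= y -> y * b y <= 2.
  move=> ky; have y2 : yk <= y / 2 by rewrite ler_pdivlMr.
  have y20 : 0 <= y / 2 by apply: le_trans y2; exact: ltW.
  have y2y : y / 2 <= y by lra.
  have y0 : 0 <= y by lra.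
  have : b y * y - b y * (y / 2) <= Us y - Us (y / 2).
    apply: (hasD_le_itv (fun z _ => hasD_lin (b y) z) derivative_Us) => // z z1 z2.
    by apply: b_dec => //; exact: le_trans z1.
  have /andP[_ u1] := Us_in01 y0; have /andP[u2 _] := Us_in01 y20; lra.
have c0 : 0 <= yk * 2 by rewrite mulr_ge0// ltW.
have [B1 h1] := contP_bounded c0 cont_Us'.
have [B2 h2] := contP_bounded c0 (contPM (@contP_id R) cont_Us').
exists (`|B1| + `|B2| + `|b yk| + 2) => y y0.
have n1 := normr_ge0 B1; have n2 := normr_ge0 B2; have n3 := normr_ge0 (b yk).
have a1 := ler_norm B1; have a2 := ler_norm B2; have a3 := ler_norm (b yk).
have [yc|cy] := leP y (yk * 2).
  by have := h1 y y0 yc; have := h2 y y0 yc; split; lra.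
have ky : yk <= y by lra.
by have := b_dec yk y (lexx _) ky; have := far y (ltW cy); split; lra.
Qed.

Definition displaced y : R := 1 - Us y.

Lemma cont_displaced : contP displaced.
Proof. by apply: contPB; [exact: contP_cst|exact: cont_Us]. Qed.

Lemma displaced_ge0 y : 0 <= y -> 0 <= displaced y.
Proof. by move=> /Us_in01/andP[_]; rewrite subr_ge0. Qed.

(** [D] is the displacement thickness above the height [y], so that [D 0] is
    [Delta]. *)
Lemma displacement_exists : exists D, [/\ forall y, 0 <= y -> hasD D y (- displaced y),
  D y @[y --> +oo] --> (0 : R), forall y, 0 <= y -> 0 <= D y & 0 < D 0].
Proof.
have [F F0 dF] := primitive_exists cont_displaced.
pose I := (\int[mu]_(y in @Rplus R) (displaced y)%:E)%E.
have Ifin : (I < +oo)%E by exact: asf_displacement hUs.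
have FI y : 0 <= y -> ((F y)%:E <= I)%E.
  rewrite le_eqVlt => /predU1P[<-|y0].
    by rewrite F0; apply: integral_ge0 => z z0; rewrite lee_fin displaced_ge0.
  have <- : (\int[mu]_(z in `[0%R, y]) (displaced z)%:E = (F y)%:E)%E.
    rewrite (@continuous_FTC2 _ displaced F) //.
    - by rewrite F0 sube0.
    - by apply: contP_itv => //; exact: cont_displaced.
    - have cF : contP F by exact: hasD_contP dF.
      split.
      + move=> z; rewrite in_itv/= => /andP[z0 _].
        by have := hasD_is_derive z0 (dF z (ltW z0)) => h; exact: ex_derive.
      + exact: contP_at_right.
      + have := hasD_is_derive y0 (dF y (ltW y0)) => h.
        apply: cvg_at_left_filter; apply: differentiable_continuous.
        by apply/derivable1_diffP; exact: ex_derive.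
    - move=> z; rewrite in_itv/= => /andP[z0 _].
      by have := hasD_is_derive z0 (dF z (ltW z0)) => h; rewrite derive1E; exact: derive_val.
  apply: ge0_subset_integral => //.
  - by rewrite RplusE; exact: measurable_itv.
  - by apply/measurable_EFinP; apply: contP_measurable; exact: cont_displaced.
  - by move=> z z0; rewrite lee_fin displaced_ge0.
  - by move=> z /=; rewrite in_itv/= => /andP[].
have I0 : (0 <= I)%E by have := FI 0 (lexx 0); rewrite F0.
have Ireal : I \is a fin_num by rewrite ge0_fin_numE.
have FB y : 0 <= y -> F y <= fine I.
  by move=> y0; rewrite -lee_fin fineK//; exact: FI.
have dom y : 0 <= y -> `|- displaced y| <= displaced y.
  by move=> y0; rewrite normrN ger0_norm// displaced_ge0.
have [D dD D0] := tail_exists (contPN cont_displaced) dom dF FB.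
have Dmono x y : 0 <= x -> x <= y -> D y <= D x.
  move=> x0 xy.
  have := @hasD_le _ D (fun=> 0 : R) _ (fun=> 0 : R) x y dD (fun z _ => hasD_cst _ _) x0 xy.
  rewrite subrr subr_le0; apply => z xz.
  by rewrite oppr_le0 displaced_ge0// (le_trans x0).
have Dge0 y : 0 <= y -> 0 <= D y.
  move=> y0; apply: le_of_all_eps => e e0; have [M M0 HM] := cvgy_near D0 e0.
  pose x := Num.max M y.
  have yx : y <= x by rewrite le_max lexx orbT.
  have := HM x; rewrite subr0 le_max lexx => /(_ isT); rewrite ler_norml => /andP[h _].
  by have := Dmono y x y0 yx; lra.
exists D; split => //.
have : D 1 - D 0 <= - displaced 1 * 1 - - displaced 1 * 0.
  apply: (hasD_le_itv dD (fun z _ => hasD_lin _ z)) => // z z0 z1.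
  by rewrite lerN2 lerD2l lerN2; exact: Us_nondecreasing.
have := Dge0 1 ler01; have /andP[_ u1] := asf_range hUs (@ler01 R).
by rewrite /displaced; lra.
Qed.

End AdmissibleProfile.

(** * Parameters and conclusion *)

Section Scales.
Variable R : realType.
Local Notation Re := complex.Re.

(** With [q = nu `^ (1 / 4)] one has [delta = 1 / (k q ^+ 2)] and
    [rho = k q sqrt Delta]. The four ratios to be made small are [1 / (rho delta)],
    which is [q / sqrt Delta]; [k delta / rho], which is [1 / (s sqrt Delta)] with
    [s = k q ^+ 3]; [delta = q / s]; and [1 / rho = q ^+ 2 / (s sqrt Delta)]. *)
Lemma small_parameters (Delta M nu kr : R) : 0 < Delta -> 1 <= M ->
  0 < nu <= (Num.min 1 (Num.sqrt Delta / (50 * 50))) ^+ 4 ->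
  50 * 50 * M * (1 + (Num.sqrt Delta)^-1) <= kr * nu `^ (3 / 4) -> 0 < kr ->
  exists delta rho : R, [/\ 0 < delta, 0 < rho,
    Num.sqrt nu * (kr * delta) = 1, rho ^+ 2 * delta = kr * Delta &
    Num.sqrt Delta / 2 * nu `^ (3 / 4) * kr ^+ 2 = rho / (2 * delta)] /\
  [/\ 50 * 50 <= rho * delta, 50 * 50 * (kr * delta) <= rho,
    50 * 50 * (M * delta) <= 1 & 50 * 50 * M <= rho].
Proof.
move=> D0 M1 /andP[nu0 nule] S_le k0.
set s := Num.sqrt Delta in nule S_le *.
have s0 : 0 < s by rewrite sqrtr_gt0.
have s2 : s ^+ 2 = Delta by rewrite sqr_sqrtr// ltW.
pose q := nu `^ (1 / 4).
have q0 : 0 < q by rewrite powR_gt0.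
have q4 : q ^+ 4 = nu.
  rewrite -powR_mulrn ?ltW// -powRrM (_ : 1 / 4 * 4%:R = 1); last by field.
  by rewrite powRr1// ltW.
have q3 : nu `^ (3 / 4) = q ^+ 3.
  rewrite -powR_mulrn ?ltW// -powRrM; congr (_ `^ _); by field.
have q2 : Num.sqrt nu = q ^+ 2.
  by rewrite -q4 (_ : q ^+ 4 = (q ^+ 2) ^+ 2) ?sqrtr_sqr ?ger0_norm ?exprn_ge0 ?ltW//; ring.
have : q <= Num.min 1 (s / (50 * 50)).
  have m0 : 0 <= Num.min 1 (s / (50 * 50)).
    by rewrite le_min ler01 divr_ge0 ?ltW// mulr_ge0.
  by rewrite -(@ler_pXn2r _ 4)// ?nnegrE ?q4// ltW.
rewrite le_min ler_pdivlMr ?mulr_gt0// => /andP[q1 qs].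
rewrite q3 in S_le; rewrite q3 q2.
have sV0 : 0 < s^-1 by rewrite invr_gt0.
have MV0 : 0 <= M * s^-1 by rewrite mulr_ge0 ?(ltW sV0)//; lra.
have h1 : 50 * 50 * M <= kr * q ^+ 3 by apply: le_trans S_le; lra.
have h2 : 50 * 50 * M <= kr * q ^+ 3 * s.
  have h : 50 * 50 * M * s^-1 <= kr * q ^+ 3.
    by apply: le_trans S_le; lra.
  by move: h; rewrite ler_pdivrMr.
have q20 : 0 < q ^+ 2 by rewrite exprn_gt0.
have qne : q != 0 by rewrite gt_eqF.
have kne : kr != 0 by rewrite gt_eqF.
have sne : s != 0 by rewrite gt_eqF.
exists (kr * q ^+ 2)^-1, (kr * q * s).
have e1 : kr * q * s * (kr * q ^+ 2)^-1 = s / q by field; rewrite kne qne.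
have e2 : kr * (kr * q ^+ 2)^-1 = (q ^+ 2)^-1 by field; rewrite kne qne.
split; split.
- by rewrite invr_gt0 mulr_gt0.
- by rewrite !mulr_gt0.
- by rewrite e2 mulfV// gt_eqF.
- by rewrite -s2; field; rewrite kne qne.
- by field; rewrite kne qne.
- by rewrite e1 ler_pdivlMr// mulrC.
- rewrite e2 ler_pdivrMr//.
  have -> : kr * q * s * q ^+ 2 = kr * q ^+ 3 * s by ring.
  by move: h2 M1; lra.
- rewrite mulrA ler_pdivrMr ?mulr_gt0// mul1r; apply: le_trans h1 _.
  rewrite ler_wpM2l ?(ltW k0)// exprSr ler_piMr// ltW//.
- apply: le_trans h2 _; rewrite ler_wpM2r ?(ltW s0)// ler_wpM2l ?(ltW k0)//.
  by rewrite exprSr ler_piMl ?(ltW q0)// exprn_ile1 ?(ltW q0).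
Qed.

End Scales.

Theorem theorem3 (R : realType) (Us : R -> R)
    (hUs : admissible_shear_flow Us) :
  exists nubar K S eta : R,
    [/\ 0 < nubar, 0 < K, 0 < S & 0 < eta] /\
    forall (nu : R) (k : nat),
      0 < nu <= nubar -> (1 <= k)%N -> K <= k%:R -> S <= k%:R * nu `^ (3 / 4) ->
      exists lambda : R[i],
        eta * nu `^ (3 / 4) * k%:R ^+ 2 <= complex.Re lambda /\
        displays_instability (linearized_IBL nu Us) lambda k.
Proof.
have [B hB] := shear_bounded_by_concavity hUs.
have [D [dD D_lim D_ge0 D0]] := displacement_exists hUs.
have Dne : D 0 != 0 by rewrite gt_eqF.
pose b := derivn_plus 1 Us.
have B0 : 0 <= B by apply: le_trans (hB 0 (lexx _)).1; exact: Us'_ge0.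
pose c := (2 * D 0)^-1.
have c0 : 0 < c by rewrite invr_gt0 mulr_gt0.
pose g y := c * (1 - Us y + y * b y).
pose H y := c * (2 * D y + y * (1 - Us y)).
pose M := 1 + c * (1 + B).
have M1 : 1 <= M by rewrite lerDl mulr_ge0 ?addr_ge0// ltW.
have s0 : 0 < Num.sqrt (D 0) by rewrite sqrtr_gt0.
have gM y : 0 <= y -> 0 <= g y <= M.
  move=> y0; have /andP[u0 u1] := Us_in01 hUs y0; have b0 := Us'_ge0 hUs y0.
  have [_ hb] := hB y y0; apply/andP; split.
    by apply: mulr_ge0; [exact: ltW|rewrite addr_ge0 ?subr_ge0// mulr_ge0].
  have : g y <= c * (1 + B) by apply: ler_wpM2l; [exact: ltW|rewrite /b; lra].
  by rewrite /M; lra.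
have dyU y : 0 <= y -> hasD (fun y => y * (1 - Us y)) y (1 - Us y - y * b y).
  move=> y0; apply: hasD_eq.
    by apply: hasDM (hasD_id y) (hasDB (hasD_cst 1 y) (derivative_Us hUs y0)).
  by rewrite /b; ring.
have dH y : 0 <= y -> hasD H y (- g y).
  move=> y0; apply: hasD_eq.
    by apply: hasDZ; apply: hasDD (dyU y y0); apply: hasDZ; exact: dD.
  by rewrite /g /displaced; ring.
have H0 : H 0 = 1 by rewrite /H mul0r addr0 /c mulVf// mulf_neq0.
have yU_le y : 0 <= y -> y * (1 - Us y) <= D 0 - D y.
  move=> y0; have dND z : 0 <= z -> hasD (fun z => - D z) z (1 - Us z).
    by move=> z0; apply: hasD_eq (hasDN (dD z z0)) _; rewrite opprK.
  have := hasD_le dyU dND (lexx 0) y0; rewrite mul0r subr0 => h.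
  have : y * (1 - Us y) <= - D y - - D 0.
    by apply: h => z z0; have := mulr_ge0 z0 (Us'_ge0 hUs z0); rewrite /b; lra.
  lra.
have H_bound y : 0 <= y -> 0 <= H y <= 3 / 2.
  move=> y0; have /andP[u0 u1] := Us_in01 hUs y0; have Dy := D_ge0 y y0.
  have p0 : 0 <= y * (1 - Us y) by rewrite mulr_ge0// subr_ge0.
  have hy := yU_le y y0; rewrite /H; apply/andP; split.
    by apply: mulr_ge0; [exact: ltW|lra].
  have -> : 3 / 2 = c * (3 * D 0) by rewrite /c; field.
  by apply: ler_wpM2l; [exact: ltW|lra].
have H_lim : H y @[y --> +oo] --> (0 : R).
  have l2 : (fun _ : R => 2 : R) y @[y --> +oo] --> (2 : R) by exact: cvg_cst.
  have lc : (fun _ : R => c) y @[y --> +oo] --> c by exact: cvg_cst.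
  have l := cvgM lc (cvgD (cvgM l2 D_lim) (asf_lim_mul hUs)).
  have e0 : c * (2 * 0 + 0) = 0 by ring.
  apply: near_cvgy => e epos.
  have [m _ hm] := cvgy_near (l _ _ _) epos.
  by exists m => y /hm; rewrite e0 /H !fctE /= [y * _]mulrC.
have cg : contP g.
  apply: contPM; first exact: contP_cst.
  apply: contPD; first by apply: contPB; [exact: contP_cst|exact: cont_Us].
  by apply: contPM; [exact: contP_id|exact: cont_Us'].
exists ((Num.min 1 (Num.sqrt (D 0) / (50 * 50))) ^+ 4), 1,
  (50 * 50 * M * (1 + (Num.sqrt (D 0))^-1)), (Num.sqrt (D 0) / 2); split.
  split.
  - by rewrite exprn_gt0// lt_min ltr01 divr_gt0// mulr_gt0.
  - exact: ltr01.
  - have M0 : 0 < M := lt_le_trans ltr01 M1.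
    apply: mulr_gt0; last by rewrite addr_gt0 // invr_gt0.
    by apply: mulr_gt0 => //; exact: mulr_gt0.
  - by rewrite divr_gt0.
move=> nu k nu_small k1 _ S_le.
have k0 : 0 < k%:R :> R by rewrite ltr0n.
have [delta [rho [[d0 r0 dnu rd ->] [sm1 sm2 sm3 sm4]]]] :=
  small_parameters D0 M1 nu_small S_le k0.
have [lambda [Z [w [v [N [Bn [[Rel Z0 w0 Zl wl] [dZ dw dv dN NB]]]]]]]] :=
  decaying_mode_exists (Us_in01 hUs) (Us'_ge0 hUs) (fun y hy => (hB y hy).1)
    (derivative_Us hUs) (cont_Us' hUs) H_bound H0 dH cg gM M1 k0 d0 r0 sm1 sm2 sm3 sm4
    (asf_infty hUs) H_lim.
exists lambda; split => //.
have l0 : 0 < complex.Re lambda by apply: lt_le_trans Rel; rewrite divr_gt0 ?mulr_gt0.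
(* It remains to recognize the forcing [i k (1 - Us + y Us')] of the momentum
   equation, by [sigma ^+ 2 = - 2 i rho ^+ 2] and [rho ^+ 2 * delta = k * D 0]. *)
apply: (mode_instability (asf_smooth hUs) k1 l0 dnu dZ dw _ Z0 w0 Zl wl dN NB) => y y0.
apply: hasDC_eq (dv y y0) _; rewrite -addrA -[RHS]addrA; congr (_ + (_ + _)).
have e : rho ^+ 2 * delta * c * 2 = k%:R by rewrite rd /c; field.
apply: complex_eq; rewrite /sigma /freq /g /b expr2 !ReImE; first by ring.
by rewrite -e; ring.
Qed.
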